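(* Let $k\in\mathbb{N}$, let $\mu$ be the standard Gaussian measure on $\mathbb{R}^k$, and let $f\in L^p(\mathbb{R}^k,\mu)$ for some $p\in\mathbb{R}_{>1}$. Then the nonstandard extension ${}^*f$ is $S$-integrable on $(S^{N-1}(\sqrt N),\bar\sigma_N)$ for all $N>\mathbb{N}$. As a consequence, $f$ is integrable on $(S^{n-1}(\sqrt n),\bar\sigma_n)$ for all large $n\in\mathbb{N}$, and $$\lim_{m\to\infty}\lim_{n\to\infty}\int_{S^{n-1}(\sqrt n)\cap\{|f|\ge m\}}|f|\,d\bar\sigma_n=0.$$ Furthermore, $$\lim_{n\to\infty}\int_{S^{n-1}(\sqrt n)}f\,d\bar\sigma_n=\int_{\mathbb{R}^k}f\,d\mu,$$ and this limit equals the single integral $\int_{S^{N-1}(\sqrt N)}\operatorname{st}({}^*f)\,dL\bar\sigma_N$ for any $N>\mathbb{N}$.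
   Context: Spheres: for $n\in\mathbb{N}$, $S^{n-1}(\sqrt n)$ is the sphere of radius $\sqrt n$ centered at the origin in $\mathbb{R}^n$ and $\bar\sigma_n$ is the unique rotation-invariant Borel probability measure on it. A function $f$ on $\mathbb{R}^k$ is regarded as a function on $\mathbb{R}^n$ ($n\ge k$) by composing with the projection onto the first $k$ coordinates. The standard Gaussian measure has mean zero and identity covariance. Nonstandard setting: fix a sufficiently saturated (at least $\aleph_1$-saturated) nonstandard extension ${}^*$ of a superstructure containing all $\mathbb{R}^n$, satisfying the transfer principle. $N>\mathbb{N}$ means $N\in{}^*\mathbb{N}\setminus\mathbb{N}$. Extending the sequence of probability spaces $(S^{n-1}(\sqrt n),\mathcal{B}(S^{n-1}(\sqrt n)),\bar\sigma_n)_{n}$ to ${}^*\mathbb{N}$ gives an internal probability space $(S^{N-1}(\sqrt N),{}^*\mathcal{B}(S^{N-1}(\sqrt N)),\bar\sigma_N)$ for each $N>\mathbb{N}$, and ${}^*f$ is regarded as an internal function on $S^{N-1}(\sqrt N)\subseteq{}^*\mathbb{R}^N$ via the first $k$ coordinates. ${}^*\mathbb{R}_{\mathrm{fin}}$ is the set of $x\in{}^*\mathbb{R}$ with $|x|\le m$ for some $m\in\mathbb{N}$; for such $x$, $\operatorname{st}(x)$ is the unique real infinitely close to $x$. The function $\operatorname{st}(F)$ is defined where $F$ is finite. For an internal finitely additive probability space $(\Omega,\mathcal{F},\nu)$, the Loeb measure $L\nu$ is the completion of the unique countably additive extension of $\operatorname{st}(\nu)$ from the algebra $\mathcal{F}$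 to $\sigma(\mathcal{F})$. An internal ${}^*$-integrable function $F\colon\Omega\to{}^*\mathbb{R}$ on an internal probability space $(\Omega,\mathcal{F},\nu)$ is $S$-integrable if $L\nu(F\in{}^*\mathbb{R}_{\mathrm{fin}})=1$ and $\operatorname{st}\left({}^*\!\int_\Omega|F|\mathbb{1}_{\{|F|>M\}}\,d\nu\right)=0$ for every $M>\mathbb{N}$, where ${}^*\!\int$ is the internal integral obtained by transfer. *)

(* Defs.v *)
From HB Require Import structures.
From mathcomp Require Import all_boot all_order all_algebra.
From mathcomp Require Import all_classical all_reals all_analysis.
From mathcomp Require Import measurable_realfun.
Set Implicit Arguments.
Unset Strict Implicit.
Unset Printing Implicit Defensive.
Import Order.TTheory GRing.Theory Num.Theory.
Import numFieldNormedType.Exports.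
Local Open Scope classical_set_scope.
Local Open Scope ring_scope.

(**md The superstructure is the universe of types, closed under [set], [*] and [->]. Its language
is higher-order logic: typed de Bruijn variables, a constant for every standard object,
application, equality, and quantifiers bounded by types. Membership is application, since
[set T] is [T -> Prop]; the other connectives are definable. *)

Inductive var : seq Type -> Type -> Type :=
| VZ T G : var (T :: G) T
| VS U G T : var G T -> var (U :: G) T.

Inductive term (G : seq Type) : Type -> Type :=
| TVar T : var G T -> term G T
| TCst T : T -> term G T
| TApp T U : term G (T -> U) -> term G T -> term G U.

Inductive form : seq Type -> Type :=
| FEq G T : term G T -> term G T -> form G
| FBot G : form G
| FImp G : form G -> form G -> form G
| FAll G T : form (T :: G) -> form G.

Arguments VZ {T G}.
Arguments VS {U G T} _.
Arguments TCst {G T} _.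
Arguments FBot {G}.
Arguments FAll {G} T _.

Record interp := Interp {
  car : Type -> Type ;
  cst_of : forall T, T -> car T ;
  app_of : forall T U, car (T -> U) -> car T -> car U }.

Section semantics.
Variable I : interp.

Fixpoint env (G : seq Type) : Type :=
  if G is T :: G' then (car I T * env G')%type else unit.

Fixpoint lookup G T (v : var G T) : env G -> car I T :=
  match v with
  | VZ _ _ => fun e => e.1
  | VS _ _ _ v' => fun e => lookup v' e.2
  end.

Fixpoint eval G T (e : env G) (t : term G T) : car I T :=
  match t with
  | TVar _ v => lookup v e
  | TCst _ c => cst_of I c
  | TApp _ _ f u => app_of (eval e f) (eval e u)
  end.

Fixpoint sat G (phi : form G) : env G -> Prop :=
  match phi with
  | FEq _ _ t u => fun e => eval e t = eval e u
  | FBot _ => fun=> False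
  | FImp _ phi psi => fun e => sat phi e -> sat psi e
  | FAll _ T phi => fun e => forall x : car I T, @sat (T :: _) phi (x, e)
  end.

End semantics.

Definition standard : interp := @Interp id (fun _ c => c) (fun _ _ f x => f x).

(**md [star T] is ${}^*T$, [std x] is ${}^*x$, and [app F x] is the value at [x] of the internal
function [F]; the elements of [star (set T)] are the internal subsets of ${}^*T$. Saturation
is $\aleph_1$-saturation: a countable family of internal sets with the finite intersection
property has a common point. *)
Record nsextension := NSExtension {
  star : Type -> Type ;
  std : forall T, T -> star T ;
  app : forall T U, star (T -> U) -> star T -> star U ;
  transfer : forall phi : form [::],
    sat (I := standard) phi tt <-> sat (I := Interp std app) phi tt ;
  saturation : forall T (A : nat -> star (set T)),
    (forall n, exists x : star T, forall i, (i <= n)%N -> app (A i) x = std True) ->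
    exists x : star T, forall i, app (A i) x = std True }.

Arguments std {n T} _.
Arguments app {n T U} _ _.

Section nonstandard_analysis.
Variable E : nsextension.

Definition internal_in T (x : star E T) (A : star E (set T)) : Prop :=
  app A x = std True.

Definition lift1 T U (g : T -> U) (x : star E T) : star E U := app (std g) x.

Definition lift2 T U V (g : T -> U -> V) (x : star E T) (y : star E U) : star E V :=
  app (app (std g) x) y.

Definition lift3 T U V W (g : T -> U -> V -> W) (x : star E T) (y : star E U)
  (z : star E V) : star E W := app (app (app (std g) x) y) z.

Definition lift_rel2 T U (r : T -> U -> Prop) (x : star E T) (y : star E U) : Prop :=
  lift2 r x y = std True.

(** [N] lies in ${}^*\mathbb{N} \setminus \mathbb{N}$. *)
Definition unlimited (N : star E nat) : Prop := forall n : nat, N <> std n.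

Section reals.
Variable R : realType.

Definition star_le : star E R -> star E R -> Prop := lift_rel2 (fun x y : R => x <= y).
Definition star_dist : star E R -> star E R -> star E R := lift2 (fun x y : R => `|x - y|).

Definition star_fin (x : star E R) : Prop :=
  exists m : nat, star_le (lift1 (fun y : R => `|y|) x) (std m%:R).

Definition infinitely_close (x y : star E R) : Prop :=
  forall e : R, 0 < e -> star_le (star_dist x y) (std e).

(** Meaningful for finite arguments only; [0] elsewhere, where no such real exists. *)
Definition st (x : star E R) : R :=
  xget 0 [set r : R | infinitely_close x (std r)].

End reals.
End nonstandard_analysis.

Local Notation v0 := (TVar VZ).
Local Notation v1 := (TVar (VS VZ)).
Local Notation v2 := (TVar (VS (VS VZ))).
Local Notation v3 := (TVar (VS (VS (VS VZ)))).
Local Notation Holds t := (FEq t (TCst True)).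
Local Notation A1 g t := (TApp (TCst g) t).
Local Notation A2 g t u := (TApp (TApp (TCst g) t) u).

Local Lemma trueE (P : Prop) : (P = True) = P.
Proof. by apply/propext; split=> [->//|p]; apply/propext; split. Qed.

Section transfer_tools.
Variable E : nsextension.

Lemma lift_rel2_std T U (r : T -> U -> Prop) x y :
  lift_rel2 r (std x) (std y : star E U) <-> r x y.
Proof.
have := transfer E (Holds (A2 r (TCst x) (TCst y))).
by rewrite /= trueE => h; split => [/h.2|/h.1].
Qed.

Section reals.
Variable R : realType.
Implicit Types (x y : star E R) (a b r s e : R).

Let le' a b : Prop := a <= b.
Let d' a b : R := `|a - b|.

Lemma star_le_std a b : star_le (std a) (std b : star E R) <-> a <= b.
Proof. exact: lift_rel2_std. Qed.

Lemma infinitely_close_uniq x r s :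
  infinitely_close x (std r) -> infinitely_close x (std s) -> r = s.
Proof.
move=> xr xs; apply/eqP; rewrite -subr_eq0 -normr_eq0; apply/eqP/le_anti.
rewrite normr_ge0 andbT; apply/ler_addgt0Pl => e e0; rewrite addr0.
have e20 : 0 < e / 2 by rewrite divr_gt0.
have := (transfer E (FAll R (FImp (Holds (A2 le' (A2 d' v0 (TCst r)) (TCst (e / 2))))
  (FImp (Holds (A2 le' (A2 d' v0 (TCst s)) (TCst (e / 2))))
  (Holds (A2 le' (TCst `|r - s|) (TCst e))))))).1 => /=.
move=> /(_ _ x (xr _ e20) (xs _ e20)) => h.
apply/star_le_std; apply: h => z; rewrite !trueE /le' /d' => h1 h2.
rewrite (splitr e) (le_trans (ler_distD z _ _))// lerD// distrC//.
Qed.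

Lemma stE x r : infinitely_close x (std r) -> st x = r.
Proof.
move=> xr; rewrite /st; case: xgetP => [s -> xs|/(_ r)//].
exact: infinitely_close_uniq xs xr.
Qed.

Lemma star_le_trans x y : forall z, star_le x y -> star_le y z -> star_le x z.
Proof.
have := (transfer E (FAll R (FAll R (FAll R (FImp (Holds (A2 le' v2 v1))
  (FImp (Holds (A2 le' v1 v0))
  (Holds (A2 le' v2 v0)))))))).1 => /= h z.
apply: h => {z}a b c; rewrite !trueE; exact: le_trans.
Qed.

Lemma infinitely_close_st x : star_fin x -> infinitely_close x (std (st x)).
Proof.
move=> [m xm].
pose A := [set a | star_le (std a) x].
have Am : A (- m%:R).
  have := (transfer E (FAll R (FImp
    (Holds (A2 le' (A1 (fun a : R => `|a|) v0) (TCst m%:R)))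
    (Holds (A2 le' (TCst (- m%:R)) v0))))).1 => /= h.
  apply: h xm => a; rewrite !trueE /le' => am.
  by rewrite lerNl (le_trans _ am)// -normrN ler_norm.
have ubA : ubound A m%:R.
  move=> a Aa; apply/star_le_std; apply: (star_le_trans Aa).
  have := (transfer E (FAll R (FImp
    (Holds (A2 le' (A1 (fun a : R => `|a|) v0) (TCst m%:R)))
    (Holds (A2 le' v0 (TCst m%:R)))))).1 => /= h.
  apply: h xm => b; rewrite !trueE /le' => bm.
  by rewrite (le_trans _ bm)// ler_norm.
have supA : has_sup A by split; [exists (- m%:R)|exists m%:R].
suff xA : infinitely_close x (std (sup A)) by rewrite (stE xA).
move=> e e0.
have [a Aa ae] := sup_adherent e0 supA.
have nAe : ~ A (sup A + e).
  by move=> /(ub_le_sup supA.2); rewrite leNgt ltrDl e0.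
have := (transfer E (FAll R (FImp (Holds (A2 le' (TCst a) v0))
  (FImp (FImp (Holds (A2 le' (TCst (sup A + e)) v0)) FBot)
  (Holds (A2 le' (A2 d' v0 (TCst (sup A))) (TCst e))))))).1 => /= h.
apply: h Aa nAe => b; rewrite !trueE /le' /d' => ab /negP; rewrite -ltNge => be.
rewrite ler_norml lerBlDl (ltW be) andbT lerBrDl.
by rewrite (le_trans _ ab)// ltW.
Qed.

Lemma stD x y : star_fin x -> star_fin y ->
  st (lift2 (fun a b => a + b) x y) = st x + st y.
Proof.
move=> /infinitely_close_st fx /infinitely_close_st fy.
apply: stE => e e0; have e20 : 0 < e / 2 by rewrite divr_gt0.
have := (transfer E (FAll R (FAll R (
  FImp (Holds (A2 le' (A2 d' v1 (TCst (st x))) (TCst (e / 2))))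
  (FImp (Holds (A2 le' (A2 d' v0 (TCst (st y))) (TCst (e / 2))))
  (Holds (A2 le' (A2 d' (A2 (fun a b => a + b) v1 v0)
    (TCst (st x + st y))) (TCst e)))))))).1 => /= h.
apply: h (fx _ e20) (fy _ e20) => a b; rewrite !trueE /le' /d' => h1 h2.
by rewrite opprD addrACA (splitr e) (le_trans (ler_normD _ _))// lerD.
Qed.

Lemma st_ge0 x : star_fin x -> star_le (std 0) x -> 0 <= st x.
Proof.
move=> /infinitely_close_st fx x0; apply/ler_addgt0Pl => e e0.
rewrite -(subr0 (st x)) addrC -lerBlDr sub0r.
have := (transfer E (FAll R (FImp (Holds (A2 le' (TCst 0) v0))
  (FImp (Holds (A2 le' (A2 d' v0 (TCst (st x))) (TCst e)))
  (Holds (A2 le' (TCst (- e)) (TCst (st x)))))))).1 => /= h.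
apply/star_le_std; rewrite subr0; apply: h x0 (fx _ e0) => b; rewrite !trueE /le' /d' => b0.
rewrite ler_norml => /andP[_]; rewrite lerBlDl => h.
by rewrite -subr_ge0 opprK (le_trans b0).
Qed.

Lemma st_std r : st (std r : star E R) = r.
Proof.
apply: stE => e e0; apply/(_ : star_le (lift2 d' (std r) (std r)) _).
have := (transfer E (Holds (A2 le' (A2 d' (TCst r) (TCst r)) (TCst e)))).1 => /=.
by apply; rewrite trueE /le' /d' subrr normr0 ltW.
Qed.

Lemma star_fin_bounded x m : star_le (std 0) x -> star_le x (std m%:R) -> star_fin x.
Proof.
move=> x0 xm; exists m.
have := (transfer E (FAll R (FImp (Holds (A2 le' (TCst 0) v0))
  (FImp (Holds (A2 le' v0 (TCst m%:R)))
  (Holds (A2 le' (A1 (fun a : R => `|a|) v0) (TCst m%:R))))))).1 => /= h.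
by apply: h x0 xm => a; rewrite !trueE /le' => a0; rewrite ger0_norm.
Qed.

End reals.
End transfer_tools.

Section completion.
Local Open Scope ereal_scope.
Context d (T : algebraOfSetsType d) (R : realType).
Variable mu : {measure set T -> \bar R}.

Lemma completed_caratheodoryE : mu^*%mu setT < +oo ->
  mu^*%mu.-cara.-measurable = completed_algebra_gen (measure_extension mu).
Proof.
move=> muT; have fin A : mu^*%mu A \is a fin_num.
  rewrite ge0_fin_numE ?mu_ext_ge0//; apply: le_lt_trans muT.
  by apply: le_outer_measure; exact: subsetT.
have cover A : exists2 F : set (g_sigma_algebraType d.-measurable), measurable F &
    A `<=` F /\ mu^*%mu A = mu^*%mu F.
  have inv0 n : (0 < n.+1%:R^-1 :> R)%R by rewrite invr_gt0.
  have /choice[B BP] : forall n : nat, exists B, @measurable_cover _ T A B /\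
      \sum_(0 <= k <oo) mu (B k) < mu^*%mu A + n.+1%:R^-1%:E.
    move=> n; have := fin A; rewrite {1}/mu_ext => /lb_ereal_inf_adherent.
    by move=> /(_ _ (inv0 n))[_/= [B AB] <-] ?; exists B.
  pose F_ n := \bigcup_m (B n m).
  have AF_ n : A `<=` F_ n by have [[_]] := BP n.
  have muF_ n : mu^*%mu (F_ n) < mu^*%mu A + n.+1%:R^-1%:E.
    apply: le_lt_trans (BP n).2.
    apply: (le_trans (outer_measure_sigma_subadditive mu^*%mu (B n))).
    apply: lee_nneseries => // k _.
    by rewrite -(measurable_mu_extE mu (X := B n k))//; have [[/(_ k)]] := BP n.
  have AF : A `<=` \bigcap_n F_ n by exact: sub_bigcap.
  exists (\bigcap_n F_ n).
    apply: bigcapT_measurable => n; apply: bigcupT_measurable => k.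
    by apply: sub_sigma_algebra; have [[/(_ k)]] := BP n.
  split=> //; apply/eqP; rewrite eq_le le_outer_measure//=.
  apply/lee_addgt0Pr => /= _/posnumP[e]; near \oo => n.
  apply: (@le_trans _ _ (mu^*%mu (F_ n))).
    by apply: le_outer_measure; exact: bigcap_inf.
  rewrite (le_trans (ltW (muF_ n)))// leeD// lee_fin ltW//.
  by near: n; apply: near_infty_natSinv_lt.
apply/seteqP; split=> [A mA|_ [A mA [N [B [mB B0 NB]]] <-]].
- have [F mF [AF muAF]] := cover A.
  have [G mG [FAG muG]] := cover (F `\` A).
  have G0 : mu^*%mu G = 0.
    rewrite -muG.
    have /= := @measureD _ _ _ (@completed_measure_extension _ _ _ mu) F A.
    rewrite /completed_measure_extension => ->//; last 2 first.
    + exact: sub_caratheodory.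
    + by rewrite ltey_eq fin.
    by rewrite setIidr// muAF subee.
  exists (F `\` G); first exact: measurableD.
  exists (A `&` G); first by exists G; split=> // x [].
  apply/seteqP; split=> [x [[Fx Gx]|[]//]|x Ax].
    by apply: contrapT => nAx; apply: Gx; exact: FAG.
  have [Gx|nGx] := pselect (G x); [by right|left].
  by split=> //; exact: AF.
- apply: measurableU; first exact: sub_caratheodory.
  apply: (@measure_is_complete_caratheodory _ _ mu^*%mu).
  by exists B; split=> //; exact: sub_caratheodory.
Unshelve. all: by end_near. Qed.

End completion.

Section internal_probability_spaces.
Variables (E : nsextension) (R : realType).
Variables (d : nat -> measure_display) (T : forall n, measurableType (d n)).
Variable P : forall n, probability (T n) R.
Variable N : star E nat.

Let X := {n & T n}.

(** The points of the [N]-th space of the extended sequence [T]. *)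
Definition internal_space := {x : star E X | lift1 (@projT1 nat T) x = N}.

Definition fibre_measurable (n : nat) (A : set X) : Prop :=
  measurable [set t : T n | A (existT _ n t)].

Definition fibre_prob (n : nat) (A : set X) : R :=
  fine (P n [set t : T n | A (existT _ n t)]).

Definition internal_trace (A : star E (set X)) : set internal_space :=
  [set w | internal_in (sval w) A].

Definition internal_measurable (A : star E (set X)) : Prop :=
  lift_rel2 fibre_measurable N A.

Definition internal_prob (A : star E (set X)) : star E R := lift2 fibre_prob N A.

Definition internal_events : set (set internal_space) :=
  [set B | exists2 A, internal_measurable A & internal_trace A = B].

Let tag : X -> nat := @projT1 nat T.

Let in_setC (A : star E (set X)) x :
  internal_in x (lift1 (@setC X) A) <-> ~ internal_in x A.
Proof.
have h1 := (transfer E (FAll (set X) (FAll X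
  (FImp (FImp (Holds (TApp v1 v0)) FBot)
  (Holds (TApp (A1 (@setC X) v1) v0)))))).1.
have h2 := (transfer E (FAll (set X) (FAll X
  (FImp (Holds (TApp (A1 (@setC X) v1) v0))
  (FImp (Holds (TApp v1 v0)) FBot))))).1.
by split; [apply: h2 => B y /=; rewrite !trueE|apply: h1 => B y /=; rewrite !trueE].
Qed.

Let in_setI (A B : star E (set X)) x :
  internal_in x (lift2 (@setI X) A B) <-> internal_in x A /\ internal_in x B.
Proof.
have h1 := (transfer E (FAll (set X) (FAll (set X) (FAll X
  (FImp (Holds (TApp v2 v0))
  (FImp (Holds (TApp v1 v0))
  (Holds (TApp (A2 (@setI X) v2 v1) v0)))))))).1.
have h2 := (transfer E (FAll (set X) (FAll (set X) (FAll X
  (FImp (Holds (TApp (A2 (@setI X) v2 v1) v0))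
  (Holds (TApp v2 v0))))))).1.
have h3 := (transfer E (FAll (set X) (FAll (set X) (FAll X
  (FImp (Holds (TApp (A2 (@setI X) v2 v1) v0))
  (Holds (TApp v1 v0))))))).1.
split=> [|[]]; last by apply: h1 => ? ? ? /=; rewrite !trueE.
move=> ABx; split; first by apply: (h2 _ A B x ABx) => ? ? ? /=; rewrite !trueE => -[].
by apply: (h3 _ A B x ABx) => ? ? ? /=; rewrite !trueE => -[].
Qed.

Let in_setU (A B : star E (set X)) x :
  internal_in x (lift2 (@setU X) A B) <-> internal_in x A \/ internal_in x B.
Proof.
have h1 := (transfer E (FAll (set X) (FAll (set X) (FAll X
  (FImp (Holds (TApp v2 v0))
  (Holds (TApp (A2 (@setU X) v2 v1) v0))))))).1.
have h2 := (transfer E (FAll (set X) (FAll (set X) (FAll X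
  (FImp (Holds (TApp v1 v0))
  (Holds (TApp (A2 (@setU X) v2 v1) v0))))))).1.
have h3 := (transfer E (FAll (set X) (FAll (set X) (FAll X
  (FImp (Holds (TApp (A2 (@setU X) v2 v1) v0))
  (FImp (FImp (Holds (TApp v2 v0)) FBot)
  (Holds (TApp v1 v0)))))))).1.
split=> [ABx|[]].
- have [?|nAx] := pselect (internal_in x A); [by left|right].
  by apply: (h3 _ A B x ABx nAx) => ? ? ? /=; rewrite !trueE => -[].
- by apply: h1 => ? ? ? /=; rewrite !trueE; left.
- by apply: h2 => ? ? ? /=; rewrite !trueE; right.
Qed.

Let in_fibre x : internal_in x (lift1 (fun n => tag @^-1` [set n]) N) <->
  lift1 tag x = N.
Proof.
have h1 := (transfer E (FAll nat (FAll X
  (FImp (Holds (TApp (A1 (fun n => tag @^-1` [set n]) v1) v0))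
  (FEq (A1 tag v0) v1))))).1.
have h2 := (transfer E (FAll nat (FAll X
  (FImp (FEq (A1 tag v0) v1)
  (Holds (TApp (A1 (fun n => tag @^-1` [set n]) v1) v0)))))).1.
by split; [apply: (h1 _ N x)|apply: (h2 _ N x)] => n y /=; rewrite !trueE.
Qed.

Let in_set0 x : ~ internal_in x (std (set0 : set X) : star E _).
Proof.
have h := (transfer E (FAll X (FImp (Holds (TApp (TCst (set0 : set X)) v0)) FBot))).1.
by apply: h => y /=; rewrite trueE.
Qed.

Let meas0 : internal_measurable (std set0).
Proof.
have h := (transfer E (FAll nat (Holds (A2 fibre_measurable v0 (TCst set0))))).1.
by apply: h => n /=; rewrite trueE; exact: measurable0.
Qed.

Let measC A : internal_measurable A -> internal_measurable (lift1 (@setC X) A).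
Proof.
have h := (transfer E (FAll nat (FAll (set X) (FImp
  (Holds (A2 fibre_measurable v1 v0))
  (Holds (A2 fibre_measurable v1 (A1 (@setC X) v0))))))).1.
by apply: h => n B /=; rewrite !trueE; exact: measurableC.
Qed.

Let measU A B : internal_measurable A -> internal_measurable B ->
  internal_measurable (lift2 (@setU X) A B).
Proof.
have h := (transfer E (FAll nat (FAll (set X) (FAll (set X) (FImp
  (Holds (A2 fibre_measurable v2 v1))
  (FImp (Holds (A2 fibre_measurable v2 v0))
  (Holds (A2 fibre_measurable v2
    (A2 (@setU X) v1 v0))))))))).1.
by apply: h => n B1 B2 /=; rewrite !trueE; exact: measurableU.
Qed.

Let fibre_probE n A : fibre_measurable n A ->
  (fibre_prob n A)%:E = P n [set t : T n | A (existT _ n t)].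
Proof. by move=> mA; rewrite /fibre_prob fineK// fin_num_measure. Qed.

Let prob_ge0 A : star_le (std 0) (internal_prob A).
Proof.
have h := (transfer E (FAll nat (FAll (set X) (Holds (A2 (fun x y : R => x <= y : Prop)
  (TCst 0) (A2 fibre_prob v1 v0)))))).1.
by apply: h => n B /=; rewrite !trueE; rewrite fine_ge0.
Qed.

Let prob_le1 A : internal_measurable A -> star_le (internal_prob A) (std 1%:R).
Proof.
have h := (transfer E (FAll nat (FAll (set X) (FImp
  (Holds (A2 fibre_measurable v1 v0))
  (Holds (A2 (fun x y : R => x <= y : Prop)
    (A2 fibre_prob v1 v0) (TCst 1%:R))))))).1.
apply: h => n B /=; rewrite !trueE => mB.
by rewrite -lee_fin fibre_probE// probability_le1.
Qed.

Let prob0 : internal_prob (std set0) = std 0.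
Proof.
have h := (transfer E (FAll nat (FEq (A2 fibre_prob v0 (TCst set0)) (TCst 0)))).1.
apply: h => n /=; rewrite /fibre_prob.
by rewrite (_ : mkset _ = set0) ?measure0//; exact/seteqP.
Qed.

Let prob_trace A B : internal_trace A = internal_trace B ->
  internal_prob A = internal_prob B.
Proof.
move=> AB.
have h := (transfer E (FAll nat (FAll (set X) (FAll (set X) (FImp
  (FAll X (FImp (FEq (A1 tag v0) v3)
    (FImp (Holds (TApp v2 v0)) (Holds (TApp v1 v0)))))
  (FImp
  (FAll X (FImp (FEq (A1 tag v0) v3)
    (FImp (Holds (TApp v1 v0)) (Holds (TApp v2 v0)))))
  (FEq (A2 fibre_prob v2 v1)
      (A2 fibre_prob v2 v0)))))))).1.
apply: h => /= [n A' B' h1 h2|x xN Ax|x xN Bx].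
- congr (fine (P n _)); apply/seteqP; split=> t /= At.
    by have := h1 (existT _ n t) erefl; rewrite !trueE; apply.
  by have := h2 (existT _ n t) erefl; rewrite !trueE; apply.
- by have : internal_trace A (exist _ x xN) by []; rewrite AB.
- by have : internal_trace B (exist _ x xN) by []; rewrite -AB.
Qed.

Let prob_finite A : internal_measurable A -> star_fin (internal_prob A).
Proof. by move=> mA; apply: star_fin_bounded (prob_ge0 A) (prob_le1 mA). Qed.

Let probU A B : internal_measurable A -> internal_measurable B ->
  internal_trace A `&` internal_trace B = set0 ->
  internal_prob (lift2 (@setU X) A B) =
  lift2 (fun x y => x + y) (internal_prob A) (internal_prob B).
Proof.
move=> mA mB AB0.
have h := (transfer E (FAll nat (FAll (set X) (FAll (set X) (FImp
  (Holds (A2 fibre_measurable v2 v1))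
  (FImp (Holds (A2 fibre_measurable v2 v0))
  (FImp
  (FAll X (FImp (FEq (A1 tag v0) v3)
    (FImp (Holds (TApp v2 v0))
    (FImp (Holds (TApp v1 v0)) FBot))))
  (FEq (A2 fibre_prob v2 (A2 (@setU X) v1 v0))
     (A2 (fun x y : R => x + y) (A2 fibre_prob v2 v1)
      (A2 fibre_prob v2 v0)))))))))).1.
apply: (h _ N A B) => // [n A' B' /= |x xN Ax Bx]; last first.
  suff : set0 (exist _ x xN : internal_space) by [].
  by rewrite -AB0; split.
rewrite !trueE => mA' mB' AB'.
apply: EFin_inj; rewrite EFinD !fibre_probE//; last exact: measurableU.
rewrite -measureU//.
apply/seteqP; split=> // t [/= At Bt].
by have := AB' (existT _ n t) erefl; rewrite !trueE; apply.
Qed.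

Let traceC A : internal_trace (lift1 (@setC X) A) = ~` internal_trace A.
Proof. by apply/seteqP; split=> w /in_setC. Qed.

Let traceU A B : internal_trace (lift2 (@setU X) A B) =
  internal_trace A `|` internal_trace B.
Proof. by apply/seteqP; split=> w /in_setU. Qed.

Let trace0 : internal_trace (std set0) = set0.
Proof. by apply/seteqP; split=> w // /in_set0. Qed.

Let internal_point : internal_space.
Proof.
pose pt n : X := existT (fun m => T m : Type) n point; exists (lift1 pt N).
have h := (transfer E (FAll nat
  (FEq (A1 tag (A1 pt v0)) v0))).1.
exact: h.
Defined.

HB.instance Definition _ := gen_eqMixin internal_space.
HB.instance Definition _ := gen_choiceMixin internal_space.
HB.instance Definition _ := isPointed.Build internal_space internal_point.

Let events0 : internal_events set0.
Proof. by exists (std set0). Qed.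

Let eventsC : setC_closed internal_events.
Proof. by move=> _ [A mA <-]; exists (lift1 (@setC X) A); [exact: measC|]. Qed.

Let eventsU : setU_closed internal_events.
Proof.
move=> _ _ [A mA <-] [B mB <-].
by exists (lift2 (@setU X) A B); [exact: measU|].
Qed.

HB.instance Definition _ := isAlgebraOfSets.Build default_measure_display
  internal_space events0 eventsU eventsC.

(** [st] of the internal probability of an internal event; independent of the
internal set [A] of trace [B]. *)
Definition loeb_premeasure (B : set internal_space) : \bar R :=
  (xget 0 [set st (internal_prob A) |
     A in [set A | internal_measurable A /\ internal_trace A = B]])%:E.

Let premeasureE A : internal_measurable A ->
  loeb_premeasure (internal_trace A) = (st (internal_prob A))%:E.
Proof.
move=> mA; rewrite /loeb_premeasure; case: xgetP => [r -> [A' [_ A'A] <-]|].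
  by rewrite (prob_trace A'A).
by move=> /(_ (st (internal_prob A))) []; exists A.
Qed.

Let premeasure0 : loeb_premeasure set0 = 0%E.
Proof. by rewrite -trace0 premeasureE// prob0 st_std. Qed.

Let premeasure_ge0 B : (0 <= loeb_premeasure B)%E.
Proof.
rewrite /loeb_premeasure; case: xgetP => [r _ [A [mA _] <-]|_]; rewrite lee_fin//.
by apply: st_ge0; [exact: prob_finite|exact: prob_ge0].
Qed.

Let premeasureU A B : internal_events A -> internal_events B -> A `&` B = set0 ->
  loeb_premeasure (A `|` B) = (loeb_premeasure A + loeb_premeasure B)%E.
Proof.
move=> [A' mA <-] [B' mB <-] AB0.
rewrite -traceU !premeasureE ?probU//; last exact: measU.
by rewrite stD ?EFinD//; exact: prob_finite.
Qed.

Let events_compact (F : (set internal_space)^nat) :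
  (forall n, internal_events (F n)) -> internal_events (\bigcup_n F n) ->
  exists n, \bigcup_n F n `<=` \big[setU/set0]_(i < n) F i.
Proof.
move=> mF [A mA AF]; apply: contrapT => /forallNP nF.
have /choice[B BF] : forall n, exists B, internal_trace B = F n.
  by move=> n; have [B _ <-] := mF n; exists B.
pose C i := lift2 (@setI X) (lift1 (fun n => tag @^-1` [set n]) N)
  (lift2 (@setI X) A (lift1 (@setC X) (B i))).
have CP i x : internal_in x (C i) <->
    [/\ lift1 tag x = N, internal_in x A & ~ internal_in x (B i)].
  split=> [/in_setI[/in_fibre ? /in_setI[? /in_setC]]//|[xN xA xB]].
  by apply/in_setI; split; [exact/in_fibre|apply/in_setI; split=> //; exact/in_setC].
have [n|x xC] := @saturation E X C.
  have /existsNP[w /not_implyP[Fw nFw]] := nF n.+1.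
  exists (sval w) => i ilen; apply/CP; split; first exact: (svalP w).
    by move: Fw; rewrite -AF.
  move=> wB; apply: nFw; rewrite -bigcup_mkord; exists i; first by rewrite /= ltnS.
  by rewrite -BF.
have [xN xA _] := (CP 0%N x).1 (xC 0%N).
have [i _] : (\bigcup_n F n) (exist _ x xN) by rewrite -AF.
by rewrite -BF => xB; have [_ _] := (CP i x).1 (xC i); apply.
Qed.

Let premeasure_sigma_additive : semi_sigma_additive loeb_premeasure.
Proof.
move=> F mF tF mUF; have [n Fn] := events_compact mF mUF.
have F0 i : (n <= i)%N -> F i = set0.
  move=> ni; apply/seteqP; split=> // w Fw.
  have : (\bigcup_n F n) w by exists i.
  move=> /Fn; rewrite -bigcup_mkord => -[j /= jn Fj].
  have ij : i = j by apply: (tF i j) => //; exists w.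
  by move: jn; rewrite -ij ltnNge ni.
have sumF m : (internal_events (\big[setU/set0]_(i < m) F i)) /\
    loeb_premeasure (\big[setU/set0]_(i < m) F i) =
    (\sum_(0 <= i < m) loeb_premeasure (F i))%E.
  elim: m => [|m [IH1 IH2]]; first by rewrite big_ord0 big_geq.
  rewrite big_ord_recr/= big_nat_recr//= -IH2; split.
    exact: (eventsU IH1 (mF m)).
  apply: (premeasureU IH1 (mF m)); apply/seteqP; split=> // w [].
  rewrite -bigcup_mkord => -[j /= jm Fj] Fm.
  have jE : j = m by apply: (tF j m) => //; exists w.
  by rewrite jE ltnn in jm.
have -> : \bigcup_n F n = \big[setU/set0]_(i < n) F i.
  by apply/seteqP; split=> //; rewrite -bigcup_mkord; move=> w [i _ Fi]; exists i.
rewrite (sumF n).2.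
apply: cvg_near_cst; near=> m.
have nm : (n <= m)%N by near: m; exact: nbhs_infty_ge.
rewrite (big_cat_nat _ nm)//=.
suff -> : (\sum_(n <= i < m) loeb_premeasure (F i) = 0)%E by rewrite adde0.
by rewrite big_nat_cond big1// => i /andP[/andP[ni _] _]; rewrite F0.
Unshelve. all: by end_near. Qed.

HB.instance Definition _ := isMeasure.Build _ _ _ loeb_premeasure
  premeasure0 premeasure_ge0 premeasure_sigma_additive.

(** The measure extension of [loeb_premeasure] to the sigma-algebra generated by the internal
events (unique by [measure_extension_unique]), and its completion, the Loeb measure; see
[loeb_measurableE]. *)
Definition loeb_ext := measure_extension loeb_premeasure.

Definition loeb := @completed_measure_extension _ _ _ loeb_premeasure.

HB.instance Definition _ := Measure.on loeb.

Lemma loeb_internal A : internal_measurable A ->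
  loeb (internal_trace A) = (st (internal_prob A))%:E.
Proof.
move=> mA; rewrite -premeasureE// /loeb /completed_measure_extension.
by rewrite measurable_mu_extE//; exists A.
Qed.

Lemma loebT : loeb setT = 1%E.
Proof.
have mT : internal_measurable (std setT).
  have h := (transfer E (FAll nat (Holds (A2 fibre_measurable v0 (TCst setT))))).1.
  by apply: h => n /=; rewrite trueE; exact: measurableT.
have traceT : internal_trace (std setT) = setT.
  have h := (transfer E (FAll X (Holds (TApp (TCst (setT : set X)) v0)))).1.
  by apply/seteqP; split=> // w _; apply: h => x /=; rewrite trueE.
rewrite -traceT loeb_internal//.
have h := (transfer E (FAll nat (FEq (A2 fibre_prob v0 (TCst setT)) (TCst 1)))).1.
rewrite /internal_prob (_ : lift2 _ _ _ = std 1) ?st_std//.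
by apply: h => n /=; rewrite /fibre_prob (_ : mkset _ = setT) ?probability_setT.
Qed.

Lemma loeb_measurableE :
  loeb_premeasure^*%mu.-cara.-measurable = completed_algebra_gen loeb_ext.
Proof.
apply: completed_caratheodoryE; move: loebT.
by rewrite /loeb /completed_measure_extension => ->; rewrite ltry.
Qed.

(** [F : star E (X -> R)] is an internal function on the [N]-th space. *)
Definition fibre_integrable (n : nat) (F : X -> R) : Prop :=
  (P n).-integrable [set: T n] (fun t => (F (existT _ n t))%:E).

Definition fibre_tail (n : nat) (F : X -> R) (m : nat) : R :=
  \int[P n]_t (`|F (existT _ n t)| * \1_[set u : T n | m%:R < `|F (existT _ n u)|] t).

Definition S_integrable (F : star E (X -> R)) : Prop :=
  [/\ lift_rel2 fibre_integrable N F,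
      loeb [set w | star_fin (app F (sval w))] = 1%E &
      forall M, unlimited M ->
        star_fin (lift3 fibre_tail N F M) /\ st (lift3 fibre_tail N F M) = 0].

End internal_probability_spaces.

Arguments loeb_premeasure {E R d T} P {N} _.
Arguments loeb_ext {E R d T} P N _.
Arguments loeb {E R d T} P N _.

Section gaussian.
Variable R : realType.

Definition cons_tuple n (x : measurableTypeR R * n.-tuple R) : n.+1.-tuple R :=
  [tuple of x.1 :: x.2].

Let measurable_cons_tuple n :
  measurable_fun [set: measurableTypeR R * n.-tuple R] (@cons_tuple n).
Proof. exact: measurable_cons. Qed.

HB.instance Definition _ n :=
  isMeasurableFun.Build _ _ _ _ (@cons_tuple n) (@measurable_cons_tuple n).

(** The [k]-fold product of the standard normal distribution. *)
Fixpoint std_gaussian k : probability (k.-tuple R) R :=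
  if k is k'.+1 then
    distribution (normal_prob (0 : R) (1 : R) \x std_gaussian k')%E (@cons_tuple k')
  else \d_([tuple]).

End gaussian.

Section sphere.
Variable R : realType.

Definition enorm n (x : n.-tuple R) : R := Num.sqrt (\sum_(i < n) tnth x i ^+ 2).

Definition sphere n := {x : n.-tuple R | enorm x == Num.sqrt n%:R}.

HB.instance Definition _ n := Choice.on (sphere n).

Let sphere_point n : sphere n.
Proof.
exists [tuple of nseq n (1 : R)].
rewrite /enorm; under eq_bigr do rewrite tnth_nseq expr1n.
by rewrite sumr_const card_ord.
Defined.

HB.instance Definition _ n := isPointed.Build (sphere n) (@sphere_point n).

(** The trace of the Borel sigma-algebra of $\mathbb{R}^n$. *)
HB.instance Definition _ n := Measurable.copy (sphere n)
  (g_sigma_algebra_preimageType (sval : sphere n -> n.-tuple R)).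

Definition mulmx_tuple n (Q : 'M[R]_n) (x : n.-tuple R) : n.-tuple R :=
  [tuple \sum_(j < n) Q i j * tnth x j | i < n].

(** Invariance under the full orthogonal group: for [n = 1] the group of proper rotations is
trivial and would not determine the measure. *)
Definition rotation_invariant n (mu : set (sphere n) -> \bar R) : Prop :=
  forall Q : 'M[R]_n, Q^T *m Q = 1%:M -> forall A : set (sphere n), measurable A ->
  mu [set x | exists2 y, A y & sval y = mulmx_tuple Q (sval x)] = mu A.

(** The projection onto the first [k] coordinates when [k <= n], padded with zeros otherwise. *)
Definition first_coords n k (x : n.-tuple R) : k.-tuple R := [tuple nth 0 x i | i < k].

Definition on_sphere k (f : k.-tuple R -> R) n (x : sphere n) : R :=
  f (first_coords k (sval x)).

Definition star_on_sphere (E : nsextension) k (f : k.-tuple R -> R) :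
    star E ({n & sphere n} -> R) :=
  std (fun x => on_sphere f (projT2 x)).

End sphere.

(* Main.v *)
Require Import Defs.
From HB Require Import structures.
From mathcomp Require Import all_boot all_order all_algebra.
From mathcomp Require Import all_classical all_reals all_analysis.
From mathcomp Require Import measurable_realfun ring lra.
Set Implicit Arguments.
Unset Strict Implicit.
Unset Printing Implicit Defensive.
Import Order.TTheory GRing.Theory Num.Theory.
Import numFieldNormedType.Exports.
Local Open Scope classical_set_scope.
Local Open Scope ring_scope.

(**md The law of the first $k$ coordinates under $\bar\sigma_n$ has density
$c_n (1 - |z|^2/n)_+^{(n-k-2)/2} e^{|z|^2/2}$ with respect to $\mu$. To see this without Haar
measure, perturb a random point $x$ of the sphere to $x + \varepsilon v$ with $v$ Gaussian. By
rotation invariance the result has a radial Lebesgue density on $\mathbb{R}^n$, and for radial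
densities the conditional law of the first $k$ coordinates given the norm follows from Fubini and
the homogeneity of Lebesgue measure; then let $\varepsilon \to 0$.

The densities tend to $1$ and are eventually at most $2 e^{a|z|^2}$ for any $a > 0$. By Young's
inequality $|f| e^{a|z|^2}$ is $\mu$-integrable for small $a$, so dominated convergence gives the
limit of the integrals and of the tails. Applied to indicator functions it gives
$\bar\sigma_n(f \in B) \to \mu(f \in B)$ for every Borel set $B$; hence the law of
$\operatorname{st}({}^*f)$ under the Loeb measure is the law of $f$ under $\mu$, and the Loeb
integral is computed by change of variables. *)

(** The measurability proof is an argument of the measure structure on a pushforward, so it
cannot be inferred from [pushforward m f] alone. *)
Local Notation pushforward_measure m mf :=
  (measure_function_pushforward__canonical__measure_function_Measure m mf).

(** [cons_tuple] alone denotes the constructor of [tuple.v]. *)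
Local Notation tcons a x := (Defs.cons_tuple (a, x)).

(** * Lebesgue and Gaussian integrals *)

(** Since $\bar\sigma_n$ is singular for Lebesgue measure, Fubini cannot slice it directly; the
    Gaussian noise gives it a density. Slicing $\mathbb{R}^{k+m}$ by $t = |y|^2$, a function $F$ of
    the first $k$ coordinates and its mean over the slice, a function of $|y|^2$ alone, have the
    same integral against any radial density. As the noise fades, $|y|^2 \to n$, where the slice
    mean is continuous, so the sphere integral of $F$ is the slice mean at $n$. Invariance enters
    only through Householder reflections.

    Lebesgue measure on $\mathbb{R}^k$ is represented as the Gaussian measure reweighted by
    $e^{|y|^2/2}$, so that every iterated integral unfolds the recursion of [std_gaussian].
    Normalising constants are never evaluated: they are fixed by total mass, and $c_n \to 1$ follows
    from dominated convergence.

    For the Loeb law, convergence must hold on every Borel set: $f$ is only measurable, and its law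
    may have atoms. For $S$-integrability, the tail bound must be uniform over thresholds beyond
    some $m_0$ before transfer can reach an unlimited one. *)

Section density.
Local Open Scope ereal_scope.
Context d (T : measurableType d) (R : realType).
Variables (m nu : {measure set T -> \bar R}) (g : T -> R).
Hypotheses (mg : measurable_fun setT g) (g0 : forall x, (0 <= g x)%R).
Hypothesis nug : forall A, measurable A -> nu A = \int[m]_(x in A) (g x)%:E.

Import HBNNSimple.

Lemma ge0_integral_density (f : T -> \bar R) : measurable_fun setT f ->
  (forall x, 0 <= f x) -> \int[nu]_x f x = \int[m]_x (f x * (g x)%:E).
Proof.
move=> mf f0.
pose f_ := nnsfun_approx measurableT mf.
have f_f x : (EFin \o f_^~ x) @ \oo --> f x by exact: cvg_nnsfun_approx.
have ndf x : {homo (fun n => (f_ n x)%:E) : a b / (a <= b)%N >-> a <= b}.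
  by move=> a b ab; rewrite lee_fin; exact/lefP/nd_nnsfun_approx.
transitivity (limn (fun n => \int[nu]_x (f_ n x)%:E)).
  rewrite -monotone_convergence//.
  - by apply: eq_integral => y _; apply/esym/cvg_lim => //; exact: f_f.
  - by move=> n; exact/measurable_EFinP.
  - by move=> n y _; rewrite lee_fin.
rewrite [X in limn X](_ : _ = (fun n => \int[m]_x ((f_ n x)%:E * (g x)%:E))).
  rewrite -monotone_convergence//.
  - apply: eq_integral => y _; apply/cvg_lim => //.
    by apply: cvgeZr => //; exact: f_f.
  - by move=> n; apply: emeasurable_funM; exact/measurable_EFinP.
  - by move=> n x _; rewrite mule_ge0// lee_fin.
  - by move=> x _ a b ab; apply: lee_wpmul2r; [rewrite lee_fin|exact: ndf].
apply/funext => n.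
under eq_integral do rewrite fimfunE -fsumEFin//.
rewrite ge0_integral_fsum//; last 2 first.
- by move=> y; exact/measurable_EFinP/measurable_funM.
- by move=> y x _; rewrite nnfun_muleindic_ge0.
transitivity (\int[m]_x \sum_(y \in range (f_ n))
    ((y * \1_(f_ n @^-1` [set y]) x)%:E * (g x)%:E)).
  rewrite ge0_integral_fsum//; last 2 first.
  - move=> y; apply: emeasurable_funM; last exact/measurable_EFinP.
    exact/measurable_EFinP/measurable_funM.
  - move=> y x _; apply: mule_ge0; last by rewrite lee_fin.
    by rewrite EFinM nnfun_muleindic_ge0.
  apply: eq_fsbigr => r rf.
  rewrite integralZl_indic_nnsfun// integral_indic//= setIT nug//.
  rewrite integral_mkcond -ge0_integralZl//.
  - apply: eq_integral => x _; rewrite EFinM -muleA; congr (_ * _).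
    by rewrite epatch_indic muleC.
  - apply/(measurable_restrictT _ _).1 => //.
    by apply/measurable_EFinP; exact: measurable_funS mg.
  - by move=> x _; rewrite erestrict_ge0// => y _; rewrite lee_fin.
  - by move: rf; rewrite inE => -[x _ <-]; rewrite lee_fin.
apply: eq_integral => x _.
rewrite fimfunE -fsumEFin// ge0_mule_fsuml//.
by move=> r; rewrite nnfun_muleindic_ge0.
Qed.

End density.

(** * Affine changes of variable on the real line *)

Section lebesgue_affine.
Local Open Scope ereal_scope.
Context (R : realType).
Local Notation mu := (@lebesgue_measure R).

Lemma preimage_affine_itvoc (a b x y : R) : (0 < a)%R ->
  (fun z => b + a * z)%R @^-1` `]x, y] = `]((x - b) / a)%R, ((y - b) / a)%R]%classic.
Proof.
move=> a0; apply/seteqP; split => z /=; rewrite !in_itv/=;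
  by rewrite ltr_pdivrMr// ler_pdivlMr// ltrBlDl lerBrDl (mulrC z).
Qed.

Lemma measurable_affine (a b : R) :
  measurable_fun setT (fun z : measurableTypeR R => b + a * z : measurableTypeR R)%R.
Proof. by apply: measurable_funD => //; apply: measurable_funM. Qed.

(** Half-open intervals determine Lebesgue measure, and on them the image measure under [h], scaled
    by [a], has the right length. *)
Lemma lebesgue_measure_affine (a b : R) (A : set R) : (0 < a)%R -> measurable A ->
  mu A = a%:E * mu ((fun z => b + a * z)%R @^-1` A).
Proof.
move=> a0 mA.
pose h := fun z : measurableTypeR R => (b + a * z : measurableTypeR R)%R.
have mh : measurable_fun setT h by exact: measurable_affine.
pose nu := mscale (NngNum (ltW a0))
  (pushforward_measure mu mh).
suff munu X : ocitv X -> mu X = nu X by rewrite (lebesgue_measure_unique munu).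
case=> -[x y] _ <-; rewrite /nu /mscale/= /pushforward preimage_affine_itvoc//.
rewrite !lebesgue_measure_itv/= !lte_fin ltr_pM2r ?invr_gt0// ltrD2r.
case: ifPn => _; last by rewrite mule0.
by rewrite -!EFinD -EFinM; congr EFin; field; rewrite gt_eqF.
Qed.

Lemma ge0_integral_affine (a b : R) (F : R -> \bar R) : (0 < a)%R ->
  measurable_fun setT F -> (forall x, 0 <= F x) ->
  \int[mu]_x F (b + a * x)%R = a^-1%:E * \int[mu]_x F x.
Proof.
move=> a0 mF F0.
pose h := fun z : measurableTypeR R => (b + a * z : measurableTypeR R)%R.
have mh : measurable_fun setT h by exact: measurable_affine.
have -> : \int[mu]_x F x = a%:E * \int[mu]_x F (h x).
  transitivity (\int[mscale (NngNum (ltW a0)) (pushforward_measure mu mh)]_x F x).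
    apply: eq_measure_integral => A mA _.
    by rewrite [LHS](lebesgue_measure_affine b a0).
  by rewrite ge0_integral_mscale//= ge0_integral_pushforward.
by rewrite muleA -EFinM mulVf ?gt_eqF// mul1e.
Qed.

End lebesgue_affine.

Section lebesgue_weighted_normal.
Local Open Scope ereal_scope.
Context (R : realType).
Local Notation N01 := (@normal_prob R 0 1).

Lemma normal_pdf01E (x : R) :
  normal_pdf 0 1 x = (normal_peak 1 * expR (- (x ^+ 2 / 2)))%R.
Proof.
rewrite normal_pdfE ?oner_neq0// /normal_fun; congr (_ * expR _)%R.
by rewrite subr0 expr1n mulNr.
Qed.

Lemma ge0_integral_normal (F : R -> \bar R) : measurable_fun setT F ->
  (forall x, 0 <= F x) ->
  \int[N01]_x F x = \int[lebesgue_measure]_x (F x * (normal_pdf 0 1 x)%:E).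
Proof.
move=> mF F0; apply: ge0_integral_density => //.
- exact: measurable_normal_pdf.
- by move=> x; exact: normal_pdf_ge0.
Qed.

(** The weight $e^{x^2/2}$ cancels the Gaussian density up to its peak, so weighted Gaussian
    integrals inherit the changes of variable of Lebesgue measure. *)
Lemma ge0_integral_normal_expR (F : R -> \bar R) : measurable_fun setT F ->
  (forall x, 0 <= F x) ->
  \int[N01]_x (F x * (expR (x ^+ 2 / 2))%:E) =
  (normal_peak 1)%:E * \int[lebesgue_measure]_x F x.
Proof.
move=> mF F0; rewrite ge0_integral_normal//; last 2 first.
- apply: emeasurable_funM => //; apply/measurable_EFinP.
  apply: measurableT_comp => //; exact: measurable_funM.
- by move=> x; rewrite mule_ge0// lee_fin expR_ge0.
rewrite -ge0_integralZl//; last by rewrite lee_fin normal_peak_ge0.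
apply: eq_integral => x _.
rewrite -muleA -EFinM normal_pdf01E mulrCA -expRD subrr expR0 mulr1.
exact: muleC.
Qed.

Lemma ge0_integral_normal_affine (a b : R) (F : R -> \bar R) : (0 < a)%R ->
  measurable_fun setT F -> (forall x, 0 <= F x) ->
  \int[N01]_x (F (b + a * x)%R * (expR (x ^+ 2 / 2))%:E) =
  a^-1%:E * \int[N01]_x (F x * (expR (x ^+ 2 / 2))%:E).
Proof.
move=> a0 mF F0; rewrite !ge0_integral_normal_expR//.
  by rewrite ge0_integral_affine// muleCA.
by apply: measurableT_comp mF _; exact: measurable_affine.
Qed.

End lebesgue_weighted_normal.

Section tuple_vectors.
Context (R : realType).

Definition sqn n (x : n.-tuple R) : R := \sum_(i < n) tnth x i ^+ 2.

Definition axpy n (x : n.-tuple R) (a : R) (y : n.-tuple R) : n.-tuple R :=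
  [tuple tnth x i + a * tnth y i | i < n].

Lemma sqn_ge0 n (x : n.-tuple R) : 0 <= sqn x.
Proof. by apply: sumr_ge0 => i _; exact: sqr_ge0. Qed.

Lemma sqn_cons n a (x : n.-tuple R) : sqn (tcons a x) = a ^+ 2 + sqn x.
Proof.
rewrite /sqn big_ord_recl (tnth_nth 0)/=; congr (_ + _).
by apply: eq_bigr => i _; rewrite !(tnth_nth 0).
Qed.

Lemma axpy_cons n a (x : n.-tuple R) e b (y : n.-tuple R) :
  axpy (tcons a x) e (tcons b y) =
  tcons (a + e * b) (axpy x e y).
Proof.
apply/eq_from_tnth => i; rewrite tnth_mktuple.
case: (unliftP ord0 i) => [j ->|->]; last by rewrite !(tnth_nth 0).
have E c (z : n.-tuple R) : tnth (tcons c z) (lift ord0 j) = tnth z j.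
  by rewrite !(tnth_nth 0).
by rewrite !E tnth_mktuple.
Qed.

Lemma tuple_consP n (P : n.+1.-tuple R -> Prop) :
  (forall a x, P (tcons a x)) -> forall x, P x.
Proof.
move=> Pc x; suff -> : x = tcons (thead x) ([tuple of behead x]) by [].
by apply/val_inj; rewrite {1}(tuple_eta x).
Qed.

Lemma first_coords_cons n k a (x : n.-tuple R) :
  first_coords k.+1 (tcons a x) = tcons a (first_coords k x).
Proof.
apply/eq_from_tnth => i; rewrite tnth_mktuple.
case: (unliftP ord0 i) => [j ->|->]; last by rewrite (tnth_nth 0).
by rewrite (tnth_nth 0)/= -[RHS]/(nth 0 (first_coords k x) j) -tnth_nth tnth_mktuple.
Qed.

Lemma measurable_sqn n : measurable_fun setT (@sqn n).
Proof.
apply: measurable_sum => i; apply: measurable_funX; exact: measurable_tnth.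
Qed.

Lemma measurable_axpy n d (T : measurableType d) (f g : T -> n.-tuple R) (a : R) :
  measurable_fun setT f -> measurable_fun setT g ->
  measurable_fun setT (fun t => axpy (f t) a (g t)).
Proof.
move=> mf mg; apply/measurable_fun_tnthP => i.
rewrite (_ : _ \o _ = fun t => tnth (f t) i + a * tnth (g t) i).
  apply: measurable_funD; last apply: measurable_funM => //.
  - by move/measurable_fun_tnthP: mf; exact.
  - by move/measurable_fun_tnthP: mg; exact.
by apply/funext => t /=; rewrite tnth_mktuple.
Qed.

Lemma measurable_first_coords n k : measurable_fun setT (@first_coords R n k).
Proof.
apply/measurable_fun_tnthP => i.
have [ni|ni] := ltnP i n; last first.
  rewrite (_ : _ \o _ = cst 0)//; apply/funext => t /=.
  by rewrite tnth_mktuple nth_default// size_tuple.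
rewrite (_ : _ \o _ = @tnth n R ^~ (Ordinal ni)); first exact: measurable_tnth.
by apply/funext => t /=; rewrite tnth_mktuple (tnth_nth 0).
Qed.

End tuple_vectors.

Section gaussian_integrals.
Local Open Scope ereal_scope.
Context (R : realType).
Local Notation N01 := (@normal_prob R 0 1).
Local Notation gauss := (std_gaussian R).

Lemma measurable_cons_tuple k : measurable_fun setT (@Defs.cons_tuple R k).
Proof. exact: measurable_funP. Qed.

Lemma measurable_section_cons k (F : k.+1.-tuple R -> \bar R) (x : R) :
  measurable_fun setT F ->
  measurable_fun setT (fun y : k.-tuple R => F (tcons x y)).
Proof.
move=> mF; apply: (measurableT_comp mF).
by apply: (measurableT_comp (@measurable_cons_tuple k)); exact: measurable_pair1.
Qed.

Lemma std_gaussianS k (F : k.+1.-tuple R -> \bar R) : measurable_fun setT F ->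
  (forall x, 0 <= F x) ->
  \int[gauss k.+1]_x F x = \int[N01]_x \int[gauss k]_y F (tcons x y).
Proof.
move=> mF F0; rewrite ge0_integral_distribution//.
rewrite fubini_tonelli1//=.
by apply: measurableT_comp mF _; exact: measurable_cons_tuple.
Qed.

Lemma std_gaussian0 (F : 0.-tuple R -> \bar R) : measurable_fun setT F ->
  \int[gauss 0]_x F x = F [tuple].
Proof. by move=> mF; rewrite integral_dirac// diracT mul1e. Qed.

End gaussian_integrals.

Lemma measurable_comp2 d d1 d2 d3 (T : measurableType d) (T1 : measurableType d1)
    (T2 : measurableType d2) (T3 : measurableType d3) (G : T1 -> T2 -> T3)
    (f : T -> T1) (g : T -> T2) :
  measurable_fun setT (fun p : T1 * T2 => G p.1 p.2) ->
  measurable_fun setT f -> measurable_fun setT g ->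
  measurable_fun setT (fun t => G (f t) (g t)).
Proof.
move=> mG mf mg.
exact: (measurableT_comp mG (measurable_fun_pair mf mg)).
Qed.

(** * Lebesgue integration on $\mathbb{R}^k$ through the Gaussian measure *)

Section lebesgue_functional.
Local Open Scope ereal_scope.
Context (R : realType).
Local Notation N01 := (@normal_prob R 0 1).
Local Notation gauss := (std_gaussian R).

(** Integration against Lebesgue measure on $\mathbb{R}^k$, up to the factor $(2\pi)^{-k/2}$. *)
Definition lam k (F : k.-tuple R -> \bar R) :=
  \int[gauss k]_y (F y * (expR (sqn y / 2))%:E).

Lemma measurable_expR_sqn k (a : R) :
  measurable_fun setT (fun y : k.-tuple R => expR (a * sqn y)).
Proof.
by apply: measurableT_comp => //; apply: measurable_funM => //; exact: measurable_sqn.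
Qed.

Lemma measurable_weight k :
  measurable_fun setT (fun y : k.-tuple R => (expR (sqn y / 2))%:E).
Proof.
apply/measurable_EFinP; under eq_fun do rewrite mulrC.
exact: measurable_expR_sqn.
Qed.

Lemma lam_ge0 k (F : k.-tuple R -> \bar R) : (forall x, 0 <= F x) -> 0 <= lam F.
Proof.
by move=> F0; apply: integral_ge0 => x _; rewrite mule_ge0// lee_fin expR_ge0.
Qed.

Lemma eq_lam k (F G : k.-tuple R -> \bar R) : F =1 G -> lam F = lam G.
Proof. by move=> FG; apply: eq_integral => x _; rewrite FG. Qed.

Lemma lam0 (F : 0.-tuple R -> \bar R) : measurable_fun setT F -> lam F = F [tuple].
Proof.
move=> mF; rewrite /lam std_gaussian0; last first.
  by apply: emeasurable_funM => //; exact: measurable_weight.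
by rewrite /sqn big_ord0 mul0r expR0 mule1.
Qed.

Lemma lamZ k (c : R) (F : k.-tuple R -> \bar R) : (0 <= c)%R -> measurable_fun setT F ->
  (forall x, 0 <= F x) -> lam (fun x => c%:E * F x) = c%:E * lam F.
Proof.
move=> c0 mF F0; rewrite /lam -ge0_integralZl//.
- by apply: eq_integral => x _; rewrite muleA.
- by apply: emeasurable_funM => //; exact: measurable_weight.
- by move=> x _; rewrite mule_ge0// lee_fin expR_ge0.
Qed.

Lemma lamS k (F : k.+1.-tuple R -> \bar R) : measurable_fun setT F ->
  (forall x, 0 <= F x) ->
  lam F = \int[N01]_x (lam (fun y => F (tcons x y)) * (expR (x ^+ 2 / 2))%:E).
Proof.
move=> mF F0; rewrite /lam std_gaussianS; last 2 first.
- by apply: emeasurable_funM => //; exact: measurable_weight.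
- by move=> x; rewrite mule_ge0// lee_fin expR_ge0.
apply: eq_integral => x _; rewrite -ge0_integralZr//.
- apply: eq_integral => y _.
  by rewrite -muleA -EFinM -expRD sqn_cons mulrDl addrC.
- apply: emeasurable_funM; first exact: measurable_section_cons.
  exact: measurable_weight.
- by move=> y _; rewrite mule_ge0// lee_fin expR_ge0.
Qed.

Lemma measurable_lam d (T : measurableType d) k (G : T -> k.-tuple R -> \bar R) :
  measurable_fun setT (fun p : T * k.-tuple R => G p.1 p.2) ->
  (forall t x, 0 <= G t x) -> measurable_fun setT (fun t => lam (G t)).
Proof.
move=> mG G0.
pose H (p : T * k.-tuple R) := G p.1 p.2 * (expR (sqn p.2 / 2))%:E.
apply: (@measurable_fun_fubini_tonelli_F _ _ _ _ _ (gauss k) H).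
  apply: emeasurable_funM => //.
  exact: (measurableT_comp (@measurable_weight k) measurable_snd).
by move=> p; rewrite mule_ge0// lee_fin expR_ge0.
Qed.

Lemma measurable_tcons k : measurable_fun setT (fun p : R * k.-tuple R => tcons p.1 p.2).
Proof.
rewrite (_ : (fun _ => _) = @Defs.cons_tuple R k); first exact: measurable_cons_tuple.
by apply/funext => -[].
Qed.

Lemma measurable_lam_tcons k (F : k.+1.-tuple R -> \bar R) : measurable_fun setT F ->
  (forall x, 0 <= F x) -> measurable_fun setT (fun x => lam (fun y => F (tcons x y))).
Proof.
move=> mF F0; apply: measurable_lam => //.
by apply: measurableT_comp mF _; exact: measurable_tcons.
Qed.

(** Each coordinate contributes one factor [a^-1] by the one-dimensional change of variable. The
    induction generalises [F] because each step freezes its first coordinate. *)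
Lemma lam_affine k (x : k.-tuple R) (a : R) (F : k.-tuple R -> \bar R) :
  (0 < a)%R -> measurable_fun setT F -> (forall x, 0 <= F x) ->
  lam (fun v => F (axpy x a v)) = (a^-1 ^+ k)%:E * lam F.
Proof.
move=> a0; elim: k => [|k IH] in x F * => mF F0.
  rewrite !lam0//; last first.
    by apply: measurableT_comp mF _; exact: measurable_axpy.
  by rewrite expr0 mul1e; congr F; exact: tuple0.
elim/tuple_consP: x => x0 x.
rewrite lamS//; last first.
  by apply: measurableT_comp mF _; exact: measurable_axpy.
under eq_integral.
  move=> v0 _; under eq_lam do rewrite axpy_cons.
  rewrite (IH x (fun y => F (tcons (x0 + a * v0)%R y)))//; last exact: measurable_section_cons.
  rewrite -muleA.
  over.
rewrite ge0_integralZl//; last 3 first.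
- apply: emeasurable_funM.
    apply: (measurableT_comp (measurable_lam_tcons mF F0)).
    exact: measurable_affine.
  by apply/measurable_EFinP; apply: measurableT_comp => //; apply: measurable_funM.
- by move=> v0 _; rewrite mule_ge0 ?lam_ge0// lee_fin expR_ge0.
- by rewrite lee_fin exprn_ge0// invr_ge0 ltW.
rewrite (ge0_integral_normal_affine x0 a0 (F := fun x => lam (fun y => F (tcons x y))))//;
  last 2 first.
- exact: measurable_lam_tcons.
- by move=> z; exact: lam_ge0.
by rewrite -lamS// muleA -EFinM exprS mulrC.
Qed.

(** Tonelli's theorem on $\mathbb{R}^k\times\mathbb{R}^m$, by induction on [k]. Separate arguments
    for the coordinates and the squared norm let [G] absorb a frozen coordinate [x]: the first gains
    an entry, the second gains [x ^+ 2]. *)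
Lemma lam_split k m (G : k.-tuple R -> R -> \bar R) :
  measurable_fun setT (fun p : k.-tuple R * R => G p.1 p.2) ->
  (forall z s, 0 <= G z s) ->
  lam (fun y : (k + m).-tuple R => G (first_coords k y) (sqn y)) =
  lam (fun z => lam (fun y : m.-tuple R => G z (sqn z + sqn y)%R)).
Proof.
elim: k => [|k IH] in G * => mG G0.
  rewrite lam0; last first.
    apply: measurable_lam => //=; apply: (measurable_comp2 mG) => //.
    by apply: measurable_funD; apply: (measurableT_comp (@measurable_sqn _ _)).
  apply: eq_lam => y; congr G; first exact: tuple0.
  by rewrite [X in (X + _)%R]/sqn big_ord0 add0r.
have mG' x : measurable_fun setT
    (fun p : k.-tuple R * R => G (tcons x p.1) (x ^+ 2 + p.2)%R).
  apply: (measurable_comp2 mG); last exact: measurable_funD.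
  by apply: (measurable_comp2 (G := fun a z => tcons a z)) => //; exact: measurable_tcons.
rewrite [LHS]lamS//; last first.
  apply: (measurable_comp2 mG); first exact: measurable_first_coords.
  exact: measurable_sqn.
rewrite [RHS]lamS//; last 2 first.
- apply: measurable_lam => //=; apply: (measurable_comp2 mG) => //.
  by apply: measurable_funD; apply: (measurableT_comp (@measurable_sqn _ _)).
- by move=> z; exact: lam_ge0.
apply: eq_integral => x _; congr (_ * _).
transitivity (lam (fun y : (k + m).-tuple R =>
    G (tcons x (first_coords k y)) (x ^+ 2 + sqn y)%R)).
  by apply: eq_lam => y; rewrite first_coords_cons -sqn_cons.
transitivity (lam (fun z => lam (fun y : m.-tuple R =>
    G (tcons x z) (x ^+ 2 + (sqn z + sqn y))%R))).
  exact: (IH (fun z s => G (tcons x z) (x ^+ 2 + s)%R) (mG' x) (fun _ _ => G0 _ _)).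
by apply: eq_lam => z; apply: eq_lam => y; rewrite sqn_cons addrA.
Qed.

End lebesgue_functional.

(** * Radial functions on $\mathbb{R}^n$ *)

Section density_measure.
Local Open Scope ereal_scope.
Context d (T : measurableType d) (R : realType).
Variables (m : {measure set T -> \bar R}) (g : T -> R).
Hypotheses (mg : measurable_fun setT g) (g0 : forall x, (0 <= g x)%R).

Let nu (A : set T) : \bar R := \int[m]_(x in A) (g x)%:E.

Let nu0 : nu set0 = 0.
Proof. exact: integral_set0. Qed.

Let nu_ge0 A : 0 <= nu A.
Proof. by apply: integral_ge0 => x _; rewrite lee_fin. Qed.

Let nu_sigma_additive : semi_sigma_additive nu.
Proof.
move=> F mF tF mUF; rewrite /nu; apply: cvg_toP.
  apply: ereal_nondecreasing_is_cvgn => a b ab.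
  by apply: lee_sum_nneg_natr => // k _ _; exact: nu_ge0.
rewrite ge0_integral_bigcup//.
- by apply/measurable_EFinP; exact: measurable_funTS.
- by move=> x _; rewrite lee_fin.
Qed.

HB.instance Definition _ := isMeasure.Build _ _ _ nu nu0 nu_ge0 nu_sigma_additive.

Lemma density_measure_exists : exists nu : {measure set T -> \bar R},
  forall A, nu A = \int[m]_(x in A) (g x)%:E.
Proof. by exists nu. Qed.

End density_measure.

Section rays.
Local Open Scope ereal_scope.
Context (R : realType).

(** Left rays are stable under intersection, generate the Borel sets and exhaust the line.
    Finiteness is asked on rays only, because the image of Lebesgue measure under the squared norm
    has infinite total mass. *)
Lemma measure_unique_rays (m1 m2 : {measure set (measurableTypeR R) -> \bar R}) :
  (forall b : R, m1 `]-oo, b[%classic < +oo) ->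
  (forall b : R, m1 `]-oo, b[%classic = m2 `]-oo, b[%classic) ->
  forall A, measurable A -> m1 A = m2 A.
Proof.
move=> m1oo m12.
move=> A mA.
apply: (@measure_unique _ R (measurableTypeR R) (@RGenInftyO.G R)
  (fun n => `]-oo, n%:R[%classic)) => //.
- exact: RGenInftyO.measurableE.
- move=> _ _ [x ->] [y ->]; exists (Num.min x y).
  by apply/seteqP; split => z /=; rewrite !in_itv/= lt_min => /andP.
- by move=> n; exists n%:R.
- apply/seteqP; split => // x _; exists (Num.truncn `|x|).+1 => //=; rewrite in_itv/=.
  by rewrite (le_lt_trans (ler_norm _))// truncnS_gt.
- by move=> _ [b ->].
Qed.

End rays.

(** * Polar coordinates in the squared radius *)

Section radial.
Local Open Scope ereal_scope.
Context (R : realType).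
Local Notation mu := (@lebesgue_measure R).

Lemma measurable_sqrt : measurable_fun setT (@Num.sqrt R).
Proof. by apply: continuous_measurable_fun; exact: sqrt_continuous. Qed.

Lemma measurable_sqrtX m : measurable_fun setT (fun s : R => Num.sqrt s ^+ m)%R.
Proof. by apply: measurable_funX; exact: measurable_sqrt. Qed.

Definition tzero k : k.-tuple R := [tuple 0%R | i < k].

Lemma sqn_axpy0 k (a : R) (v : k.-tuple R) : sqn (axpy (tzero k) a v) = (a ^+ 2 * sqn v)%R.
Proof.
rewrite /sqn big_distrr/=; apply: eq_bigr => i _.
by rewrite !tnth_mktuple add0r exprMn.
Qed.

(** The substitution $s = bu$ gives $\sqrt b^{\,m}$ from the integrand and $b = \sqrt b^{\,2}$ from
    the measure. *)
Lemma integral_sqrtX_ray m (b : R) : (0 < m)%N -> (0 < b)%R ->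
  \int[mu]_(s in `]-oo, b[) (Num.sqrt s ^+ m)%:E =
  (Num.sqrt b ^+ m.+2)%:E * \int[mu]_(s in `]-oo, 1%R[) (Num.sqrt s ^+ m)%:E.
Proof.
move=> m0 b0; rewrite [LHS]integral_mkcond [in RHS]integral_mkcond.
set G := (X in \int[mu]_x X x = _); set G1 := (X in _ = _ * \int[mu]_x X x).
have mG c : measurable_fun setT ((fun s : R => (Num.sqrt s ^+ m)%:E) \_ `]-oo, c[).
  apply/(measurable_restrictT _ _).1 => //; apply/measurable_EFinP.
  by apply: measurable_funTS; exact: measurable_sqrtX.
have G0 c x : 0 <= ((fun s : R => (Num.sqrt s ^+ m)%:E) \_ `]-oo, c[) x.
  by apply: erestrict_ge0 => y _; rewrite lee_fin exprn_ge0.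
have := ge0_integral_affine 0 b0 (mG b) (G0 b).
rewrite (_ : (fun x => _) = (fun x => (Num.sqrt b ^+ m)%:E * G1 x)); last first.
  apply/funext => x; rewrite /G1 add0r !patchE !mem_setE/= !in_itv/=.
  rewrite gtr_pMr//; case: ifPn => _; last by rewrite mule0.
  by rewrite -EFinM -exprMn sqrtrM// ltW.
rewrite ge0_integralZl; [|by []|exact: mG|by move=> x _; exact: G0|]; last first.
  by rewrite lee_fin exprn_ge0.
move=> /(congr1 (fun z => b%:E * z)).
rewrite !muleA -!EFinM divff ?gt_eqF// mul1e => <-.
by rewrite !exprS mulrA -expr2 sqr_sqrtr// ltW.
Qed.

(** The integrand is bounded below on $[1/2, 1[$, is at most 1 on $[0, 1[$, and vanishes on negative
    reals, where [0 < m] excludes the zeroth power, which would be 1. *)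
Lemma integral_sqrtX_unit_ray m : (0 < m)%N ->
  0 < \int[mu]_(s in `]-oo, 1%R[) (Num.sqrt s ^+ m)%:E < +oo.
Proof.
move=> m0; have ms D : measurable_fun D (fun s : R => (Num.sqrt s ^+ m)%:E).
  by apply/measurable_EFinP; apply: measurable_funTS; exact: measurable_sqrtX.
apply/andP; split.
  apply: (@lt_le_trans _ _ (\int[mu]_(s in `[2^-1%R, 1%R[) (Num.sqrt 2^-1%R ^+ m)%:E)).
    rewrite integral_cst//= lebesgue_measure_itv/= lte_fin invf_lt1// ltr1n.
    rewrite -EFinD -EFinM lte_fin mulr_gt0//.
    by rewrite subr_gt0 invf_lt1// ltr1n.
  apply: (@le_trans _ _ (\int[mu]_(s in `[2^-1%R, 1%R[) (Num.sqrt s ^+ m)%:E)).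
    apply: ge0_le_integral => //.
    - exact: ms.
    move=> x /=; rewrite in_itv/= => /andP[x2 _].
    by rewrite lee_fin lerXn2r ?nnegrE// ler_wsqrtr.
  apply: ge0_subset_integral => //.
  - exact: ms.
  - by move=> x /=; rewrite !in_itv/= => /andP[].
apply: (@le_lt_trans _ _ (\int[mu]_(s in `]-oo, 1%R[) (\1_(`[0%R, 1%R]) s)%:E)).
  apply: ge0_le_integral => //.
  - exact: ms.
  - by apply/measurable_EFinP; apply: measurable_funTS; exact: measurable_indic.
  move=> x /=; rewrite in_itv/= => x1; rewrite lee_fin indicE mem_setE/= in_itv/=.
  have [x0|x0] := leP 0%R x; last by rewrite ltr0_sqrtr// expr0n/= gtn_eqF.
  rewrite (ltW x1)/= exprn_ile1//.
  by rewrite -sqrtr1 ler_wsqrtr// ltW.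
rewrite integral_indic//=.
apply: (@le_lt_trans _ _ (mu `[0%R, 1%R])).
  by apply: le_measure; rewrite ?inE//; exact: measurableI.
by rewrite lebesgue_measure_itv/= lte01 -EFinD ltry.
Qed.

Lemma lam_ball k (b : R) : (0 < b)%R ->
  lam (fun y : k.-tuple R => (\1_(`]-oo, b[%classic : set R) (sqn y) : R)%:E) =
  (Num.sqrt b ^+ k)%:E *
  lam (fun y : k.-tuple R => (\1_(`]-oo, 1%R[%classic : set R) (sqn y) : R)%:E).
Proof.
move=> b0; have sb0 : (0 < Num.sqrt b)%R by rewrite sqrtr_gt0.
have mi c : measurable_fun setT
    (fun y : k.-tuple R => (\1_(`]-oo, c[%classic : set R) (sqn y) : R)%:E).
  apply/measurable_EFinP; apply: (measurableT_comp _ (@measurable_sqn R k)).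
  exact: measurable_indic.
have := lam_affine (tzero k) sb0 (mi b).
rewrite (_ : (fun v => _) =
    (fun y : k.-tuple R => (\1_(`]-oo, 1%R[%classic : set R) (sqn y) : R)%:E)).
  move=> -> //; rewrite muleA -EFinM -exprMn divff ?gt_eqF// expr1n mul1e//.
apply/funext => v; rewrite !indicE !mem_setE/= !in_itv/= sqn_axpy0 sqr_sqrtr ?ltW//.
by rewrite gtr_pMr.
Qed.

Lemma lam_unit_ball_lty k :
  lam (fun y : k.-tuple R => (\1_(`]-oo, 1%R[%classic : set R) (sqn y) : R)%:E) < +oo.
Proof.
apply: (@le_lt_trans _ _ (\int[std_gaussian R k]_y (expR 1)%:E)).
  apply: ge0_le_integral => //.
  - apply: emeasurable_funM; last exact: measurable_weight.
    apply/measurable_EFinP; apply: (measurableT_comp _ (@measurable_sqn R k)).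
    exact: measurable_indic.
  move=> x _; rewrite indicE mem_setE/= in_itv/=; case: (ltP (sqn x) 1%R) => /= x1.
    rewrite mul1e lee_fin ler_expR; lra.
  by rewrite mul0e lee_fin expR_ge0.
by rewrite integral_cst//= probability_setT mule1 ltry.
Qed.

(** In the variable $s = r^2$, the polar factor $r^{m-1}\,dr$ is $\sqrt s^{\,m-2}\,ds$ up to a
    constant. In place of a surface measure, the image of Lebesgue measure under [sqn] is compared
    with this density on the rays $]-\infty, b[$: for $b > 0$ both are multiples of $\sqrt b^{\,m}$,
    matched on the unit ball, and for $b \le 0$ both vanish, the density because [m - 2] is
    positive. *)
Lemma lam_radial m : (2 < m)%N -> exists2 c : R, (0 <= c)%R &
  forall F : R -> \bar R, measurable_fun setT F -> (forall s, 0 <= F s) ->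
  lam (fun y : m.-tuple R => F (sqn y)) =
  c%:E * \int[mu]_s (F s * (Num.sqrt s ^+ (m - 2))%:E).
Proof.
move=> m2; have m20 : (0 < m - 2)%N by rewrite subn_gt0.
set V := lam (fun y : m.-tuple R => (\1_(`]-oo, 1%R[%classic : set R) (sqn y) : R)%:E).
have Vfin : V \is a fin_num.
  by rewrite ge0_fin_numE ?lam_unit_ball_lty//; apply: lam_ge0 => y; rewrite lee_fin.
pose I1 := \int[mu]_(s in `]-oo, 1%R[) (Num.sqrt s ^+ (m - 2))%:E.
have /andP[I10 I1oo] := integral_sqrtX_unit_ray m20.
have I1fin : I1 \is a fin_num by rewrite ge0_fin_numE// ltW.
have V0 : (0 <= fine V)%R by apply: fine_ge0; apply: lam_ge0 => y; rewrite lee_fin.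
have c0 : (0 <= fine V / fine I1)%R by rewrite divr_ge0// fine_ge0// ltW.
exists (fine V / fine I1)%R => // F mF F0.
have [nu1 nu1E] : exists nu : {measure set (m.-tuple R) -> \bar R},
    forall A, nu A = \int[std_gaussian R m]_(x in A) (expR (sqn x / 2))%:E.
  apply: density_measure_exists; last by move=> x; exact: expR_ge0.
  by apply/measurable_EFinP; exact: measurable_weight.
have [nu2 nu2E] : exists nu : {measure set (measurableTypeR R) -> \bar R},
    forall A, nu A = \int[mu]_(s in A) (fine V / fine I1 * Num.sqrt s ^+ (m - 2))%:E.
  apply: density_measure_exists; last by move=> x; rewrite mulr_ge0// exprn_ge0.
  by apply: measurable_funM => //; exact: measurable_sqrtX.
have msqn : measurable_fun setT (@sqn R m : _ -> measurableTypeR R) by exact: measurable_sqn.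
have nu12 A : measurable A -> pushforward_measure nu1 msqn A = nu2 A.
  have ray (b : R) : pushforward_measure nu1 msqn `]-oo, b[%classic =
      lam (fun y : m.-tuple R => (\1_(`]-oo, b[%classic : set R) (sqn y) : R)%:E).
    rewrite /= /pushforward nu1E integral_mkcond; apply: eq_integral => y _.
    by rewrite epatch_indic/= muleC.
  have rayM (b : R) : (0 < b)%R ->
      pushforward_measure nu1 msqn `]-oo, b[%classic =
      (Num.sqrt b ^+ m * fine V)%:E.
    by move=> b0; rewrite ray lam_ball// EFinM fineK.
  have ray0 (b : R) : (b <= 0)%R ->
      pushforward_measure nu1 msqn `]-oo, b[%classic = 0.
    move=> b0; rewrite /= /pushforward (_ : _ @^-1` _ = set0) ?measure0//.
    apply/seteqP; split => // y /=; rewrite in_itv/= => yb.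
    by have := lt_le_trans yb b0; rewrite ltNge sqn_ge0.
  move: A; apply: measure_unique_rays => b; have [b0|b0] := leP b 0%R.
  - by rewrite ray0.
  - by rewrite rayM// ltry.
  - rewrite ray0// nu2E integral0_eq// => s /=; rewrite in_itv/= => sb.
    by rewrite ltr0_sqrtr ?(lt_le_trans sb)// expr0n gtn_eqF// mulr0.
  rewrite rayM// nu2E.
  under eq_integral do rewrite EFinM.
  rewrite ge0_integralZl//; last first.
    by apply: measurable_funTS; apply/measurable_EFinP; exact: measurable_sqrtX.
  rewrite integral_sqrtX_ray// -/I1 -(fineK I1fin) -!EFinM; congr EFin.
  have m2E : (m - 2).+2 = m by rewrite -addn2 subnK// ltnW.
  rewrite m2E mulrCA; congr (_ * _)%R; rewrite -mulrA mulVf ?mulr1//.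
  by rewrite /= gt_eqF// fine_gt0// I10 I1oo.
have -> : lam (fun y : m.-tuple R => F (sqn y)) = \int[nu1]_y F (sqn y).
  rewrite (ge0_integral_density _ _ (fun A _ => nu1E A))//.
  - by apply/measurable_EFinP; exact: measurable_weight.
  - exact: (measurableT_comp mF (@measurable_sqn R m)).
transitivity (\int[nu2]_s F s).
  rewrite -[LHS](ge0_integral_pushforward msqn nu1 measurableT mF)//.
  by apply: eq_measure_integral => A mA _; exact: nu12.
rewrite (ge0_integral_density _ _ (fun A _ => nu2E A))//; last 2 first.
- by apply: measurable_funM => //; exact: measurable_sqrtX.
- by move=> s; rewrite mulr_ge0// exprn_ge0.
rewrite -ge0_integralZl//.
- by apply: eq_integral => s _; rewrite EFinM muleCA.
- by apply: emeasurable_funM => //; apply/measurable_EFinP; exact: measurable_sqrtX.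
- by move=> s _; rewrite mule_ge0// lee_fin exprn_ge0.
Qed.

End radial.

(** * Slices of $\mathbb{R}^{k+m}$ of constant norm *)

Section sphere_profile.
Local Open Scope ereal_scope.
Context (R : realType) (k m : nat).
Hypothesis m2 : (2 < m)%N.
Local Notation mu := (@lebesgue_measure R).

(** For [t > 0], the density (up to a constant) of the first [k] coordinates of a uniform point
on the sphere of radius [Num.sqrt t] in $\mathbb{R}^{k+m}$; it vanishes off the ball since
[Num.sqrt] is [0] on negative reals. *)
Definition profile (t : R) (z : k.-tuple R) : R := (Num.sqrt (t - sqn z) ^+ (m - 2))%R.

Lemma profile_ge0 t z : (0 <= profile t z)%R.
Proof. by rewrite exprn_ge0. Qed.

Lemma measurable_profile :
  measurable_fun setT (fun p : R * k.-tuple R => profile p.1 p.2).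
Proof.
rewrite /profile; apply: (measurableT_comp (@measurable_sqrtX R (m - 2))).
by apply: measurable_funB => //; apply: (measurableT_comp (@measurable_sqn R k)).
Qed.

Lemma measurable_profile1 t : measurable_fun setT (profile t).
Proof. by apply: (measurable_comp2 measurable_profile). Qed.

Definition profile_mass (F : k.-tuple R -> \bar R) (t : R) : \bar R :=
  lam (fun z => F z * (profile t z)%:E).

Lemma profile_mass_ge0 F t : (forall z, 0 <= F z) -> 0 <= profile_mass F t.
Proof. by move=> F0; apply: lam_ge0 => z; rewrite mule_ge0// lee_fin profile_ge0. Qed.

(** Put the last [m] coordinates in polar form; the shift $t = |z|^2 + s$ turns $\sqrt s^{\,m-2}$
    into [profile t z], and Tonelli moves the integral over [t] outside. *)
Lemma lam_radial_split : exists2 c : R, (0 <= c)%R &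
  forall G : k.-tuple R -> R -> \bar R,
  measurable_fun setT (fun p : k.-tuple R * R => G p.1 p.2) ->
  (forall z s, 0 <= G z s) ->
  lam (fun y : (k + m).-tuple R => G (first_coords k y) (sqn y)) =
  c%:E * \int[mu]_t profile_mass (G ^~ t) t.
Proof.
have [c c0 cE] := lam_radial R m2; exists c => // G mG G0.
rewrite lam_split//.
pose K z t := G z t * (profile t z)%:E.
have K0 z t : 0 <= K z t by rewrite mule_ge0// lee_fin profile_ge0.
have mK : measurable_fun setT (fun p : k.-tuple R * R => K p.1 p.2).
  apply: emeasurable_funM => //; apply/measurable_EFinP.
  exact: (measurable_comp2 measurable_profile).
transitivity (lam (fun z : k.-tuple R => c%:E * \int[mu]_t K z t)).
  apply: eq_lam => z.
  transitivity (c%:E * \int[mu]_s (G z (sqn z + s)%R * (Num.sqrt s ^+ (m - 2))%:E)).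
    apply: (cE (fun s => G z (sqn z + s)%R) _ (fun _ => G0 _ _)).
    by apply: (measurable_comp2 mG) => //; exact: measurable_funD.
  congr (c%:E * _).
  transitivity (\int[mu]_s K z (sqn z + 1 * s)%R).
    by apply: eq_integral => s _; rewrite /K /profile mul1r addrAC subrr add0r.
  rewrite ge0_integral_affine//; last exact: (measurable_comp2 mK).
  by rewrite invr1 mul1e.
have mIK : measurable_fun setT (fun z => \int[mu]_t K z t).
  exact: (@measurable_fun_fubini_tonelli_F _ _ _ _ _ mu (fun p => K p.1 p.2)).
rewrite lamZ//; last by move=> z; exact: integral_ge0.
congr (_ * _); rewrite /profile_mass /lam.
transitivity (\int[std_gaussian R k]_z \int[mu]_t (K z t * (expR (sqn z / 2))%:E)).
  apply: eq_integral => z _; rewrite ge0_integralZr//.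
  exact: (measurable_comp2 mK).
rewrite (@fubini_tonelli _ _ _ _ _ (std_gaussian R k) mu
  (fun p => K p.1 p.2 * (expR (sqn p.1 / 2))%:E))//.
- apply: emeasurable_funM => //.
  exact: (measurableT_comp (@measurable_weight R k) measurable_fst).
- by move=> p; rewrite mule_ge0// lee_fin expR_ge0.
Qed.

Lemma measurable_profile_mass (F : k.-tuple R -> \bar R) :
  measurable_fun setT F -> (forall z, 0 <= F z) ->
  measurable_fun setT (profile_mass F).
Proof.
move=> mF F0; apply: measurable_lam => /=; last first.
  by move=> t z; rewrite mule_ge0// lee_fin profile_ge0.
apply: emeasurable_funM; first exact: (measurableT_comp mF measurable_snd).
by apply/measurable_EFinP; exact: measurable_profile.
Qed.

(** The profile vanishes unless $|z|^2 < t$, and there the exponential is at most $e^{t/2}$. *)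
Lemma profile_le (t : R) z : (0 <= t)%R ->
  (profile t z * expR (sqn z / 2) <= Num.sqrt t ^+ (m - 2) * expR (t / 2))%R.
Proof.
move=> t0; rewrite /profile; have [tz|tz] := leP (t - sqn z)%R 0%R.
  rewrite ler0_sqrtr// expr0n gtn_eqF ?subn_gt0// mul0r.
  by rewrite mulr_ge0 ?expR_ge0// exprn_ge0.
rewrite ler_pM ?expR_ge0 ?exprn_ge0//.
  by rewrite lerXn2r ?nnegrE// ler_wsqrtr// gerBl sqn_ge0.
rewrite ler_expR; lra.
Qed.

Lemma profile_mass_lty (t : R) : (0 <= t)%R -> profile_mass (cst 1) t < +oo.
Proof.
move=> t0.
apply: (@le_lt_trans _ _ (\int[std_gaussian R k]_y (Num.sqrt t ^+ (m - 2) * expR (t / 2))%:E)).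
  apply: ge0_le_integral => //.
  - by move=> x _; rewrite mul1e -EFinM lee_fin mulr_ge0 ?expR_ge0// profile_ge0.
  - apply: emeasurable_funM; last exact: measurable_weight.
    apply: emeasurable_funM => //; apply/measurable_EFinP.
    exact: measurable_profile1.
  - by move=> x _; rewrite mul1e -EFinM lee_fin profile_le.
by rewrite integral_cst//= probability_setT mule1 ltry.
Qed.

Lemma profile_mass_neg (t : R) F : (t <= 0)%R -> profile_mass F t = 0.
Proof.
move=> t0; apply: integral0_eq => z _; rewrite /profile ler0_sqrtr.
  by rewrite expr0n gtn_eqF ?subn_gt0// mule0 mul0e.
by rewrite subr_le0 (le_trans t0)// sqn_ge0.
Qed.

Lemma profile_mass_scale (t : R) : (0 < t)%R ->
  profile_mass (cst 1) t = (Num.sqrt t ^+ (k + (m - 2)))%:E * profile_mass (cst 1) 1.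
Proof.
move=> t0; have st0 : (0 < Num.sqrt t)%R by rewrite sqrtr_gt0.
have mp s : measurable_fun setT (fun z => cst 1 z * (profile s z)%:E).
  by apply: emeasurable_funM => //; apply/measurable_EFinP; exact: measurable_profile1.
have p0 s z : 0 <= cst 1 z * (profile s z)%:E by rewrite mul1e lee_fin profile_ge0.
have := lam_affine (tzero R k) st0 (mp t) (p0 t).
rewrite (@eq_lam _ _ _ (fun z => (Num.sqrt t ^+ (m - 2))%:E * (cst 1 z * (profile 1 z)%:E))).
  rewrite lamZ; [|by rewrite exprn_ge0|exact: mp|by move=> z; exact: p0].
  move=> /(congr1 (fun x => (Num.sqrt t ^+ k)%:E * x)).
  rewrite [in RHS]muleA -!EFinM -exprMn divff ?gt_eqF// expr1n mul1e.
  by rewrite /profile_mass exprD EFinM -muleA => ->.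
move=> z; rewrite !mul1e -EFinM /profile sqn_axpy0 sqr_sqrtr ?ltW//.
rewrite -exprMn -sqrtrM ?ltW//; congr (Num.sqrt _ ^+ _)%:E; ring.
Qed.

(** By scaling, a zero at one positive [t] would force zeros everywhere. Slicing $e^{-|y|^2/2}$,
    whose integral under [lam] is the Gaussian total mass 1, would then give 0. *)
Lemma profile_mass_gt0 (t : R) : (0 < t)%R -> 0 < profile_mass (cst 1) t.
Proof.
move=> t0; rewrite lt_neqAle profile_mass_ge0// andbT; apply/eqP => /esym J0.
have {}J0 : profile_mass (cst 1) 1 = 0.
  apply/eqP; move/eqP: J0; rewrite profile_mass_scale// mule_eq0 eqe.
  by rewrite expf_eq0 sqrtr_eq0 leNgt t0/= andbF.
have {}J0 s : profile_mass (cst 1) s = 0.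
  have [s0|s0] := leP s 0%R; first exact: profile_mass_neg.
  by rewrite profile_mass_scale// J0 mule0.
have [c _ cE] := lam_radial_split.
have me : measurable_fun setT (fun s : R => (expR (- (s / 2)))%:E).
  apply/measurable_EFinP; apply: measurableT_comp => //.
  by apply: measurableT_comp => //; exact: measurable_funM.
have := cE (fun _ s => (expR (- (s / 2)))%:E) (measurableT_comp me measurable_snd).
have -> : lam (fun y : (k + m).-tuple R => (expR (- (sqn y / 2)))%:E) = 1.
  rewrite /lam; under eq_integral do rewrite -EFinM -expRD addNr expR0.
  by rewrite integral_cst//= probability_setT mule1.
rewrite integral0_eq => [|s _].
  rewrite mule0 => h; suff /eqP : 1%E = 0 :> \bar R by rewrite onee_eq0.
  by apply: h => _ s; rewrite lee_fin expR_ge0.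
rewrite /profile_mass (@eq_lam _ _ _
  (fun z => (expR (- (s / 2)))%:E * (cst 1 z * (profile s z)%:E))); last first.
  by move=> z; rewrite mul1e.
rewrite lamZ ?expR_ge0//.
- by rewrite -/(profile_mass (cst 1) s) J0 mule0.
- by apply: emeasurable_funM => //; apply/measurable_EFinP; exact: measurable_profile1.
- by move=> z; rewrite mul1e lee_fin profile_ge0.
Qed.

End sphere_profile.

(** * Rotation-invariant measures on the sphere *)

Section householder.
Context (R : realType) (n : nat).
Implicit Types (x y w : n.-tuple R) (Q : 'M[R]_n).

Definition dot x y : R := \sum_(i < n) tnth x i * tnth y i.

Lemma dotC x y : dot x y = dot y x.
Proof. by apply: eq_bigr => i _; rewrite mulrC. Qed.

Lemma sqn_dot x : sqn x = dot x x.
Proof. by apply: eq_bigr => i _; rewrite expr2. Qed.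

Lemma sqn_axpy x a y : sqn (axpy x a y) = sqn x + 2 * a * dot x y + a ^+ 2 * sqn y.
Proof.
rewrite /sqn /dot !big_distrr/= -!big_split/=; apply: eq_bigr => i _.
rewrite tnth_mktuple; ring.
Qed.

Lemma dot_mulmx Q x y : Q^T = Q -> dot x (mulmx_tuple Q y) = dot (mulmx_tuple Q x) y.
Proof.
move=> QT; rewrite /dot.
under eq_bigr do rewrite tnth_mktuple big_distrr/=.
under [RHS]eq_bigr do rewrite tnth_mktuple big_distrl/=.
rewrite exchange_big/=; apply: eq_bigr => j _; apply: eq_bigr => i _.
by rewrite -{1}QT mxE mulrCA mulrA.
Qed.

Lemma mulmx_tupleM P Q x :
  mulmx_tuple P (mulmx_tuple Q x) = mulmx_tuple (P *m Q) x.
Proof.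
apply/eq_from_tnth => i; rewrite !tnth_mktuple.
under eq_bigr do rewrite tnth_mktuple big_distrr/=.
rewrite exchange_big/=; apply: eq_bigr => j _.
by rewrite mxE big_distrl/=; apply: eq_bigr => l _; rewrite mulrA.
Qed.

Lemma mulmx_tuple1 x : mulmx_tuple 1%:M x = x.
Proof.
apply/eq_from_tnth => i; rewrite tnth_mktuple (bigD1 i)//= mxE eqxx mul1r.
by rewrite big1 ?addr0// => j /negbTE ji; rewrite mxE eq_sym ji mul0r.
Qed.

Lemma sqn_mulmx Q x : Q^T = Q -> Q *m Q = 1%:M -> sqn (mulmx_tuple Q x) = sqn x.
Proof.
by move=> QT QQ; rewrite !sqn_dot dot_mulmx// mulmx_tupleM QQ mulmx_tuple1.
Qed.

(** The reflection in the hyperplane orthogonal to [w]. Reflections suffice as rotations here: they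
    are symmetric involutions, and one of them carries a vector to any other of the same norm. *)
Definition householder w : 'M[R]_n :=
  let W := \col_i tnth w i in 1%:M - (2 / sqn w) *: (W *m W^T).

Lemma householder_sym w : (householder w)^T = householder w.
Proof. by rewrite /householder linearB/= linearZ/= trmx_mul trmxK trmx1. Qed.

Lemma householderK w : sqn w != 0 -> householder w *m householder w = 1%:M.
Proof.
move=> w0; rewrite /householder; set W := \col_i _.
have WW : W^T *m W = (sqn w)%:M.
  apply/matrixP => i j; rewrite !ord1 !mxE eqxx mulr1n.
  by apply: eq_bigr => l _; rewrite !mxE expr2.
rewrite mulmxBl mul1mx mulmxBr mulmx1 -scalemxAl -scalemxAr.
rewrite -mulmxA (mulmxA W^T) WW mul_scalar_mx -scalemxAr !scalerA.
by rewrite divfK// mulr_natr mulr2n scalerDl opprB addrK subrK.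
Qed.

(** Equal norms give $|x-y|^2 = 2\langle x-y, x\rangle$, so the reflection subtracts exactly $x-y$
    from $x$. *)
Lemma householder_swap x y : sqn x = sqn y -> sqn (axpy x (-1) y) != 0 ->
  mulmx_tuple (householder (axpy x (-1) y)) x = y.
Proof.
move=> xy; set w := axpy x (-1) y => w0.
have wx : sqn w = 2 * dot w x.
  rewrite sqn_axpy -xy.
  have -> : dot w x = sqn x - dot x y.
    rewrite /dot /sqn -sumrB; apply: eq_bigr => i _; rewrite tnth_mktuple; ring.
  ring.
apply/eq_from_tnth => i; rewrite tnth_mktuple.
transitivity (tnth x i - 2 / sqn w * tnth w i * dot w x).
  rewrite /householder.
  under eq_bigr => j _.
    rewrite !mxE big_ord1 !mxE mulrBl.
    rewrite (_ : 2 / sqn w * _ * _ = 2 / sqn w * tnth w i * (tnth w j * tnth x j)); last ring.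
    over.
  rewrite sumrB -big_distrr/=; congr (_ - _).
  rewrite (bigD1 i)//= eqxx mul1r big1 ?addr0// => j /negbTE ji.
  by rewrite eq_sym ji mul0r.
have d0 : dot w x != 0 by move: w0; rewrite wx mulf_eq0 negb_or => /andP[].
rewrite (_ : 2 / sqn w * tnth w i * dot w x = tnth w i).
  by rewrite tnth_mktuple; ring.
by rewrite wx; field.
Qed.

End householder.

(** * Gaussian perturbation of a random point of the sphere *)

Section sphere_average.
Local Open Scope ereal_scope.
Context (R : realType) (n : nat) (sigma : probability (sphere R n) R).
Hypothesis sigma_rot : rotation_invariant sigma.
Local Notation gauss := (std_gaussian R).

Lemma sqn_sphere (x : sphere R n) : sqn (sval x) = n%:R.
Proof.
have /eqP := svalP x; rewrite /enorm -/(sqn _) => /(congr1 (fun z => z ^+ 2)%R).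
by rewrite !sqr_sqrtr// sqn_ge0.
Qed.

Lemma measurable_sval_sphere : measurable_fun setT (sval : sphere R n -> n.-tuple R).
Proof. by move=> _ B mB; exists B. Qed.

Lemma measurable_mulmx_tuple (Q : 'M[R]_n) : measurable_fun setT (mulmx_tuple Q).
Proof.
apply/measurable_fun_tnthP => i.
rewrite (_ : _ \o _ = fun x => \sum_(j < n) Q i j * tnth x j)%R; last first.
  by apply/funext => x /=; rewrite tnth_mktuple.
by apply: measurable_sum => j; apply: measurable_funM => //; exact: measurable_tnth.
Qed.

Lemma sphere_mulmxP (Q : 'M[R]_n) (QT : Q^T = Q) (QQ : Q *m Q = 1%:M) (x : sphere R n) :
  enorm (mulmx_tuple Q (sval x)) == Num.sqrt n%:R.
Proof. by rewrite /enorm -/(sqn _) sqn_mulmx// sqn_sphere. Qed.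

Definition sphere_mulmx Q QT QQ (x : sphere R n) : sphere R n :=
  exist (fun y : n.-tuple R => is_true (enorm y == Num.sqrt n%:R))
    (mulmx_tuple Q (sval x)) (sphere_mulmxP QT QQ x).

Lemma integral_sphere_mulmx (Q : 'M[R]_n) (g : n.-tuple R -> \bar R) :
  Q^T = Q -> Q *m Q = 1%:M -> measurable_fun setT g -> (forall x, 0 <= g x) ->
  \int[sigma]_x g (mulmx_tuple Q (sval x)) = \int[sigma]_x g (sval x).
Proof.
move=> QT QQ mg g0.
have mQ : measurable_fun setT (sphere_mulmx QT QQ).
  move=> _ _ [B mB <-]; rewrite !setTI.
  exists (mulmx_tuple Q @^-1` B); last by rewrite setTI.
  by rewrite -[X in measurable X]setTI; exact: measurable_mulmx_tuple.
rewrite -[LHS](@ge0_integral_pushforward _ _ _ _ _ _ mQ sigma setT (g \o sval))//; last 2 first.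
- exact: (measurableT_comp mg measurable_sval_sphere).
- by move=> x _; exact: g0.
transitivity (\int[pushforward_measure sigma mQ]_x g (sval x)) => //.
apply: eq_measure_integral => A mA _.
have QTQ : Q^T *m Q = 1%:M by rewrite QT.
rewrite -[RHS](sigma_rot QTQ mA) /= /pushforward; congr (sigma _).
apply/seteqP; split => [x /= Ax|x [y Ay yx]]; first by exists (sphere_mulmx QT QQ x).
by rewrite /= (_ : sphere_mulmx QT QQ x = y)//; apply/val_inj.
Qed.

(** The reflection exchanging [y] and [y'] moves across the inner product onto the sphere point,
    where [sigma] absorbs it. The case [y = y'] is separate because the reflection vector must be
    nonzero. *)
Lemma integral_sphere_dot (g : R -> \bar R) (y y' : n.-tuple R) :
  measurable_fun setT g -> (forall x, 0 <= g x) -> sqn y = sqn y' ->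
  \int[sigma]_x g (dot (sval x) y) = \int[sigma]_x g (dot (sval x) y').
Proof.
move=> mg g0 yy'; have [w0|w0] := eqVneq (sqn (axpy y (-1) y')) 0%R.
  suff -> : y = y' by [].
  apply/eq_from_tnth => i; apply/eqP; rewrite -subr_eq0 -sqrf_eq0.
  move/eqP: w0; rewrite psumr_eq0 => [/allP/(_ i)|? _]; last exact: sqr_ge0.
  by rewrite mem_index_enum tnth_mktuple mulN1r; exact.
have mgd z : measurable_fun setT (fun x : n.-tuple R => g (dot x z)).
  apply: (measurableT_comp mg); apply: measurable_sum => i.
  by apply: measurable_funM => //; exact: measurable_tnth.
rewrite -(householder_swap yy' w0).
rewrite -(@integral_sphere_mulmx (householder (axpy y (-1) y')) (fun x => g (dot x y)))//.
- by apply: eq_integral => x _; rewrite dot_mulmx// householder_sym.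
- exact: householder_sym.
- exact: householderK.
Qed.

(** The density at [y] of [x] plus Gaussian noise of standard deviation [e], without its normalising
    constant. *)
Definition noise_kernel (e : R) (x y : n.-tuple R) : R :=
  expR (- ((2 * e ^+ 2)^-1 * sqn (axpy y (-1) x)))%R.

Lemma measurable_noise_kernel e :
  measurable_fun setT (fun p : n.-tuple R * n.-tuple R => noise_kernel e p.1 p.2).
Proof.
apply: measurableT_comp => //; apply: measurableT_comp => //.
apply: measurable_funM => //; apply: (measurableT_comp (@measurable_sqn R n)).
exact: measurable_axpy.
Qed.

Definition noise_density (e : R) (y : n.-tuple R) : \bar R :=
  \int[sigma]_x (noise_kernel e (sval x) y)%:E.

Lemma measurable_noise_kernel_sphere e :
  measurable_fun setT (fun p : sphere R n * n.-tuple R => noise_kernel e (sval p.1) p.2).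
Proof.
apply: (measurable_comp2 (measurable_noise_kernel e)) => //.
exact: (measurableT_comp measurable_sval_sphere).
Qed.

Lemma noise_density_ge0 e y : 0 <= noise_density e y.
Proof. by apply: integral_ge0 => x _; rewrite lee_fin expR_ge0. Qed.

Lemma measurable_noise_density e : measurable_fun setT (noise_density e).
Proof.
apply: (@measurable_fun_fubini_tonelli_G _ _ _ _ _ sigma
  (fun p : sphere R n * n.-tuple R => (noise_kernel e (sval p.1) p.2)%:E)).
- by apply/measurable_EFinP; exact: measurable_noise_kernel_sphere.
- by move=> p; rewrite lee_fin expR_ge0.
Qed.

(** With $|x|^2 = n$ fixed, $|y-x|^2$ depends on [y] only through $|y|^2$ and $\langle x, y\rangle$,
    and the law of the latter depends only on $|y|$. *)
Lemma noise_density_radial e y y' : sqn y = sqn y' -> noise_density e y = noise_density e y'.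
Proof.
move=> yy'.
have E z : noise_density e z = \int[sigma]_x
    (expR (- ((2 * e ^+ 2)^-1 * (sqn z + - 2 * dot (sval x) z + n%:R)))%R)%:E.
  apply: eq_integral => x _; congr (expR (- (_ * _)))%:E.
  by rewrite sqn_axpy sqn_sphere (dotC z); ring.
rewrite !E yy'.
apply: (integral_sphere_dot (g := fun s =>
  (expR (- ((2 * e ^+ 2)^-1 * (sqn y' + - 2 * s + n%:R)))%R)%:E)) => //.
  apply/measurable_EFinP; apply: measurableT_comp => //; apply: measurableT_comp => //.
  apply: measurable_funM => //; apply: measurable_funD => //; apply: measurable_funD => //.
Qed.

(** At $y = x + ev$ the kernel is $e^{-|v|^2/2}$, which cancels the weight in [lam]; the factor
    [e^-1 ^+ n] is the Jacobian. Tonelli then averages the kernel over the sphere. *)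
Lemma integral_sphere_noise (e : R) (G : n.-tuple R -> \bar R) :
  (0 < e)%R -> measurable_fun setT G -> (forall x, 0 <= G x) ->
  \int[sigma]_x \int[gauss n]_v G (axpy (sval x) e v) =
  (e^-1 ^+ n)%:E * lam (fun y => G y * noise_density e y).
Proof.
move=> e0 mG G0.
pose K (x : sphere R n) y := G y * (noise_kernel e (sval x) y)%:E.
have mK : measurable_fun setT (fun p => K p.1 p.2).
  apply: emeasurable_funM; first exact: (measurableT_comp mG measurable_snd).
  by apply/measurable_EFinP; exact: measurable_noise_kernel_sphere.
have K0 x y : 0 <= K x y by rewrite mule_ge0// lee_fin expR_ge0.
transitivity (\int[sigma]_x ((e^-1 ^+ n)%:E * lam (K x))).
  apply: eq_integral => x _; rewrite -(lam_affine (sval x))//; last first.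
    exact: (measurable_comp2 mK).
  apply: eq_integral => v _; rewrite /K -muleA -EFinM -expRD.
  rewrite [X in expR X](_ : _ = 0)%R ?expR0 ?mule1//.
  have -> : axpy (axpy (sval x) e v) (-1) (sval x) = axpy (tzero R n) e v.
    apply/eq_from_tnth => i; rewrite !tnth_mktuple; ring.
  by rewrite sqn_axpy0; field; rewrite gt_eqF.
rewrite ge0_integralZl//; last 3 first.
- exact: measurable_lam.
- by move=> x _; exact: lam_ge0.
- by rewrite lee_fin exprn_ge0// invr_ge0 ltW.
congr (_ * _); rewrite /lam.
rewrite (@fubini_tonelli _ _ _ _ _ sigma (gauss n)
  (fun p => K p.1 p.2 * (expR (sqn p.2 / 2))%:E))//; last 2 first.
- apply: emeasurable_funM => //.
  exact: (measurableT_comp (@measurable_weight R n) measurable_snd).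
- by move=> p; rewrite mule_ge0// lee_fin expR_ge0.
apply: eq_integral => y _ /=.
rewrite ge0_integralZr//; last exact: (measurable_comp2 mK).
congr (_ * _); rewrite /K ge0_integralZl//.
- apply/measurable_EFinP.
  exact: (measurableT_comp (measurable_noise_kernel_sphere e) (pair2_measurable y)).
- by move=> x _; rewrite lee_fin expR_ge0.
Qed.

Lemma noise_density_fin_num e y : noise_density e y \is a fin_num.
Proof.
rewrite ge0_fin_numE ?noise_density_ge0//.
apply: (@le_lt_trans _ _ (\int[sigma]_x (cst 1 x))); last first.
  by rewrite integral_cst//= probability_setT mule1 ltry.
apply: ge0_le_integral => //.
- by move=> x _; rewrite lee_fin expR_ge0.
- apply/measurable_EFinP.
  exact: (measurableT_comp (measurable_noise_kernel_sphere e) (pair2_measurable y)).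
- move=> x _; rewrite lee_fin -[leRHS]expR0 ler_expR oppr_le0.
  by rewrite mulr_ge0 ?sqn_ge0// invr_ge0 mulr_ge0// sqr_ge0.
Qed.

(** A radial function is read off along the ray through the unit vector [u]; this makes [Psi]
    measurable by composition. *)
Lemma noise_radial_density (e : R) : (0 < n)%N -> exists Psi : R -> R,
  [/\ measurable_fun setT Psi, forall t, (0 <= Psi t)%R &
      forall y, noise_density e y = (Psi (sqn y))%:E].
Proof.
move=> n0.
pose u : n.-tuple R := [tuple (Num.sqrt n%:R)^-1 | i < n]%R.
have u1 : sqn u = 1%R.
  rewrite /sqn; under eq_bigr do rewrite tnth_mktuple exprVn sqr_sqrtr//.
  by rewrite sumr_const card_ord -[LHS]mulr_natr mulVf// pnatr_eq0 -lt0n.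
pose pt (t : R) := axpy (tzero R n) (Num.sqrt t) u.
have mpt : measurable_fun setT pt.
  apply/measurable_fun_tnthP => i.
  rewrite (_ : _ \o _ = fun t => Num.sqrt t * tnth u i)%R; last first.
    by apply/funext => t /=; rewrite !tnth_mktuple add0r.
  by apply: measurable_funM => //; exact: measurable_sqrt.
exists (fun t => fine (noise_density e (pt t))); split.
- apply: measurableT_comp => //.
  exact: (measurableT_comp (measurable_noise_density e) mpt).
- by move=> t; apply: fine_ge0; exact: noise_density_ge0.
move=> y; rewrite (fineK (noise_density_fin_num e (pt (sqn y)))).
apply: noise_density_radial.
by rewrite sqn_axpy0 u1 mulr1 sqr_sqrtr// sqn_ge0.
Qed.

End sphere_average.

Section bounded_convergence.
Local Open Scope ereal_scope.
Context d (T : measurableType d) (R : realType) (P : probability T R).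

Lemma bounded_cvg_integral (f_ : nat -> T -> R) (f : T -> R) (C : R) :
  (forall j, measurable_fun setT (f_ j)) -> (forall j x, `|f_ j x| <= C)%R ->
  (forall x, f_ ^~ x @ \oo --> f x) ->
  \int[P]_x (f_ j x)%:E @[j --> \oo] --> \int[P]_x (f x)%:E.
Proof.
move=> mf fC ff.
apply: (@dominated_cvg _ _ _ P setT measurableT (fun j x => (f_ j x)%:E)
  (fun x => (f x)%:E) (cst C%:E)) => //.
- by move=> j; apply/measurable_EFinP.
- by move=> x _; apply: cvg_EFin; [exact: nearW|exact: ff].
- exact: finite_measure_integrable_cst.
- by move=> j x _; rewrite lee_fin.
Qed.

End bounded_convergence.

Section profile_mass_continuity.
Local Open Scope ereal_scope.
Context (R : realType) (k m : nat).
Hypothesis m2 : (2 < m)%N.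
Variable F : k.-tuple R -> R.
Hypotheses (mF : measurable_fun setT F) (F0 : forall z, (0 <= F z)%R)
  (F1 : forall z, (F z <= 1)%R).

Lemma cvg_profile_mass (t_ : nat -> R) (t C : R) : (0 <= C)%R ->
  (forall j, t_ j <= C)%R -> t_ @ \oo --> t ->
  profile_mass m (EFin \o F) (t_ j) @[j --> \oo] --> profile_mass m (EFin \o F) t.
Proof.
move=> C0 tC tt.
apply: (@bounded_cvg_integral _ _ _ (std_gaussian R k)
  (fun j z => F z * profile m (t_ j) z * expR (sqn z / 2))%R
  (fun z => F z * profile m t z * expR (sqn z / 2))%R
  (Num.sqrt C ^+ (m - 2) * expR (C / 2))%R).
- move=> j; apply: measurable_funM; last by apply/measurable_EFinP; exact: measurable_weight.
  by apply: measurable_funM => //; exact: measurable_profile1.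
- move=> j z; rewrite ger0_norm; last by rewrite !mulr_ge0 ?expR_ge0 ?profile_ge0.
  apply: (le_trans _ (profile_le m2 z C0)); rewrite ler_wpM2r ?expR_ge0//.
  rewrite (@le_trans _ _ (profile m (t_ j) z))//.
    by rewrite ler_piMl ?profile_ge0.
  by rewrite /profile lerXn2r ?nnegrE// ler_wsqrtr// lerD2r.
- move=> z; apply: cvgM; last exact: cvg_cst.
  apply: cvgM; first exact: cvg_cst.
  rewrite /profile; apply: (cvg_comp _ (fun x => x ^+ (m - 2))%R); last exact: exprn_continuous.
  apply: (cvg_comp _ (@Num.sqrt R)); last exact: sqrt_continuous.
  by apply: cvgB => //; exact: cvg_cst.
Qed.

End profile_mass_continuity.

(** * Means over slices *)

Section profile_mean.
Local Open Scope ereal_scope.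
Context (R : realType) (k m : nat).
Hypothesis m2 : (2 < m)%N.
Local Notation mass := (profile_mass m).
Local Notation one := (cst 1 : k.-tuple R -> \bar R).
Variable F : k.-tuple R -> R.
Hypotheses (mF : measurable_fun setT F) (F0 : forall z, (0 <= F z)%R)
  (F1 : forall z, (F z <= 1)%R).

Lemma profile_mass_le t : mass (EFin \o F) t <= mass one t.
Proof.
apply: ge0_le_integral => //.
- by move=> z _; rewrite !mule_ge0 ?lee_fin ?profile_ge0 ?expR_ge0//.
- apply: emeasurable_funM; last exact: measurable_weight.
  by apply: emeasurable_funM; apply/measurable_EFinP => //; exact: measurable_profile1.
- apply: emeasurable_funM; last exact: measurable_weight.
  by apply: emeasurable_funM => //; apply/measurable_EFinP; exact: measurable_profile1.
- move=> z _; apply: lee_wpmul2r; first by rewrite lee_fin expR_ge0.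
  by apply: lee_wpmul2r; rewrite lee_fin ?profile_ge0 ?F1.
Qed.

Lemma profile_mass1_fin_num t : mass one t \is a fin_num.
Proof.
rewrite ge0_fin_numE ?profile_mass_ge0//; have [t0|t0] := leP t 0%R.
  by rewrite profile_mass_neg.
by rewrite profile_mass_lty// ltW.
Qed.

Lemma profile_mass_fin_num t : mass (EFin \o F) t \is a fin_num.
Proof.
rewrite ge0_fin_numE; last by apply: profile_mass_ge0 => z; rewrite lee_fin F0.
apply: (le_lt_trans (profile_mass_le t)).
by rewrite -ge0_fin_numE ?profile_mass1_fin_num ?profile_mass_ge0.
Qed.

(** The power [-1] is the inverse of a nonnegative real, with [0 `^ (-1) = 0]. *)
Definition profile_mean (t : R) : R :=
  (fine (mass (EFin \o F) t) * (fine (mass one t)) `^ (-1))%R.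

(** Where the mass of the slice vanishes, [F <= 1] makes the numerator vanish too, so the default
    value of the quotient does no harm. *)
Lemma profile_meanE t :
  (profile_mean t)%:E * mass one t = mass (EFin \o F) t.
Proof.
rewrite -[mass one t]fineK ?profile_mass1_fin_num//.
rewrite -[RHS]fineK ?profile_mass_fin_num// -EFinM /profile_mean.
rewrite powR_inv1 ?fine_ge0 ?profile_mass_ge0//.
have [J0|J0] := eqVneq (fine (mass one t)) 0%R; last first.
  by rewrite divfK.
rewrite J0 mulr0; congr EFin; apply/esym/le_anti.
rewrite fine_ge0 ?andbT; last by apply: profile_mass_ge0 => z; rewrite lee_fin F0.
by rewrite -{1}J0 fine_le ?profile_mass1_fin_num ?profile_mass_fin_num ?profile_mass_le.
Qed.

Lemma profile_mean_ge0 t : (0 <= profile_mean t)%R.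
Proof.
rewrite mulr_ge0 ?powR_ge0 ?fine_ge0//.
by apply: profile_mass_ge0 => z; rewrite lee_fin F0.
Qed.

Lemma profile_mean_le1 t : (profile_mean t <= 1)%R.
Proof.
rewrite /profile_mean powR_inv1 ?fine_ge0 ?profile_mass_ge0//.
have : 0 <= mass one t by exact: profile_mass_ge0.
rewrite -[X in 0 <= X]fineK ?profile_mass1_fin_num// lee_fin le_eqVlt => /predU1P[<-|J0].
  by rewrite invr0 mulr0.
rewrite ler_pdivrMr// mul1r.
by rewrite fine_le ?profile_mass1_fin_num ?profile_mass_fin_num ?profile_mass_le.
Qed.

Lemma measurable_profile_mean : measurable_fun setT profile_mean.
Proof.
have mE := measurable_profile_mass m.
apply: measurable_funM.
  apply: measurableT_comp => //; apply: mE; first exact/measurable_EFinP.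
  by move=> z; rewrite lee_fin F0.
have mJ : measurable_fun setT (fun t => fine (mass one t)).
  by apply: measurableT_comp => //; exact: mE.
exact: (measurableT_comp (@measurable_powR R (-1)%R) mJ).
Qed.

Lemma cvg_profile_mean (t_ : nat -> R) (t C : R) : (0 < t)%R -> (0 <= C)%R ->
  (forall j, t_ j <= C)%R -> t_ @ \oo --> t ->
  profile_mean (t_ j) @[j --> \oo] --> profile_mean t.
Proof.
move=> t0 C0 tC tt; apply: cvgM.
  apply: fine_cvg; rewrite fineK ?profile_mass_fin_num//.
  exact: cvg_profile_mass C0 tC tt.
rewrite powR_inv1 ?fine_ge0 ?profile_mass_ge0//.
under eq_fun do rewrite powR_inv1 ?fine_ge0 ?profile_mass_ge0//.
apply: cvgV.
  rewrite gt_eqF// fine_gt0// profile_mass_gt0//=.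
  by rewrite -ge0_fin_numE ?profile_mass_ge0// profile_mass1_fin_num.
apply: fine_cvg; rewrite fineK ?profile_mass1_fin_num//.
exact: (@cvg_profile_mass _ _ _ m2 (cst 1%R)) C0 tC tt.
Qed.

End profile_mean.

(** * Removing the noise *)

Section sphere_law.
Local Open Scope ereal_scope.
Context (R : realType) (k m : nat) (sigma : probability (sphere R (k + m)) R).
Hypotheses (m2 : (2 < m)%N) (sigma_rot : rotation_invariant sigma).
Local Notation n := (k + m)%N.
Local Notation gauss := (std_gaussian R).
Local Notation one := (cst 1 : k.-tuple R -> \bar R).

Section mean.
Variable F : k.-tuple R -> R.
Hypotheses (mF : measurable_fun setT F) (F0 : forall z, (0 <= F z)%R)
  (F1 : forall z, (F z <= 1)%R).

(** The perturbed point has a radial density, equal to a constant [Psi t] on each slice of squared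
    norm [t]; replacing [F] by its slice mean therefore preserves the integral. *)
Lemma sphere_noise_mean (e : R) : (0 < e)%R ->
  \int[sigma]_x \int[gauss n]_v (F (first_coords k (axpy (sval x) e v)))%:E =
  \int[sigma]_x \int[gauss n]_v (profile_mean m F (sqn (axpy (sval x) e v)))%:E.
Proof.
move=> e0.
have mr := measurable_profile_mean m mF F0.
have r0 := profile_mean_ge0 m F0.
rewrite (@integral_sphere_noise _ _ _ e (fun y => (F (first_coords k y))%:E))//; last 2 first.
- by apply/measurable_EFinP; exact: (measurableT_comp mF (@measurable_first_coords R n k)).
- by move=> x; rewrite lee_fin.
rewrite (@integral_sphere_noise _ _ _ e (fun y => (profile_mean m F (sqn y))%:E))//; last 2 first.
- by apply/measurable_EFinP; exact: (measurableT_comp mr (@measurable_sqn R n)).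
- by move=> x; rewrite lee_fin.
congr (_ * _).
have n0 : (0 < n)%N by rewrite addn_gt0 (ltn_trans _ m2) ?orbT.
have [Psi [mPsi Psi0 PsiE]] := noise_radial_density sigma_rot e n0.
have [c c0 cE] := @lam_radial_split R k m m2.
rewrite (@eq_lam _ _ _ (fun y => (F (first_coords k y))%:E * (Psi (sqn y))%:E)); last first.
  by move=> y; rewrite PsiE.
rewrite (cE (fun z t => (F z)%:E * (Psi t)%:E)); last 2 first.
- apply: emeasurable_funM; apply/measurable_EFinP.
    exact: (measurableT_comp mF).
  exact: (measurableT_comp mPsi).
- by move=> z s; rewrite mule_ge0// lee_fin.
rewrite (@eq_lam _ _ _ (fun y => (profile_mean m F (sqn y))%:E * (Psi (sqn y))%:E)); last first.
  by move=> y; rewrite PsiE.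
rewrite (cE (fun _ t => (profile_mean m F t)%:E * (Psi t)%:E)); last 2 first.
- apply: emeasurable_funM; apply/measurable_EFinP.
    exact: (measurableT_comp mr).
  exact: (measurableT_comp mPsi).
- by move=> z s; rewrite mule_ge0// lee_fin.
congr (_ * _); apply: eq_integral => t _.
have mp : measurable_fun setT (fun z : k.-tuple R => (profile m t z)%:E).
  by apply/measurable_EFinP; exact: measurable_profile1.
transitivity ((Psi t)%:E * profile_mass m (EFin \o F) t).
  rewrite /profile_mass -lamZ//.
  - by apply: eq_lam => z; rewrite /= [in LHS](muleC (F z)%:E) muleA.
  - by apply: emeasurable_funM => //; apply/measurable_EFinP.
  - by move=> z; rewrite mule_ge0// lee_fin ?profile_ge0.
rewrite -(profile_meanE m2 mF F0 F1) muleA /profile_mass -EFinM -lamZ//.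
- by apply: eq_lam => z; rewrite /= mul1e -!EFinM (mulrC (Psi t)).
- by rewrite mulr_ge0.
- by apply: emeasurable_funM.
- by move=> z; rewrite mul1e lee_fin profile_ge0.
Qed.

(** In the limit the argument of [F] moves only by noise of size $1/(j+1)$ in a fixed direction. *)
Hypothesis cF : forall z w, F (axpy z j.+1%:R^-1%R w) @[j --> \oo] --> F z.

Lemma first_coords_axpy (x v : n.-tuple R) e :
  first_coords k (axpy x e v) = axpy (first_coords k x) e (first_coords k v).
Proof.
apply/eq_from_tnth => i; rewrite !tnth_mktuple.
have ni : (i < n)%N by rewrite ltn_addr.
by rewrite -[i : nat]/(Ordinal ni : nat) -!tnth_nth tnth_mktuple.
Qed.

(** Let the noise fade in [sphere_noise_mean]: bounded convergence on the product of the sphere and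
    the Gaussian space recovers [F] on the left, while on the right the squared norm tends to [n],
    where the slice mean is continuous because [0 < n]. *)
Lemma sphere_mean : \int[sigma]_x (F (first_coords k (sval x)))%:E =
  (profile_mean m F n%:R)%:E.
Proof.
have n0 : (0 < n)%N by rewrite addn_gt0 (ltn_trans _ m2) ?orbT.
have mr := measurable_profile_mean m mF F0.
have r0 := profile_mean_ge0 m F0.
have r1 := profile_mean_le1 m2 mF F0 F1.
pose P : probability (sphere R n * n.-tuple R)%type R := (sigma \x gauss n)%E.
pose Y (j : nat) (p : sphere R n * n.-tuple R) := axpy (sval p.1) j.+1%:R^-1%R p.2.
have mY j : measurable_fun setT (Y j).
  by apply: measurable_axpy => //; exact: (measurableT_comp (@measurable_sval_sphere R n)).
have mFY j : measurable_fun setT (fun p => F (first_coords k (Y j p))).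
  exact: (measurableT_comp mF (measurableT_comp (@measurable_first_coords R n k) (mY j))).
have mrY j : measurable_fun setT (fun p => profile_mean m F (sqn (Y j p))).
  exact: (measurableT_comp mr (measurableT_comp (@measurable_sqn R n) (mY j))).
have A : \int[P]_p (F (first_coords k (Y j p)))%:E @[j --> \oo] -->
    \int[P]_p (F (first_coords k (sval p.1)))%:E.
  apply: (@bounded_cvg_integral _ _ _ P _ _ 1%R) => //.
  - by move=> j x; rewrite ger0_norm.
  - move=> p; under eq_fun do rewrite first_coords_axpy; exact: cF.
have B : \int[P]_p (profile_mean m F (sqn (Y j p)))%:E @[j --> \oo] -->
    \int[P]_p (profile_mean m F n%:R)%:E.
  apply: (@bounded_cvg_integral _ _ _ P _ _ 1%R) => //.
  - by move=> j x; rewrite ger0_norm.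
  (* [C] bounds $|x+ev|^2 = n + 2e\langle x,v\rangle + e^2|v|^2$ for all $0 < e \le 1$. *)
  move=> p; apply: (cvg_profile_mean m2 mF F0 F1
    (C := (n%:R + 2 * `|dot (sval p.1) p.2| + sqn p.2)%R)).
  - by rewrite ltr0n.
  - by rewrite !addr_ge0 ?sqn_ge0// mulr_ge0.
  - move=> j; rewrite sqn_axpy sqn_sphere.
    have j1 : (j.+1%:R^-1 <= 1 :> R)%R by rewrite invf_le1// ler1n.
    apply: lerD; first apply: lerD => //.
      rewrite -mulrA ler_pM2l// (le_trans (ler_norm _))// normrM ler_piMl//.
      by rewrite ger0_norm.
    by rewrite ler_piMl ?sqn_ge0// exprn_ile1.
  - rewrite (_ : (fun j => sqn (Y j p)) = (fun j => n%:R + 2 * dot (sval p.1) p.2 * harmonic j +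
        sqn p.2 * (harmonic j * harmonic j)))%R; last first.
      apply/funext => j; rewrite sqn_axpy sqn_sphere /harmonic/=; ring.
    have h0 : (@harmonic R) @ \oo --> (0 : R)%R by exact: cvg_harmonic.
    suff : (fun j => n%:R + 2 * dot (sval p.1) p.2 * harmonic j +
        sqn p.2 * (harmonic j * harmonic j))%R @ \oo -->
        (n%:R + 2 * dot (sval p.1) p.2 * 0 + sqn p.2 * (0 * 0))%R.
      by rewrite !mulr0 !addr0.
    apply: cvgD; first by apply: cvgD; [exact: cvg_cst|apply: cvgM => //; exact: cvg_cst].
    by apply: cvgM; [exact: cvg_cst|exact: cvgM].
have AB : (fun j => \int[P]_p (F (first_coords k (Y j p)))%:E) =
    (fun j => \int[P]_p (profile_mean m F (sqn (Y j p)))%:E).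
  apply/funext => j; rewrite !fubini_tonelli1//; last 4 first.
  - by apply/measurable_EFinP; exact: mrY.
  - by move=> p; rewrite lee_fin.
  - by apply/measurable_EFinP; exact: mFY.
  - by move=> p; rewrite lee_fin.
  by apply: sphere_noise_mean.
transitivity (\int[P]_p (F (first_coords k (sval p.1)))%:E).
  rewrite fubini_tonelli1//.
  - apply: eq_integral => x _.
    by rewrite /fubini_F/= integral_cst//= probability_setT mule1.
  - apply/measurable_EFinP; apply: (measurableT_comp mF).
    apply: (measurableT_comp (@measurable_first_coords R n k)).
    exact: (measurableT_comp (@measurable_sval_sphere R n)).
  - by move=> p; rewrite lee_fin.
transitivity (\int[P]_p (profile_mean m F n%:R)%:E).
  by rewrite -(cvg_lim _ A)// AB (cvg_lim _ B).
by rewrite integral_cst//= probability_setT mule1.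
Qed.

End mean.

End sphere_law.

(** * Orthants as a determining class, and their continuous approximation *)

Section boxes.
Context (R : realType) (k : nat).

Definition box (b : 'I_k -> R) : set (k.-tuple R) := [set z | forall i, tnth z i < b i].

(** A continuous approximation of the indicator of [0 < s]. It vanishes at [s = 0], so [box_ramp]
    converges to the indicator of the open box at every point, boundary included. *)
Definition ramp (j : nat) (s : R) : R := Num.min 1 (Num.max 0 (j%:R * s)).

Definition box_ramp (b : 'I_k -> R) (j : nat) (z : k.-tuple R) : R :=
  \prod_(i < k) ramp j (b i - tnth z i).

Lemma ramp_ge0 j s : 0 <= ramp j s.
Proof. by rewrite /ramp le_min ler01 le_max lexx. Qed.

Lemma ramp_le1 j s : ramp j s <= 1.
Proof. by rewrite /ramp ge_min lexx. Qed.

Lemma continuous_ramp j : continuous (ramp j).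
Proof.
rewrite (_ : ramp j = cst 1 \min (cst 0 \max (fun x => j%:R * x)))//.
move=> s; apply: continuous_min; first exact: cvg_cst.
by apply: continuous_max; [exact: cvg_cst|exact: mulrl_continuous].
Qed.

Lemma cvg_ramp s : ramp j s @[j --> \oo] --> ((0 < s)%R%:R : R).
Proof.
have [s0|s0] := ltP 0 s; last first.
  rewrite (_ : (fun j => ramp j s) = cst 0); first exact: cvg_cst.
  apply/funext => j; rewrite /ramp max_l ?min_r//.
  by rewrite mulr_ge0_le0.
apply: cvg_near_cst; near=> j; rewrite /ramp min_l//.
rewrite le_max; apply/orP; right; rewrite -ler_pdivrMr// div1r.
by near: j; exact: nbhs_infty_ger.
Unshelve. all: by end_near. Qed.

Lemma cvg_prod_ord (u : nat -> 'I_k -> R) (l : 'I_k -> R) :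
  (forall i, u ^~ i @ \oo --> l i) ->
  \prod_(i < k) u j i @[j --> \oo] --> \prod_(i < k) l i.
Proof.
move=> ul; by apply: (@cvg_big R 'I_k _ 1 xpredT (@mul_continuous R) nat \oo
  (index_enum 'I_k) (fun i j => u j i) l) => // i _; exact: ul.
Qed.

Lemma box_ramp_ge0 b j z : 0 <= box_ramp b j z.
Proof. by apply: prodr_ge0 => i _; exact: ramp_ge0. Qed.

Lemma box_ramp_le1 b j z : box_ramp b j z <= 1.
Proof. by apply: prodr_ile1 => i _; rewrite ramp_ge0 ramp_le1. Qed.

Lemma measurable_box_ramp b j : measurable_fun setT (box_ramp b j).
Proof.
apply: measurable_prod => i _.
apply: (measurableT_comp (continuous_measurable_fun (@continuous_ramp j))).
by apply: measurable_funB => //; exact: measurable_tnth.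
Qed.

Lemma cvg_box_ramp b z : box_ramp b j z @[j --> \oo] --> (\1_(box b) z : R).
Proof.
rewrite (_ : \1_(box b) z = \prod_(i < k) (0 < b i - tnth z i)%R%:R :> R).
  by apply: cvg_prod_ord => i; exact: cvg_ramp.
rewrite indicE; have [zb|/existsNP[i zi]] := pselect (box b z).
  by rewrite mem_set// big1// => i _; rewrite subr_gt0 zb.
rewrite memNset; last by move=> /(_ i).
by rewrite (bigD1 i)//= subr_gt0; move/negP/negbTE: zi => ->; rewrite mul0r.
Qed.

Lemma box_ramp_axpy b j z w :
  box_ramp b j (axpy z l.+1%:R^-1 w) @[l --> \oo] --> box_ramp b j z.
Proof.
apply: cvg_prod_ord => i.
apply: (cvg_comp (fun l : nat => b i - tnth (axpy z l.+1%:R^-1 w) i) (ramp j)); last first.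
  exact: continuous_ramp.
suff : (fun l => b i - (tnth z i + harmonic l * tnth w i)) @ \oo -->
    b i - (tnth z i + 0 * tnth w i).
  rewrite mul0r addr0; under eq_fun do rewrite -[harmonic _]/(_%:R^-1)
    -[X in _ - X](tnth_mktuple (fun i => tnth z i + _ * tnth w i)).
  by [].
apply: cvgB; first exact: cvg_cst.
apply: cvgD; first exact: cvg_cst.
by apply: cvgM; [exact: cvg_harmonic|exact: cvg_cst].
Qed.

Lemma measurable_box b : measurable (box b).
Proof.
rewrite (_ : box b = \bigcap_(i in [set: 'I_k]) (@tnth k R ^~ i @^-1` `]-oo, b i[)).
  apply: fin_bigcap_measurable => // i _.
  by rewrite -[X in measurable X]setTI; exact: measurable_tnth.
apply/seteqP; split => z zb i /=; first by move=> _; rewrite in_itv/=; exact: zb.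
by have := zb i I; rewrite /= in_itv.
Qed.

(** Boxes are stable under intersection, and they generate the Borel sets because a ray in one
    coordinate is a union of boxes whose other sides run through the integers. *)
Lemma measure_unique_boxes (m1 m2 : {measure set (k.-tuple R) -> \bar R}) :
  (forall b, m1 (box b) < +oo)%E -> (forall b, m1 (box b) = m2 (box b)) ->
  forall A, measurable A -> m1 A = m2 A.
Proof.
move=> m1oo m12 A mA.
pose G := [set B | exists b, B = box b].
have cover : \bigcup_n (box (fun=> n%:R)) = setT.
  apply/seteqP; split => // z _.
  exists (\max_(i < k) (Num.truncn `|tnth z i|).+1)%N => // i.
  rewrite (le_lt_trans (ler_norm _))// (lt_le_trans (truncnS_gt _))//.
  by rewrite ler_nat (leq_bigmax i).
apply: (@measure_unique _ R _ G (fun n => box (fun=> n%:R))) => //.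
- apply/seteqP; split; last first.
    apply: smallest_sub; first exact: sigma_algebra_measurable.
    by move=> _ [b ->]; exact: measurable_box.
  have mid : measurable_fun setT (idfun : g_sigma_algebraType G -> k.-tuple R).
    apply/measurable_fun_tnthP => i.
    apply: (measurability _ (@RGenInftyO.measurableE R)) => _ [_ [b ->] <-].
    rewrite setTI (_ : _ @^-1` _ = \bigcup_n box (fun j => if j == i then b else n%:R)).
      apply: bigcupT_measurable => n; apply: sub_sigma_algebra.
      by exists (fun j => if j == i then b else n%:R).
    apply/seteqP; split => z /=.
      rewrite in_itv/= => zb; have : [set: k.-tuple R] z by []; rewrite -cover => -[n _ zn].
      by exists n => // j; case: eqP => [->//|_]; exact: zn.
    by move=> [n _ /(_ i)]; rewrite eqxx in_itv.
  by move=> B mB; have := mid measurableT B mB; rewrite setTI.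
- move=> _ _ [b ->] [c ->]; exists (fun i => Num.min (b i) (c i)).
  apply/seteqP; split => z /=.
    by move=> [zb zc] i; rewrite lt_min zb zc.
  by move=> zbc; split => i; have := zbc i; rewrite lt_min => /andP[].
- by move=> n; exists (fun=> n%:R).
- by move=> _ [b ->].
Qed.

End boxes.

(** * The law of the first [k] coordinates *)

Section sphere_density.
Local Open Scope ereal_scope.
Context (R : realType) (k m : nat) (sigma : probability (sphere R (k + m)) R).
Hypotheses (m2 : (2 < m)%N) (sigma_rot : rotation_invariant sigma).
Local Notation n := (k + m)%N.
Local Notation gauss := (std_gaussian R).
Local Notation one := (cst 1 : k.-tuple R -> \bar R).

(** The exponential converts the slice profile at [t = n] from a Lebesgue density into a Gaussian
    one. *)
Definition sphere_density (z : k.-tuple R) : R :=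
  (profile m n%:R z * expR (sqn z / 2) / fine (profile_mass m one n%:R))%R.

Let n0 : (0 < n%:R :> R)%R.
Proof. by rewrite ltr0n addn_gt0 (ltn_trans _ m2) ?orbT. Qed.

Let J0 : (0 < fine (profile_mass m one n%:R))%R.
Proof.
rewrite fine_gt0// profile_mass_gt0//=.
by rewrite -ge0_fin_numE ?profile_mass_ge0// profile_mass1_fin_num.
Qed.

Lemma sphere_density_ge0 z : (0 <= sphere_density z)%R.
Proof. by rewrite divr_ge0 ?mulr_ge0 ?profile_ge0 ?expR_ge0// ltW. Qed.

Lemma measurable_sphere_density : measurable_fun setT sphere_density.
Proof.
apply: measurable_funM => //; apply: measurable_funM; first exact: measurable_profile1.
by apply/measurable_EFinP; exact: measurable_weight.
Qed.

Lemma profile_mean_density (F : k.-tuple R -> R) : measurable_fun setT F ->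
  (forall z, (0 <= F z)%R) -> (forall z, (F z <= 1)%R) ->
  (profile_mean m F n%:R)%:E = \int[gauss k]_z (F z * sphere_density z)%:E.
Proof.
move=> mF F0 F1; rewrite /profile_mean powR_inv1 ?ltW//.
rewrite EFinM fineK ?profile_mass_fin_num// /profile_mass /lam -ge0_integralZr//.
- by apply: eq_integral => z _; rewrite -!EFinM /sphere_density !mulrA.
- apply: emeasurable_funM; last exact: measurable_weight.
  by apply: emeasurable_funM; apply/measurable_EFinP => //; exact: measurable_profile1.
- by move=> z _; rewrite !mule_ge0// lee_fin ?profile_ge0 ?expR_ge0.
- by rewrite lee_fin invr_ge0 ltW.
Qed.

Lemma measurable_sphere_proj (n' : nat) :
  measurable_fun setT (fun x : sphere R n' => first_coords k (sval x)).
Proof.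
exact: (measurableT_comp (@measurable_first_coords R n' k) (@measurable_sval_sphere R n')).
Qed.

(** Indicators lack the continuity that [sphere_mean] asks for. The ramps have it, and bounded
    convergence passes to the box on both sides. *)
Lemma sphere_law_box b : sigma [set x | box b (first_coords k (sval x))] =
  \int[gauss k]_(z in box b) (sphere_density z)%:E.
Proof.
have A : \int[sigma]_x (box_ramp b j (first_coords k (sval x)))%:E @[j --> \oo] -->
    \int[sigma]_x (\1_(box b) (first_coords k (sval x)))%:E.
  apply: (@bounded_cvg_integral _ _ _ sigma _ _ 1%R) => //.
  - move=> j; exact: (measurableT_comp (@measurable_box_ramp R k b j) (@measurable_sphere_proj n)).
  - by move=> j x; rewrite ger0_norm ?box_ramp_ge0 ?box_ramp_le1.
  - by move=> x; exact: cvg_box_ramp.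
have B : \int[gauss k]_z (box_ramp b j z * sphere_density z)%:E @[j --> \oo] -->
    \int[gauss k]_z (\1_(box b) z * sphere_density z)%:E.
  apply: (@bounded_cvg_integral _ _ _ (gauss k) _ _
      (Num.sqrt n%:R ^+ (m - 2) * expR (n%:R / 2) / fine (profile_mass m one n%:R))%R) => //.
  - move=> j; apply: measurable_funM; first exact: measurable_box_ramp.
    exact: measurable_sphere_density.
  - move=> j z; rewrite ger0_norm; last by rewrite mulr_ge0 ?box_ramp_ge0 ?sphere_density_ge0.
    rewrite (@le_trans _ _ (sphere_density z))//.
      by rewrite ler_piMl ?sphere_density_ge0 ?box_ramp_le1.
    by rewrite ler_wpM2r ?invr_ge0 ?(ltW J0)// profile_le// ltW.
  - by move=> z; apply: cvgM; [exact: cvg_box_ramp|exact: cvg_cst].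
have AB : (fun j => \int[sigma]_x (box_ramp b j (first_coords k (sval x)))%:E) =
    (fun j => \int[gauss k]_z (box_ramp b j z * sphere_density z)%:E).
  apply/funext => j; rewrite (@sphere_mean _ _ _ sigma m2 sigma_rot (box_ramp b j)).
  - by rewrite profile_mean_density//; [exact: measurable_box_ramp|
      exact: box_ramp_ge0|exact: box_ramp_le1].
  - exact: measurable_box_ramp.
  - exact: box_ramp_ge0.
  - exact: box_ramp_le1.
  - exact: box_ramp_axpy.
transitivity (\int[sigma]_x (\1_(box b) (first_coords k (sval x)))%:E).
  rewrite (_ : (fun x => _) = EFin \o \1_[set x | box b (first_coords k (sval x))]); last first.
    by apply/funext => x /=; rewrite !indicE; congr (_ %:R%:E); apply/idP/idP; rewrite !inE.
  rewrite integral_indic ?setIT// -[X in measurable X]setTI.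
  by apply: measurable_sphere_proj => //; exact: measurable_box.
rewrite -(cvg_lim _ A)// AB (cvg_lim _ B)// [RHS]integral_mkcond.
by apply: eq_integral => z _; rewrite epatch_indic/= EFinM muleC.
Qed.

Lemma sphere_law (A : set (k.-tuple R)) : measurable A ->
  sigma [set x | A (first_coords k (sval x))] =
  \int[gauss k]_(z in A) (sphere_density z)%:E.
Proof.
move=> mA.
have [nu nuE] := density_measure_exists (gauss k) measurable_sphere_density sphere_density_ge0.
rewrite -nuE.
rewrite -[LHS]/(pushforward_measure sigma (@measurable_sphere_proj n) A).
apply: measure_unique_boxes mA => b.
  rewrite /= /pushforward (le_lt_trans (probability_le1 _ _))// ?ltry//.
  rewrite -[X in measurable X]setTI.
  by apply: measurable_sphere_proj => //; exact: measurable_box.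
by rewrite nuE -sphere_law_box.
Qed.

Lemma ge0_integral_sphere (f : k.-tuple R -> \bar R) : measurable_fun setT f ->
  (forall z, 0 <= f z) ->
  \int[sigma]_x f (first_coords k (sval x)) =
  \int[gauss k]_z (f z * (sphere_density z)%:E).
Proof.
move=> mf f0.
rewrite -[LHS](ge0_integral_pushforward (@measurable_sphere_proj n) sigma measurableT mf)//.
transitivity (\int[pushforward_measure sigma (@measurable_sphere_proj n)]_z f z) => //.
apply: ge0_integral_density => //.
- exact: measurable_sphere_density.
- exact: sphere_density_ge0.
- exact: sphere_law.
Qed.

End sphere_density.

(** * Limits of integrals over spheres *)

Section gaussian_moment.
Local Open Scope ereal_scope.
Context (R : realType).

(** What remains against Lebesgue measure is $e^{-x^2/4}$, which the substitution $x \mapsto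
    \sqrt2\,x$ turns into the Gaussian density up to a constant. *)
Lemma gaussian_moment1_lty :
  \int[@normal_prob R 0 1]_x (expR (x ^+ 2 / 4))%:E < +oo.
Proof.
have mx (c : R) : measurable_fun setT (fun x : R => (expR (c * x ^+ 2))%:E).
  apply/measurable_EFinP; apply: measurableT_comp => //.
  by apply: measurable_funM => //; exact: measurable_funX.
have e0 (c : R) x : 0 <= (expR (c * x ^+ 2))%:E by rewrite lee_fin expR_ge0.
under eq_integral do rewrite mulrC.
rewrite ge0_integral_normal//.
have pk : (0 < normal_peak 1 :> R)%R by rewrite normal_peak_gt0// oner_neq0.
pose F (x : R) : \bar R := (expR (- 4^-1 * x ^+ 2))%:E.
have s2 : (0 < Num.sqrt 2 :> R)%R by rewrite sqrtr_gt0.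
rewrite (_ : (fun x => _) = (fun x => (normal_peak 1)%:E * F x)); last first.
  apply/funext => x; rewrite normal_pdf01E -!EFinM mulrCA -expRD.
  by congr (_ * expR _)%:E; field.
rewrite ge0_integralZl//; [|exact: mx|by move=> x _; exact: e0|by rewrite lee_fin ltW].
have : \int[lebesgue_measure]_x F (0 + Num.sqrt 2 * x)%R =
    (Num.sqrt 2)^-1%:E * \int[lebesgue_measure]_x F x.
  exact: (ge0_integral_affine 0 s2 (mx _) (e0 _)).
move=> /(congr1 (fun x => (Num.sqrt 2)%:E * x)).
rewrite muleA -EFinM divff ?gt_eqF// mul1e => <-.
rewrite muleCA -ge0_integralZl//; [|exact: measurableT_comp (mx _) (measurable_affine _ _)|
  by move=> x _; exact: e0|by rewrite lee_fin ltW].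
rewrite (_ : (fun x => _) = (fun x => (normal_pdf 0 1 x)%:E)).
  by rewrite integral_normal_pdf mule1 ltry.
apply/funext => x; rewrite normal_pdf01E -EFinM; congr (_ * expR _)%:E.
by rewrite add0r exprMn sqr_sqrtr//; field.
Qed.

Lemma gaussian_moment_lty k : \int[std_gaussian R k]_z (expR (sqn z / 4))%:E < +oo.
Proof.
have me j : measurable_fun setT (fun z : j.-tuple R => (expR (sqn z / 4))%:E).
  apply/measurable_EFinP; under eq_fun do rewrite mulrC; exact: measurable_expR_sqn.
elim: k => [|k IH]; first by rewrite std_gaussian0// ltry.
rewrite std_gaussianS//.
under eq_integral.
  move=> x _; under eq_integral do rewrite sqn_cons mulrDl expRD EFinM.
  rewrite ge0_integralZl//; last exact: me.
  over.
have m1 : measurable_fun setT (fun x : R => (expR (x ^+ 2 / 4))%:E).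
  apply/measurable_EFinP; apply: measurableT_comp => //; exact: measurable_funM.
rewrite ge0_integralZr//; last by apply: integral_ge0 => x _; rewrite lee_fin expR_ge0.
rewrite lte_mul_pinfty ?gaussian_moment1_lty//.
- by apply: integral_ge0 => x _; rewrite lee_fin expR_ge0.
- rewrite ge0_fin_numE ?gaussian_moment1_lty//.
  by apply: integral_ge0 => x _; rewrite lee_fin expR_ge0.
Qed.

End gaussian_moment.

(** * Bounds on the unnormalised density *)

Section cap_weight.
Context (R : realType) (k : nat).

(** Up to the constant [cap_mass n] below, the density with respect to the Gaussian measure of the
first [k] coordinates of a uniform point on the sphere of radius [Num.sqrt n]. *)
Definition cap_weight (n : nat) (z : k.-tuple R) : R :=
  Num.sqrt (1 - sqn z / n%:R) ^+ (n - k - 2) * expR (sqn z / 2).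

Lemma cap_weight_ge0 n z : 0 <= cap_weight n z.
Proof. by rewrite mulr_ge0 ?exprn_ge0 ?expR_ge0. Qed.

Lemma measurable_cap_weight n : measurable_fun setT (cap_weight n).
Proof.
apply: measurable_funM; last by apply/measurable_EFinP; exact: measurable_weight.
apply: (measurableT_comp (@measurable_sqrtX R (n - k - 2))).
by apply: measurable_funB => //; apply: measurable_funM => //; exact: measurable_sqn.
Qed.

Lemma sqrt_1B_le (s : R) : Num.sqrt (1 - s) <= expR (- s / 2).
Proof.
rewrite -[leRHS]ger0_norm ?expR_ge0// -sqrtr_sqr ler_wsqrtr// expr2 -expRD.
by rewrite -splitr; exact: expR_ge1Dx.
Qed.

(** Invert $1/(1-s) = 1 + s/(1-s) \le e^{s/(1-s)}$ and take square roots. *)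
Lemma sqrt_1B_ge (s : R) : s < 1 -> expR (- s / (1 - s) / 2) <= Num.sqrt (1 - s).
Proof.
move=> s1; have s0 : 0 < 1 - s by rewrite subr_gt0.
rewrite -[leLHS]ger0_norm ?expR_ge0// -sqrtr_sqr ler_wsqrtr// expr2 -expRD.
rewrite -splitr mulNr expRN.
rewrite -[leRHS]invrK lef_pV2 ?posrE ?expR_gt0 ?invr_gt0//.
apply: le_trans (expR_ge1Dx _).
by have -> : 1 + s / (1 - s) = (1 - s)^-1 by field; rewrite lt0r_neq0.
Qed.

(** By $1-u \le e^{-u}$ with $u = |z|^2/n$, the exponents $-(n-k-2)|z|^2/(2n)$ and $|z|^2/2$ add up
    to $(k+2)|z|^2/(2n)$, whose coefficient tends to 0. *)
Lemma cap_weight_le n z : (k + 2 < n)%N ->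
  cap_weight n z <= expR ((k + 2)%:R / (2 * n%:R) * sqn z).
Proof.
move=> kn; have n0 : n%:R != 0 :> R by rewrite pnatr_eq0 -lt0n (leq_ltn_trans _ kn).
apply: (@le_trans _ _ (expR (- (sqn z / n%:R) / 2) ^+ (n - k - 2) * expR (sqn z / 2))).
  by rewrite ler_wpM2r ?expR_ge0// lerXn2r ?nnegrE ?expR_ge0// sqrt_1B_le.
rewrite -expRM_natr -expRD ler_expR -subnDA natrB; last exact: ltnW.
by rewrite le_eqVlt; apply/orP; left; apply/eqP; field.
Qed.

(** With $s = |z|^2$, [sqrt_1B_ge] gives the exponent $s(k+2-s)/(2(n-s))$; dropping $k+2$ and using
    $n \le 2(n-s)$ leaves $-s^2/n$. *)
Lemma cap_weight_ge n z : (k + 2 < n)%N -> 2 * sqn z <= n%:R ->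
  expR (- (sqn z ^+ 2) / n%:R) <= cap_weight n z.
Proof.
move=> kn sn; have n0 : 0 < n%:R :> R by rewrite ltr0n (leq_ltn_trans _ kn).
have s0 := sqn_ge0 z.
set s := sqn z in sn s0 *.
have s1 : s / n%:R < 1 by rewrite ltr_pdivrMr// mul1r; lra.
have ns : 0 < n%:R - s by lra.
rewrite /cap_weight -/s.
apply: (@le_trans _ _ (expR (- (s / n%:R) / (1 - s / n%:R) / 2) ^+ (n - k - 2) * expR (s / 2))).
  rewrite -expRM_natr -expRD ler_expR -subnDA natrB; last exact: ltnW.
  have -> : - (s / n%:R) / (1 - s / n%:R) / 2 * (n%:R - (k + 2)%:R) + s / 2 =
      s * ((k + 2)%:R - s) / (2 * (n%:R - s)).
    field; rewrite !gt_eqF//=.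
  apply: (@le_trans _ _ (s * (- s) / (2 * (n%:R - s)))).
    rewrite mulrN -expr2 !mulNr lerN2 ler_wpM2l ?sqr_ge0// lef_pV2 ?posrE ?mulr_gt0//.
    lra.
  rewrite ler_wpM2r ?invr_ge0 ?mulr_ge0 ?(ltW ns)// ler_wpM2l//.
  by rewrite lerDr ler0n.
rewrite ler_wpM2r ?expR_ge0// lerXn2r ?nnegrE ?expR_ge0//; exact: sqrt_1B_ge.
Qed.

Lemma cvg_cap_weight z : cap_weight n z @[n --> \oo] --> (1 : R).
Proof.
have inv0 : (fun n : nat => n%:R^-1 : R) @ \oo --> 0.
  by rewrite -cvg_shiftS; exact: cvg_harmonic.
have cvg_expR (c : R) : (fun n : nat => expR (c * n%:R^-1)) @ \oo --> (1 : R).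
  suff : (fun n : nat => expR (c * n%:R^-1)) @ \oo --> expR (c * 0).
    by rewrite mulr0 expR0.
  apply: (cvg_comp (fun n : nat => c * n%:R^-1) expR); last exact: continuous_expR.
  by apply: cvgM => //; exact: cvg_cst.
apply: (@squeeze_cvgr _ _ _ _ (fun n => expR (- (sqn z ^+ 2) * n%:R^-1))
  (fun n => expR ((k + 2)%:R / 2 * sqn z * n%:R^-1))) => //.
near=> n.
have kn : (k + 2 < n)%N by near: n; exact: nbhs_infty_gt.
rewrite cap_weight_ge//=.
  rewrite (le_trans (cap_weight_le _ kn))// ler_expR.
  rewrite le_eqVlt; apply/orP; left; apply/eqP; field.
  by rewrite pnatr_eq0 -lt0n (leq_ltn_trans _ kn).
by near: n; exact: nbhs_infty_ger.
Unshelve. all: by end_near. Qed.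

End cap_weight.

(** * Dominated convergence for functions of the first [k] coordinates *)

Section sphere_limits.
Local Open Scope ereal_scope.
Context (R : realType) (k : nat) (sigma : forall n : nat, probability (sphere R n) R).
Hypothesis sigma_rot : forall n, rotation_invariant (sigma n).
Local Notation gauss := (std_gaussian R k).

Definition cap_mass (n : nat) : R := fine (\int[gauss]_z (cap_weight n z)%:E).

(** Since $\sqrt{n-|z|^2} = \sqrt n\,\sqrt{1-|z|^2/n}$, the same power of $\sqrt n$ comes out of the
    profile and of its mass. *)
Lemma sphere_density_cap m (z : k.-tuple R) : (2 < m)%N ->
  sphere_density m z = (cap_weight (k + m) z / cap_mass (k + m))%R.
Proof.
move=> m2; set n := (k + m)%N.
have n0 : (0 < n%:R :> R)%R by rewrite ltr0n addn_gt0 (ltn_trans _ m2) ?orbT.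
pose K : R := (Num.sqrt n%:R ^+ (m - 2))%R.
have K0 : (0 < K)%R by rewrite exprn_gt0// sqrtr_gt0.
have pE (y : k.-tuple R) : (profile m n%:R y * expR (sqn y / 2))%R = (K * cap_weight n y)%R :> R.
  rewrite /cap_weight mulrA /profile; congr (_ * _)%R.
  have -> : (n - k - 2 = m - 2)%N by rewrite addKn.
  rewrite -exprMn -sqrtrM ?ltW//; congr (Num.sqrt _ ^+ _)%R.
  by field; rewrite gt_eqF.
rewrite /sphere_density -/n pE.
have -> : fine (profile_mass m (cst 1 : k.-tuple R -> _) n%:R) = (K * cap_mass n)%R.
  rewrite /cap_mass /profile_mass /lam.
  rewrite (_ : (fun y => _) = (fun y => K%:E * (cap_weight n y)%:E)); last first.
    by apply/funext => y; rewrite mul1e -!EFinM pE.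
  rewrite ge0_integralZl//; last 3 first.
  - by apply/measurable_EFinP; exact: measurable_cap_weight.
  - by move=> y _; rewrite lee_fin cap_weight_ge0.
  - by rewrite lee_fin ltW.
  (* [fine] sends both infinities to 0, so the positive factor [K] comes out of [fine] in every
     case. *)
  case: (\int[_]_y _) => [r| |] //=; first by rewrite gt0_muley ?lte_fin//= mulr0.
  by rewrite gt0_muleNy ?lte_fin//= mulr0.
by rewrite -mulf_div divff ?mul1r// gt_eqF.
Qed.

Lemma ge0_integral_sphere_cap n (f : k.-tuple R -> \bar R) : (k + 2 < n)%N ->
  measurable_fun setT f -> (forall z, 0 <= f z) ->
  \int[sigma n]_x f (first_coords k (sval x)) =
  \int[gauss]_z (f z * (cap_weight n z / cap_mass n)%:E).
Proof.
move=> kn mf f0.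
have [m nE] : exists m, n = (k + m)%N.
  by exists (n - k)%N; rewrite subnKC// ltnW// (leq_ltn_trans _ kn)// leq_addr.
rewrite nE ltn_add2l in kn *.
transitivity (\int[gauss]_z (f z * (sphere_density m z)%:E)).
  exact: (ge0_integral_sphere kn (@sigma_rot _) mf f0).
by apply: eq_integral => z _; rewrite sphere_density_cap.
Qed.

Lemma cap_mass_ge0 n : (0 <= cap_mass n)%R.
Proof. by apply: fine_ge0; apply: integral_ge0 => z _; rewrite lee_fin cap_weight_ge0. Qed.

Definition cap_density n (z : k.-tuple R) : R := (cap_weight n z / cap_mass n)%R.

Lemma cap_density_ge0 n z : (0 <= cap_density n z)%R.
Proof. by rewrite divr_ge0 ?cap_weight_ge0 ?cap_mass_ge0. Qed.

Lemma measurable_cap_density n : measurable_fun setT (cap_density n).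
Proof. by apply: measurable_funM => //; exact: measurable_cap_weight. Qed.

Lemma integral_sphere_cap n (f : k.-tuple R -> R) : (k + 2 < n)%N ->
  measurable_fun setT f ->
  \int[sigma n]_x (f (first_coords k (sval x)))%:E =
  \int[gauss]_z (f z * cap_density n z)%:E.
Proof.
move=> kn mf; rewrite integralE [RHS]integralE.
have maxM (x y : R) : (0 <= y)%R -> maxe (x * y)%:E 0 = maxe x%:E 0 * y%:E.
  by move=> y0; rewrite -!EFin_max -EFinM maxr_pMl// mul0r.
congr (_ - _).
- rewrite (_ : _^\+ = (EFin \o f)^\+ \o (fun x : sphere R n => first_coords k (sval x)));
    last by rewrite -funepos_comp.
  rewrite (ge0_integral_sphere_cap (f := (EFin \o f)^\+))//; last first.
    by apply: measurable_funepos; exact/measurable_EFinP.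
  by apply: eq_integral => z _; rewrite !funeposE/= maxM// cap_density_ge0.
- rewrite (_ : _^\- = (EFin \o f)^\- \o (fun x : sphere R n => first_coords k (sval x)));
    last by rewrite -funeneg_comp.
  rewrite (ge0_integral_sphere_cap (f := (EFin \o f)^\-))//; last first.
    by apply: measurable_funeneg; exact/measurable_EFinP.
  apply: eq_integral => z _; rewrite !funenegE/= -mulNr maxM// cap_density_ge0//.
Qed.

Section dominated.
Variables (a : R) (a0 : (0 < a)%R).

Lemma cap_weight_near : \forall n \near \oo, (k + 2 < n)%N /\
  forall z : k.-tuple R, (cap_weight n z <= expR (a * sqn z))%R.
Proof.
near=> n.
have kn : (k + 2 < n)%N by near: n; exact: nbhs_infty_gt.
have n0 : (0 < n%:R :> R)%R by rewrite ltr0n (leq_ltn_trans _ kn).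
split => // z; rewrite (le_trans (cap_weight_le _ kn))// ler_expR ler_wpM2r ?sqn_ge0//.
rewrite ler_pdivrMr ?mulr_gt0// -ler_pdivrMl//.
rewrite -ler_pdivrMl//; near: n; exact: nbhs_infty_ger.
Unshelve. all: by end_near. Qed.

Lemma measurable_dominated (g : k.-tuple R -> R) : measurable_fun setT g ->
  measurable_fun setT (fun z => `|g z| * expR (a * sqn z))%R.
Proof.
move=> mg; apply: measurable_funM; last exact: measurable_expR_sqn.
exact: measurableT_comp.
Qed.

Hypothesis int1 : gauss.-integrable setT (fun z => (expR (a * sqn z))%:E).

Lemma cvg_cap_mass : cap_mass n @[n --> \oo] --> (1 : R)%R.
Proof.
have [n0 _ n0P] := cap_weight_near.
(* The domination holds only from [n0] on, while [dominated_cvg] asks for it at every index. *)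
rewrite -(cvg_shiftn n0).
apply: fine_cvg.
have -> : 1%:E = \int[gauss]_z 1%:E by rewrite integral_cst//= probability_setT mule1.
apply: (@dominated_cvg _ _ _ gauss setT measurableT
  (fun j z => (cap_weight (j + n0) z)%:E) (fun z => 1%:E) (fun z => (expR (a * sqn z))%:E)) => //.
- by move=> j; apply/measurable_EFinP; exact: measurable_cap_weight.
- move=> z _; apply: cvg_EFin; first exact: nearW.
  by rewrite (cvg_shiftn n0 (fun n => cap_weight n z)); exact: cvg_cap_weight.
- move=> j z _; rewrite lee_fin ger0_norm ?cap_weight_ge0//.
  by apply: (n0P _ _).2; rewrite /= leq_addl.
Qed.

Lemma cap_density_near : \forall n \near \oo, (k + 2 < n)%N /\
  forall z : k.-tuple R, (cap_density n z <= 2 * expR (a * sqn z))%R.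
Proof.
near=> n.
have [kn nle] : (k + 2 < n)%N /\
  forall z : k.-tuple R, (cap_weight n z <= expR (a * sqn z))%R.
  by near: n; exact: cap_weight_near.
split => // z; rewrite mulrC /cap_density.
(* Origin of the factor 2: [cap_mass n] tends to 1, so it is eventually at least $1/2$. *)
have c2 : (2^-1 <= cap_mass n)%R.
  near: n; apply: (cvgr_ge 1%R cvg_cap_mass); by rewrite invf_lt1// ltr1n.
apply: ler_pM => //; rewrite ?cap_weight_ge0 ?invr_ge0 ?cap_mass_ge0//.
by rewrite -[leRHS]invrK lef_pV2 ?posrE// (lt_le_trans _ c2).
Unshelve. all: by end_near. Qed.

Variable g : k.-tuple R -> R.
Hypotheses (mg : measurable_fun setT g)
  (intg : gauss.-integrable setT (fun z => (`|g z| * expR (a * sqn z))%:E)).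

Lemma sphere_dominated_near : \forall n \near \oo,
  \int[sigma n]_x (`|g (first_coords k (sval x))|)%:E <=
  2%:E * \int[gauss]_z (`|g z| * expR (a * sqn z))%:E.
Proof.
near=> n.
have [kn nle] : (k + 2 < n)%N /\
  forall z : k.-tuple R, (cap_density n z <= 2 * expR (a * sqn z))%R.
  by near: n; exact: cap_density_near.
have mng : measurable_fun setT (fun z => `|g z|)%R by exact: measurableT_comp.
rewrite (integral_sphere_cap kn mng) -ge0_integralZl//; last first.
  by apply/measurable_EFinP; exact: measurable_dominated.
apply: ge0_le_integral => //.
- by move=> z _; rewrite lee_fin mulr_ge0// cap_density_ge0.
- by apply/measurable_EFinP; apply: measurable_funM => //; exact: measurable_cap_density.
- apply: emeasurable_funM => //; apply/measurable_EFinP; exact: measurable_dominated.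
- by move=> z _; rewrite -EFinM lee_fin [leRHS]mulrCA ler_wpM2l.
Unshelve. all: by end_near. Qed.

Lemma sphere_integrable_near : \forall n \near \oo,
  (sigma n).-integrable setT (fun x => (g (first_coords k (sval x)))%:E).
Proof.
apply: filterS sphere_dominated_near => n nle; apply/integrableP; split.
  by apply/measurable_EFinP; exact: (measurableT_comp mg (@measurable_sphere_proj R k n)).
apply: (le_lt_trans nle); rewrite lte_mul_pinfty//.
have /integrableP[_] := intg.
by under eq_integral do rewrite /= ger0_norm ?mulr_ge0 ?expR_ge0//.
Qed.

Lemma cvg_integral_sphere :
  \int[sigma n]_x (g (first_coords k (sval x)))%:E @[n --> \oo] --> \int[gauss]_z (g z)%:E.
Proof.
have [n0 _ n0P] := cap_density_near.
rewrite -(cvg_shiftn n0).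
rewrite (_ : (fun n => _) = (fun j => \int[gauss]_z (g z * cap_density (j + n0) z)%:E)); last first.
  apply/funext => j; rewrite integral_sphere_cap//.
  by apply: (n0P _ _).1; rewrite /= leq_addl.
apply: (@dominated_cvg _ _ _ gauss setT measurableT _ _
  (fun z => (2 * (`|g z| * expR (a * sqn z)))%:E)) => //.
- move=> j; apply/measurable_EFinP; apply: measurable_funM => //.
  exact: measurable_cap_density.
- move=> z _; apply: cvg_EFin; first exact: nearW.
  suff : (fun j => g z * cap_density (j + n0) z)%R @ \oo --> (g z * (1 * 1^-1))%R.
    by rewrite invr1 !mulr1.
  apply: cvgM; first exact: cvg_cst.
  rewrite (cvg_shiftn n0 (fun n => cap_density n z)).
  by apply: cvgM; [exact: cvg_cap_weight|apply: cvgV => //; exact: cvg_cap_mass].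
- under eq_fun do rewrite EFinM.
  exact: integrableZl.
- move=> j z _; rewrite lee_fin normrM mulrCA ler_wpM2l//.
  rewrite ger0_norm ?cap_density_ge0//.
  by apply: (n0P _ _).2; rewrite /= leq_addl.
Qed.

End dominated.

End sphere_limits.

(** * Domination of $L^p$ functions *)

Section lp_domination.
Local Open Scope ereal_scope.
Context (R : realType) (k : nat) (p : R).
Hypothesis p1 : (1 < p)%R.
Local Notation gauss := (std_gaussian R k).

Let q : R := (p / (p - 1))%R.

(** With [q] conjugate to [p], the [q]-th power of $e^{a|z|^2}$ is $e^{|z|^2/4}$, whose Gaussian
    integral is finite by [gaussian_moment_lty]. *)
Definition lp_exponent : R := (4 * q)^-1%R.

Let p0 : (0 < p)%R. Proof. exact: lt_trans p1. Qed.

Let q0 : (0 < q)%R.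
Proof. by rewrite divr_gt0// subr_gt0. Qed.

Lemma lp_exponent_gt0 : (0 < lp_exponent)%R.
Proof. by rewrite invr_gt0 mulr_gt0. Qed.

Lemma integrable_lp_domination (g : k.-tuple R -> R) : measurable_fun setT g ->
  gauss.-integrable setT (fun z => (`|g z| `^ p)%:E) ->
  gauss.-integrable setT (fun z => (`|g z| * expR (lp_exponent * sqn z))%:E).
Proof.
move=> mg intg.
have m4 : measurable_fun setT (fun z : k.-tuple R => (expR (sqn z / 4))%:E).
  apply/measurable_EFinP; under eq_fun do rewrite mulrC; exact: measurable_expR_sqn.
have int4 : gauss.-integrable setT (fun z => (expR (sqn z / 4))%:E).
  apply/integrableP; split => //.
  under eq_integral do rewrite /= ger0_norm ?expR_ge0//.
  exact: gaussian_moment_lty.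
apply: (le_integrable _ _ _ (integrableD _ intg int4)) => //.
  by apply/measurable_EFinP; exact: measurable_dominated.
move=> z _; rewrite /= lee_fin [leLHS]ger0_norm ?mulr_ge0 ?expR_ge0//.
rewrite [leRHS]ger0_norm ?addr_ge0 ?powR_ge0 ?expR_ge0//.
have pq : (p^-1 + q^-1 = 1)%R.
  by rewrite /q; field; rewrite ?gt_eqF// subr_gt0.
apply: (le_trans (conjugate_powR (normr_ge0 _) (expR_ge0 _) p0 q0 pq)).
apply: lerD.
  by rewrite ler_piMr ?powR_ge0// invf_le1// ltW.
rewrite -expRM (_ : lp_exponent * sqn z * q = sqn z / 4)%R; last first.
  by rewrite /lp_exponent; field; rewrite gt_eqF.
rewrite ler_piMr ?expR_ge0// invf_le1// /q ler_pdivlMr ?subr_gt0//; lra.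
Qed.

End lp_domination.

Section lp_functions.
Local Open Scope ereal_scope.
Context (R : realType) (sigma : forall n : nat, probability (sphere R n) R).
Hypothesis sigma_rot : forall n, rotation_invariant (sigma n).
Context (k : nat) (p : R) (p1 : (1 < p)%R) (f : k.-tuple R -> R).
Local Notation gauss := (std_gaussian R k).
Hypothesis f_Lp : f \in Lfun gauss p%:E.
Local Notation a := (lp_exponent p).

Lemma measurable_lp : measurable_fun setT f.
Proof. by have /sub_Lfun_mfun := f_Lp; rewrite inE. Qed.

Let mf := measurable_lp.
Let a0 : (0 < a)%R := lp_exponent_gt0 p1.

Lemma integrable_one_domination : gauss.-integrable setT (fun z => (expR (a * sqn z))%:E).
Proof.
have := @integrable_lp_domination R k p p1 (cst 1%R).
under eq_fun do rewrite normr1 powR1; under [in X in _ -> _ -> X]eq_fun do rewrite normr1 mul1r.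
by apply => //; exact: finite_measure_integrable_cst.
Qed.

Lemma integrable_f_domination :
  gauss.-integrable setT (fun z => (`|f z| * expR (a * sqn z))%:E).
Proof. by apply: integrable_lp_domination => //; apply: Lfun_integrable => //; exact: ltW. Qed.

Lemma integrable_le_domination (g : k.-tuple R -> R) : measurable_fun setT g ->
  (forall z, `|g z| <= `|f z|)%R ->
  gauss.-integrable setT (fun z => (`|g z| * expR (a * sqn z))%:E).
Proof.
move=> mg gf; apply: (le_integrable _ _ _ integrable_f_domination) => //.
  by apply/measurable_EFinP; exact: measurable_dominated.
move=> z _; rewrite /= lee_fin !normrM !normr_id.
by rewrite ler_wpM2r.
Qed.

Lemma integrable_lp : gauss.-integrable setT (EFin \o f).
Proof.
apply: (le_integrable _ _ _ integrable_f_domination) => //; first exact/measurable_EFinP.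
move=> z _; rewrite /= lee_fin normrM normr_id ler_peMr//.
by rewrite ger0_norm ?expR_ge0// -expR0 ler_expR mulr_ge0 ?sqn_ge0// ltW.
Qed.

Lemma on_sphere_cvg (g : k.-tuple R -> R) : measurable_fun setT g ->
  (forall z, `|g z| <= `|f z|)%R ->
  \int[sigma n]_x (on_sphere g x)%:E @[n --> \oo] --> \int[gauss]_z (g z)%:E.
Proof.
move=> mg gf; apply: (cvg_integral_sphere sigma_rot a0) => //.
- exact: integrable_one_domination.
- exact: integrable_le_domination.
Qed.

Lemma on_sphere_integrable_near : \forall n \near \oo,
  (sigma n).-integrable setT (EFin \o on_sphere f (n:=n)).
Proof.
by apply: (sphere_integrable_near sigma_rot a0) => //;
  [exact: integrable_one_domination|exact: integrable_f_domination].
Qed.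

(** Cutting off inside the integrand keeps a function of the first [k] coordinates dominated by
    [|f|], to which [on_sphere_cvg] applies. *)
Definition trunc_tail (m : R) (z : k.-tuple R) : R :=
  (`|f z| * \1_[set y | m <= `|f y|]%R z)%R.

Lemma measurable_tail_set (m : R) : measurable [set y | m <= `|f y|]%R.
Proof.
rewrite -[X in measurable X]setTI.
have mnf : measurable_fun setT (fun y => `|f y|%R) by exact: measurableT_comp.
rewrite (_ : [set y | _] = (fun y => `|f y|%R) @^-1` `[m, +oo[%classic).
  exact: mnf.
by apply/seteqP; split => z /=; rewrite in_itv/= andbT.
Qed.

Lemma measurable_trunc_tail m : measurable_fun setT (trunc_tail m).
Proof.
apply: measurable_funM; first exact: measurableT_comp.
by apply: measurable_indic; exact: measurable_tail_set.
Qed.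

Lemma trunc_tail_ge0 m z : (0 <= trunc_tail m z)%R.
Proof. by rewrite mulr_ge0. Qed.

Lemma trunc_tail_le m z : (`|trunc_tail m z| <= `|f z|)%R.
Proof. by rewrite ger0_norm ?trunc_tail_ge0// /trunc_tail indicE ler_piMr//; case: (_ \in _). Qed.

Lemma tail_integralE n (m : R) :
  \int[sigma n]_(x in [set x | (m <= `|on_sphere f x|)%R]) (`|on_sphere f x|)%R%:E =
  \int[sigma n]_x (on_sphere (trunc_tail m) x)%:E.
Proof.
rewrite integral_mkcond; apply: eq_integral => x _.
rewrite epatch_indic /on_sphere /trunc_tail EFinM muleC; congr (_ * _%:E).
Qed.

Definition tail (m : nat) : \bar R := \int[gauss]_z (trunc_tail m%:R z)%:E.

Lemma cvg_tail_sphere (m : nat) :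
  (\int[sigma n]_(x in [set x | (m%:R <= `|on_sphere f x|)%R])
     (`|on_sphere f x|)%R%:E) @[n --> \oo] --> tail m.
Proof.
under eq_cvg do rewrite tail_integralE.
by apply: on_sphere_cvg; [exact: measurable_trunc_tail|exact: trunc_tail_le].
Qed.

Lemma cvg_tail : tail @ \oo --> 0.
Proof.
rewrite -(@integral0 _ _ R gauss setT).
apply: (@dominated_cvg _ _ _ gauss setT measurableT _ _ (fun z => `|f z|%:E)) => //.
- by move=> j; apply/measurable_EFinP; exact: measurable_trunc_tail.
- move=> z _; apply: cvg_EFin; first exact: nearW.
  apply: cvg_near_cst; near=> m.
  rewrite /= /trunc_tail indicE memNset ?mulr0//= => /=.
  apply/negP; rewrite -ltNge; near: m; exact: nbhs_infty_gtr.
- exact: (integrable_abse integrable_lp).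
- by move=> j z _; rewrite lee_fin trunc_tail_le.
Unshelve. all: by end_near. Qed.

Lemma sphere_setwise_cvg (A : set (k.-tuple R)) : measurable A ->
  fine (sigma n [set x | A (first_coords k (sval x))]) @[n --> \oo] --> fine (gauss A).
Proof.
move=> mA; apply: fine_cvg; rewrite fineK ?fin_num_measure//.
have -> : gauss A = \int[gauss]_z (\1_A z)%:E by rewrite integral_indic// setIT.
have -> : (fun n => sigma n [set x | A (first_coords k (sval x))]) =
    (fun n => \int[sigma n]_x (\1_A (first_coords k (sval x)))%:E).
  apply/funext => n.
  rewrite (_ : (fun x => _) = EFin \o \1_[set x : sphere R n | A (first_coords k (sval x))]).
    rewrite integral_indic ?setIT// -[X in measurable X]setTI.
    by have := @measurable_sphere_proj R k n measurableT _ mA.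
  by apply/funext => x /=; rewrite !indicE; congr (_ %:R%:E); apply/idP/idP; rewrite !inE.
apply: (cvg_integral_sphere sigma_rot a0) => //.
- exact: integrable_one_domination.
- apply: (le_integrable _ _ _ integrable_one_domination) => //.
    apply/measurable_EFinP; exact: measurable_dominated.
  move=> z _; rewrite /= lee_fin normrM ler_piMl// normr_id ger0_norm// indicE.
Qed.

End lp_functions.

(** * The Loeb law of a standard function *)

Local Notation v0 := (TVar VZ).
Local Notation v1 := (TVar (VS VZ)).
Local Notation Holds t := (FEq t (TCst True)).
Local Notation A1 g t := (TApp (TCst g) t).
Local Notation A2 g t u := (TApp (TApp (TCst g) t) u).
Local Notation A3 g t u v := (TApp (TApp (TApp (TCst g) t) u) v).

(** * Limits evaluated at unlimited indices *)

Section unlimited_indices.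
Variables (E : nsextension) (N : star E nat).
Hypothesis unlN : unlimited N.

(** If [n <= N] and [N] is not the standard [n], transfer gives [n.+1 <= N]; an unlimited [N] thus
    passes every standard number in turn. *)
Lemma unlimited_ge (n : nat) : lift_rel2 (fun a b : nat => a <= b : Prop)%N (std n) N.
Proof.
elim: n => [|n IH].
  have h := (transfer E (FAll nat (Holds (A2 (fun a b : nat => a <= b : Prop)%N (TCst 0%N) v0)))).1.
  by apply: h => m /=; rewrite Defs.trueE.
have h := (transfer E (FAll nat
  (FImp (Holds (A2 (fun a b : nat => a <= b : Prop)%N (TCst n) v0))
  (FImp (FImp (FEq v0 (TCst n)) FBot)
  (Holds (A2 (fun a b : nat => a <= b : Prop)%N (TCst n.+1) v0)))))).1.
apply: h IH _ => [m /=|/=]; last exact: unlN.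
by rewrite !Defs.trueE => nm mn; rewrite ltn_neqAle nm andbT; apply/eqP => nE; exact: mn.
Qed.

Lemma unlimited_near (Q : nat -> Prop) : (\forall n \near \oo, Q n) -> lift1 Q N = std True.
Proof.
move=> [n0 _ n0Q].
have h := (transfer E (FAll nat
  (FImp (Holds (A2 (fun a b : nat => a <= b : Prop)%N (TCst n0) v0)) (Holds (A1 Q v0))))).1.
by apply: h (unlimited_ge n0) => m /=; rewrite !Defs.trueE; exact: n0Q.
Qed.

Variable R : realType.

Lemma infinitely_close_lim (u : nat -> R) (l : R) : u @ \oo --> l ->
  infinitely_close (lift1 u N) (std l).
Proof.
move=> ul e e0.
have ue : \forall n \near \oo, `|u n - l| <= e by move/cvgrPdistC_le : ul; exact.
have h := (transfer E (FAll nat (FImp (Holds (A1 (fun n => `|u n - l| <= e : Prop) v0))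
  (Holds (A2 (fun x y : R => x <= y : Prop)
    (A2 (fun x y : R => `|x - y|) (A1 u v0) (TCst l)) (TCst e)))))).1.
by apply: h (unlimited_near ue) => n.
Qed.

Lemma st_lim (u : nat -> R) (l : R) : u @ \oo --> l -> st (lift1 u N) = l.
Proof. by move=> ul; apply: stE; exact: infinitely_close_lim. Qed.

End unlimited_indices.

Section standard_parts.
Variables (E : nsextension) (R : realType).
Implicit Types (x : star E R) (r b : R).

Lemma infinitely_close_fin x r : infinitely_close x (std r) -> star_fin x.
Proof.
move=> /(_ 1 ltr01) xr; exists (Num.truncn (`|r| + 1)).+1.
have h := (transfer E (FAll R (FImp
  (Holds (A2 (fun x y : R => x <= y : Prop) (A2 (fun x y : R => `|x - y|) v0 (TCst r)) (TCst 1)))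
  (Holds (A2 (fun x y : R => x <= y : Prop) (A1 (fun y : R => `|y|) v0)
    (TCst (Num.truncn (`|r| + 1)).+1%:R)))))).1.
apply: h xr => y /=; rewrite !Defs.trueE => yr.
rewrite (le_trans _ (ltW (truncnS_gt _)))//.
by rewrite -[y](subrK r) (le_trans (ler_normD _ _))// addrC lerD2l.
Qed.

Lemma st_infinite x : ~ star_fin x -> st x = 0.
Proof.
move=> xfin; rewrite /st; case: xgetP => [r _ xr|//].
by case: xfin; exact: infinitely_close_fin xr.
Qed.

Lemma st_le x r : star_fin x -> star_le x (std r) -> st x <= r.
Proof.
move=> /infinitely_close_st xst xr; apply/ler_addgt0Pr => e e0.
apply/(star_le_std E).
have h := (transfer E (FAll R (FImp
  (Holds (A2 (fun x y : R => x <= y : Prop) v0 (TCst r)))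
  (FImp (Holds (A2 (fun x y : R => x <= y : Prop)
    (A2 (fun x y : R => `|x - y|) v0 (TCst (st x))) (TCst e)))
  (Holds (A2 (fun x y : R => x <= y : Prop) (TCst (st x)) (TCst (r + e)))))))).1.
apply: h xr (xst _ e0) => y /=; rewrite !Defs.trueE => yr.
rewrite ler_norml => /andP[xy _]; lra.
Qed.

(** Strictness matters: [st x = r] leaves the order of [x] and [r] undecided. *)
Lemma st_lt x r : star_fin x -> st x < r -> star_le x (std r).
Proof.
move=> /infinitely_close_st xst xr.
have h := (transfer E (FAll R
  (FImp (Holds (A2 (fun x y : R => x <= y : Prop)
    (A2 (fun x y : R => `|x - y|) v0 (TCst (st x))) (TCst (r - st x))))
  (Holds (A2 (fun x y : R => x <= y : Prop) v0 (TCst r)))))).1.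
apply: h (xst _ _) => [y /=|]; last by rewrite subr_gt0.
by rewrite !Defs.trueE ler_norml => /andP[_]; rewrite lerD2r.
Qed.

End standard_parts.

(** * The law of the standard part under the Loeb measure *)

Section loeb_law.
Variables (E : nsextension) (R : realType).
Variables (d : nat -> measure_display) (T : forall n, measurableType (d n)).
Variables (P : forall n, probability (T n) R) (N : star E nat).
Hypothesis unlN : unlimited N.
Let X := {n & T n}.
Variable F : X -> R.
Hypothesis mF : forall n, measurable_fun setT (fun t : T n => F (existT _ n t)).
Local Notation space := (internal_space T N).
Local Notation L := (loeb P N).
Local Notation starF w := (app (std F) (sval w : star E X)).

Lemma internal_prob_std (A : set X) :
  internal_prob P N (std A) = lift1 (fun n => fibre_prob P n A) N.
Proof.
have h := (transfer E (FAll nat (FEq (A2 (fibre_prob P) v0 (TCst A))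
  (A1 (fun n => fibre_prob P n A) v0)))).1.
exact: h.
Qed.

Lemma internal_measurable_std (A : set X) : (forall n, fibre_measurable n A) ->
  internal_measurable N (std A).
Proof.
move=> mA; have h := (transfer E (FAll nat (Holds (A2 (@fibre_measurable _ T) v0 (TCst A))))).1.
by apply: h => n /=; rewrite Defs.trueE.
Qed.

(** The internal probability of a standard set is the sequence of its fibre probabilities evaluated
    at [N], and the standard part of that value is the limit of the sequence. *)
Lemma loeb_std (A : set X) (l : R) : (forall n, fibre_measurable n A) ->
  fibre_prob P n A @[n --> \oo] --> l -> L (@internal_trace E d T N (std A)) = l%:E.
Proof.
move=> mA Al; rewrite loeb_internal; last exact: internal_measurable_std.
by rewrite internal_prob_std (st_lim unlN Al).
Qed.

Lemma measurable_loeb_std (A : set X) : (forall n, fibre_measurable n A) ->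
  (loeb_premeasure P (N := N))^*%mu.-cara.-measurable (@internal_trace E d T N (std A)).
Proof.
move=> mA; apply: sub_caratheodory; apply: sub_sigma_algebra.
by exists (std A) => //; exact: internal_measurable_std.
Qed.

Definition sublevel (r : R) : set X := [set x | F x <= r].
Definition bounded_by (m : R) : set X := [set x | `|F x| <= m].

Lemma trace_sublevel r (w : space) :
  @internal_trace E d T N (std (sublevel r)) w <-> star_le (starF w) (std r).
Proof.
have h1 := (transfer E (FAll X (FImp (Holds (TApp (TCst (sublevel r)) v0))
  (Holds (A2 (fun x y : R => x <= y : Prop) (A1 F v0) (TCst r)))))).1.
have h2 := (transfer E (FAll X (FImp
  (Holds (A2 (fun x y : R => x <= y : Prop) (A1 F v0) (TCst r)))
  (Holds (TApp (TCst (sublevel r)) v0))))).1.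
by split; [apply: h1|apply: h2] => x /=; rewrite !Defs.trueE.
Qed.

Lemma trace_bounded_by m (w : space) :
  @internal_trace E d T N (std (bounded_by m)) w <->
  star_le (lift1 (fun y : R => `|y|) (starF w)) (std m).
Proof.
have h1 := (transfer E (FAll X (FImp (Holds (TApp (TCst (bounded_by m)) v0))
  (Holds (A2 (fun x y : R => x <= y : Prop) (A1 (fun y : R => `|y|) (A1 F v0)) (TCst m)))))).1.
have h2 := (transfer E (FAll X (FImp
  (Holds (A2 (fun x y : R => x <= y : Prop) (A1 (fun y : R => `|y|) (A1 F v0)) (TCst m)))
  (Holds (TApp (TCst (bounded_by m)) v0))))).1.
by split; [apply: h1|apply: h2] => x /=; rewrite !Defs.trueE.
Qed.

Lemma measurable_preimage_fibre (B : set R) : measurable B ->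
  forall n, fibre_measurable n (F @^-1` B).
Proof.
by move=> mB n; have := @mF n measurableT B mB; rewrite setTI.
Qed.

Variables (dY : measure_display) (Y : measurableType dY) (gam : probability Y R) (f : Y -> R).
Hypothesis mf : measurable_fun setT f.
(** Weak convergence would not do: the law of [f] may charge the endpoints of the intervals used
    below. *)
Hypothesis cvg_law : forall B : set R, measurable B ->
  fibre_prob P n (F @^-1` B) @[n --> \oo] --> fine (gam (f @^-1` B)).

Let mpre (B : set R) : measurable B -> measurable (f @^-1` B).
Proof. by move=> mB; rewrite -[X in measurable X]setTI; exact: mf. Qed.

Let loeb_preimage (B : set R) : measurable B ->
  L (@internal_trace E d T N (std (F @^-1` B))) = gam (f @^-1` B).
Proof.
move=> mB; rewrite (loeb_std (measurable_preimage_fibre mB) (cvg_law mB)).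
by rewrite fineK// fin_num_measure//; exact: mpre.
Qed.

Let C (r : R) : set space := @internal_trace E d T N (std (F @^-1` `]-oo, r]%classic)).

Let CE r w : C r w <-> star_le (starF w) (std r).
Proof.
rewrite -trace_sublevel /C (_ : _ @^-1` _ = sublevel r)//.
Qed.

Let B (m : nat) : set space :=
  @internal_trace E d T N (std (F @^-1` `[- m%:R, m%:R]%classic)).

Let BE m w : B m w <-> star_le (lift1 (fun y : R => `|y|) (starF w)) (std m%:R).
Proof.
rewrite -trace_bounded_by /B (_ : _ @^-1` _ = bounded_by m%:R)//.
by apply/seteqP; split => x; rewrite /bounded_by/= in_itv/= ler_norml.
Qed.

Let S : set space := [set w | star_fin (starF w)].

Let SE : S = \bigcup_m B m.
Proof.
apply/seteqP; split => w.
  by move=> [m wm]; exists m => //; exact/BE.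
by move=> [m _ /BE wm]; exists m.
Qed.

Let mC r : (loeb_premeasure P (N := N))^*%mu.-cara.-measurable (C r).
Proof. by apply: measurable_loeb_std; exact: measurable_preimage_fibre. Qed.

Let mBm m : (loeb_premeasure P (N := N))^*%mu.-cara.-measurable (B m).
Proof. by apply: measurable_loeb_std; exact: measurable_preimage_fibre. Qed.

Let mS : (loeb_premeasure P (N := N))^*%mu.-cara.-measurable S.
Proof. by rewrite SE; apply: bigcupT_measurable => m; exact: mBm. Qed.

(** Finiteness is the countable union over [m] of the events $|{}^*F| \le m$. Continuity from below,
    for both measures, gives the mass of $\bigcup_m \{|f| \le m\}$, the whole space. *)
Lemma loeb_finite : L [set w : space | star_fin (starF w)] = 1%E.
Proof.
rewrite -/S SE.
have LB : L \o B @ \oo --> L (\bigcup_m B m).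
  apply: nondecreasing_cvg_mu => //.
  - exact: bigcupT_measurable.
  - move=> m n mn; apply/subsetPset => w /BE wm; apply/BE.
    apply: star_le_trans wm _; apply/star_le_std; by rewrite ler_nat.
have gB : (fun m : nat => gam (f @^-1` `[- m%:R, m%:R]%classic)) @ \oo -->
    gam (\bigcup_m (f @^-1` `[- m%:R, m%:R]%classic)).
  apply: nondecreasing_cvg_mu => //.
  - by move=> m; exact: mpre.
  - by apply: bigcupT_measurable => m; exact: mpre.
  - move=> m n mn; apply/subsetPset => y /=; rewrite !in_itv/= -!ler_norml => ym.
    by rewrite (le_trans ym)// ler_nat.
have LBE : L \o B = (fun m : nat => gam (f @^-1` `[- m%:R, m%:R]%classic)).
  by apply/funext => m /=; rewrite loeb_preimage.
rewrite -(cvg_lim _ LB)// LBE (cvg_lim _ gB)//.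
rewrite (_ : \bigcup_m _ = setT) ?probability_setT//.
apply/seteqP; split => // y _; exists (Num.truncn `|f y|).+1 => //=.
by rewrite in_itv/= -ler_norml ltW// truncnS_gt.
Qed.

Let stF (w : space) : R := st (starF w).

(** The event $\operatorname{st}({}^*F) < b$ need not be internal; on finite points it is exhausted
    by the internal events ${}^*F \le b - 1/(j+1)$. *)
Let D (b : R) : set space := \bigcup_j C (b - j.+1%:R^-1).

(** At infinite values [st] is 0 by default, so those points belong to the event exactly when
    [0 < b]. *)
Let stF_lt b : [set w | stF w < b] = (D b `&` S) `|` ((if 0 < b then setT else set0) `&` ~` S).
Proof.
apply/seteqP; split => [w /= wb|w [[[j _ /CE wj] Sw]|[+ nSw]]].
- have [Sw|nSw] := pselect (S w); last first.
    right; split => //; move: wb; rewrite /stF st_infinite// => ->; exact: I.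
  left; split => //; have [j /= jb] : exists j : nat, stF w < b - j.+1%:R^-1.
    move: (wb); rewrite -subr_gt0 => /ltr_add_invr[j]; rewrite add0r => jd.
    by exists j; rewrite ltrBrDr -ltrBrDl.
  by exists j => //; apply/CE; apply: st_lt.
- rewrite /= (@le_lt_trans _ _ (b - j.+1%:R^-1))//; first exact: st_le.
  by rewrite ltrBlDr ltrDl invr_gt0.
- by rewrite /= /stF st_infinite//; case: ifP.
Qed.

Let mstF_lt b : (loeb_premeasure P (N := N))^*%mu.-cara.-measurable [set w | stF w < b].
Proof.
rewrite stF_lt; apply: measurableU; apply: measurableI => //.
- by apply: bigcupT_measurable => j; exact: mC.
- by case: ifP => _; [exact: measurableT|exact: measurable0].
- exact: measurableC.
Qed.

Lemma measurable_st_loeb : measurable_fun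
  [set: caratheodory_type (loeb_premeasure P (N := N))^*%mu] (fun w : space => st (starF w)).
Proof.
apply: (measurability _ (@RGenInftyO.measurableE R)) => _ [_ [b ->] <-].
rewrite setTI (_ : _ @^-1` _ = [set w | stF w < b]); first exact: mstF_lt.
by apply/seteqP; split => w /=; rewrite in_itv/=.
Qed.

Let loeb_nS : L (~` S) = 0%E.
Proof.
have : L (S `|` ~` S) = (L S + L (~` S))%E.
  by apply: measureU => //; [exact: measurableC|exact: setICr].
rewrite setUv (_ : L setT = 1%E); last exact: loebT.
rewrite (_ : L S = 1%E); last exact: loeb_finite.
case: (L (~` S)) => [r| |]//.
move=> h; have [r0] : 1%:E = (1 + r)%:E by [].
by congr EFin; lra.
Qed.

Let loeb_D b : L (D b) = gam (f @^-1` `]-oo, b[%classic).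
Proof.
have nd : {homo (fun j => b - j.+1%:R^-1) : m n / (m <= n)%N >-> m <= n}.
  by move=> m n mn; rewrite lerD2l lerN2 lef_pV2 ?posrE// ler_nat.
have LD : L \o (fun j => C (b - j.+1%:R^-1)) @ \oo --> L (D b).
  apply: nondecreasing_cvg_mu => //.
  - exact: bigcupT_measurable.
  - move=> m n mn; apply/subsetPset => w /CE wm; apply/CE.
    by apply: star_le_trans wm _; apply/star_le_std; exact: nd.
have gD : (fun j => gam (f @^-1` `]-oo, b - j.+1%:R^-1]%classic)) @ \oo -->
    gam (\bigcup_j (f @^-1` `]-oo, b - j.+1%:R^-1]%classic)).
  apply: nondecreasing_cvg_mu => //.
  - by move=> m; exact: mpre.
  - by apply: bigcupT_measurable => m; exact: mpre.
  - move=> m n mn; apply/subsetPset => y /=; rewrite !in_itv/= => ym.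
    by rewrite (le_trans ym)// nd.
have CgE : L \o (fun j => C (b - j.+1%:R^-1)) =
    (fun j => gam (f @^-1` `]-oo, b - j.+1%:R^-1]%classic)).
  by apply/funext => m /=; rewrite loeb_preimage.
rewrite -(cvg_lim _ LD)// CgE (cvg_lim _ gD)//; congr (gam _).
apply/seteqP; split => y /=.
  move=> [j _ /=]; rewrite !in_itv/= => yj.
  by rewrite (le_lt_trans yj)// ltrBlDr ltrDl invr_gt0.
rewrite in_itv/= -subr_gt0 => /ltr_add_invr[j]; rewrite add0r => jy.
by exists j => //=; rewrite in_itv/= lerBrDr -lerBrDl ltW.
Qed.

(** The event agrees with [D b] on the finite points, and the infinite ones form a null set. *)
Let loeb_stF_lt b : L [set w | stF w < b] = gam (f @^-1` `]-oo, b[%classic).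
Proof.
have mD : (loeb_premeasure P (N := N))^*%mu.-cara.-measurable (D b).
  by apply: bigcupT_measurable => j; exact: mC.
have mnS := measurableC mS.
rewrite -loeb_D; apply/le_anti/andP; split.
  rewrite -[leRHS]adde0 -loeb_nS; apply: (le_trans _ (measureU2 L mD mnS)).
  apply: le_measure; rewrite ?inE//; [exact: measurableU|].
  by rewrite stF_lt => w [[Dw _]|[_ nSw]]; [left|right].
rewrite -[leRHS]adde0 -loeb_nS; apply: (le_trans _ (measureU2 L (mstF_lt b) mnS)).
apply: le_measure; rewrite ?inE//; [exact: measurableU|].
move=> w Dw; have [Sw|nSw] := pselect (S w); [left|by right].
by rewrite stF_lt; left.
Qed.

Lemma loeb_st_law (A : set R) : measurable A ->
  L [set w : space | A (st (starF w))] = gam (f @^-1` A).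
Proof.
move=> mA.
have mst : measurable_fun [set: caratheodory_type (loeb_premeasure P (N := N))^*%mu]
    (stF : _ -> measurableTypeR R) by exact: measurable_st_loeb.
have mf' : measurable_fun setT (f : Y -> measurableTypeR R) by exact: mf.
apply: (@measure_unique_rays R (pushforward_measure L mst) (pushforward_measure gam mf')) => // b.
- rewrite /= /pushforward (_ : _ @^-1` _ = [set w | stF w < b]).
  by rewrite loeb_stF_lt (le_lt_trans (probability_le1 _ _)) ?ltry//; exact: mpre.
- rewrite /= /pushforward (_ : stF @^-1` _ = [set w | stF w < b]) ?loeb_stF_lt//.
Qed.

Lemma loeb_st_integral : gam.-integrable setT (EFin \o f) ->
  L.-integrable setT (fun w : space => (st (starF w))%:E) /\
  (\int[L]_w (st (starF w))%:E = \int[gam]_y (f y)%:E)%E.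
Proof.
move=> intf.
have eqpush (g : R -> \bar R) : measurable_fun setT g -> (forall x, 0 <= g x)%E ->
    (\int[L]_w g (st (starF w)) = \int[gam]_y g (f y))%E.
  move=> mg g0.
  rewrite -[LHS](ge0_integral_pushforward measurable_st_loeb L measurableT mg)//.
  rewrite -[RHS](ge0_integral_pushforward mf gam measurableT mg)//.
  transitivity (\int[pushforward_measure L measurable_st_loeb]_x g x)%E => //.
  transitivity (\int[pushforward_measure gam mf]_x g x)%E => //.
  by apply: eq_measure_integral => A mA _; exact: loeb_st_law.
split.
  apply/integrableP; split.
    by apply/measurable_EFinP; exact: measurable_st_loeb.
  rewrite (eqpush (fun x => `|x%:E|%E)) => //; last first.
    by apply: measurableT_comp => //; exact/measurable_EFinP.
  by have /integrableP[] := intf.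
rewrite integralE [RHS]integralE; congr (_ - _)%E.
- under eq_integral do rewrite funeposE; under [RHS]eq_integral do rewrite funeposE.
  apply: (eqpush (fun x => maxe x%:E 0%E)).
    by apply: measurable_maxe => //; exact/measurable_EFinP.
  by move=> x; rewrite le_max lexx orbT.
- under eq_integral do rewrite funenegE; under [RHS]eq_integral do rewrite funenegE.
  apply: (eqpush (fun x => maxe (- x%:E)%E 0%E)).
    by apply: measurable_maxe => //; apply: measurableT_comp => //; exact/measurable_EFinP.
  by move=> x; rewrite le_max lexx orbT.
Qed.

End loeb_law.

Lemma near_cvge_lt (R : realType) (u : nat -> \bar R) (l e : \bar R) :
  u @ \oo --> l -> (l < e)%E -> \forall n \near \oo, (u n < e)%E.
Proof. by move=> ul le; exact: (ul _ (open_ereal_lt' le)). Qed.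

(** * $S$-integrability of the extension of an $L^p$ function *)

Section star_lp.
Variables (E : nsextension) (R : realType).
Variable sigma : forall n : nat, probability (sphere R n) R.
Hypothesis sigma_rot : forall n, rotation_invariant (sigma n).
Variables (k : nat) (p : R) (p1 : 1 < p) (f : k.-tuple R -> R).
Hypothesis f_Lp : f \in Lfun (std_gaussian R k) p%:E.
Let X := {n & sphere R n}.
Let F (x : X) : R := on_sphere f (projT2 x).

Let mf := measurable_lp f_Lp.

Lemma measurable_on_sphere n : measurable_fun setT (on_sphere f (n:=n)).
Proof. exact: (measurableT_comp mf (@measurable_sphere_proj R k n)). Qed.

Lemma fibre_prob_cvg (B : set R) : measurable B ->
  fibre_prob sigma n (F @^-1` B) @[n --> \oo] --> fine (std_gaussian R k (f @^-1` B)).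
Proof.
move=> mB; apply: (sphere_setwise_cvg sigma_rot p1).
by rewrite -[X in measurable X]setTI; exact: mf.
Qed.

(** Truncated integrals decrease as the threshold grows, so a bound at one [m0], chosen from the
    Gaussian tail before [n] is taken large, serves all [m >= m0] at once. *)
Lemma fibre_tail_le (e : R) : 0 < e -> exists m0 : nat, \forall n \near \oo,
  forall m, (m0 <= m)%N -> `|fibre_tail sigma n F m - 0| <= e.
Proof.
move=> e0.
have [m0 _ tail_e] : \forall m \near \oo, (tail f m < e%:E)%E.
  by apply: (near_cvge_lt (cvg_tail p1 f_Lp)); rewrite lte_fin.
exists m0; have {}tail_e := tail_e m0 (leqnn _).
have := near_cvge_lt (on_sphere_cvg sigma_rot p1 f_Lp (measurable_trunc_tail f_Lp m0%:R)
  (trunc_tail_le f m0%:R)) tail_e.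
apply: filterS => n ne m m0m; rewrite subr0.
have mg : measurable_fun setT (fun t : sphere R n =>
    `|F (existT _ n t)| * \1_[set u : sphere R n | m%:R < `|F (existT _ n u)|] t).
  have mn : measurable_fun setT (fun t : sphere R n => `|on_sphere f t|).
    by apply: measurableT_comp => //; exact: measurable_on_sphere.
  apply: measurable_funM => //; apply: measurable_indic.
  rewrite -[X in measurable X]setTI.
  have := mn measurableT `]m%:R, +oo[%classic (measurable_itv _).
  rewrite (_ : _ @^-1` _ = [set u : sphere R n | m%:R < `|F (existT _ n u)|])//.
  by apply/seteqP; split => u /=; rewrite in_itv/= andbT.
rewrite /fibre_tail /Rintegral ger0_norm; last first.
  by apply: fine_ge0; apply: integral_ge0 => t _; rewrite lee_fin mulr_ge0.
set I := (\int[_]_t _)%E.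
have Ie : (I <= e%:E)%E.
  apply: le_trans (ltW ne); apply: ge0_le_integral => //.
  - by apply/measurable_EFinP.
  - by apply/measurable_EFinP; exact: (measurableT_comp (measurable_trunc_tail f_Lp m0%:R)
      (@measurable_sphere_proj R k n)).
  (* [fibre_tail] cuts at a strict inequality and [trunc_tail] at a weak one; $m < |f|$ and $m_0 \le
     m$ give $m_0 \le |f|$. *)
  move=> t _; rewrite lee_fin /on_sphere /trunc_tail ler_wpM2l// !indicE.
  have [mt|] := boolP (t \in _); last by rewrite ler0n.
  rewrite mem_set//; move: mt; rewrite inE /F /on_sphere/= => /ltW; apply: le_trans.
  by rewrite ler_nat.
have I0 : (0 <= I)%E by apply: integral_ge0 => t _; rewrite lee_fin mulr_ge0.
by rewrite -lee_fin fineK// ge0_fin_numE// (le_lt_trans Ie)// ltry.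
Qed.

Lemma star_S_integrable (N : star E nat) : unlimited N ->
  S_integrable sigma N (star_on_sphere E f).
Proof.
move=> unlN; split.
- have h := (transfer E (FAll nat (FImp
    (Holds (TApp (TCst (fun n => fibre_integrable sigma n F : Prop)) v0))
    (Holds (A2 (fibre_integrable sigma) v0 (TCst F)))))).1.
  apply: h => [n //|]; apply: unlimited_near => //.
  exact: (on_sphere_integrable_near sigma_rot p1).
- apply: (loeb_finite unlN (F := F) (P := sigma) _ mf); last exact: fibre_prob_cvg.
  by move=> n; exact: measurable_on_sphere.
move=> M unlM.
suff h0 : infinitely_close (lift3 (fibre_tail sigma) N (star_on_sphere E f) M) (std 0).
  by split; [exact: infinitely_close_fin h0|exact: stE].
move=> e /fibre_tail_le[m0 tail_e].
(* The bound uniform in [m] is a standard predicate of [n] that holds at [N]; after transfer its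
   inner variable may take the unlimited value [M]. *)
have h := (transfer E (FAll nat (FAll nat
  (FImp (Holds (TApp
    (TCst (fun n => forall m, (m0 <= m)%N -> `|fibre_tail sigma n F m - 0| <= e)) v1))
  (FImp (Holds (A2 (fun a b : nat => a <= b : Prop)%N (TCst m0) v0))
  (Holds (A2 (fun x y : R => x <= y : Prop)
    (A2 (fun x y : R => `|x - y|) (A3 (fibre_tail sigma) v1 (TCst F) v0) (TCst 0))
    (TCst e)))))))).1.
apply: h (unlimited_near unlN tail_e) (unlimited_ge unlM m0) => n m /=.
by rewrite !Defs.trueE => + mm; exact.
Qed.

End star_lp.

Theorem theorem5p8 (E : nsextension) (R : realType)
    (sigma : forall n : nat, probability (sphere R n) R)
    (sigma_rot : forall n, rotation_invariant (sigma n))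
    (k : nat) (p : R) (p_gt1 : 1 < p) (f : k.-tuple R -> R)
    (f_Lp : f \in Lfun (std_gaussian R k) p%:E) :
  [/\ forall N : star E nat, unlimited N ->
        S_integrable sigma N (star_on_sphere E f),
      \forall n \near \oo,
        (sigma n).-integrable [set: sphere R n] (EFin \o on_sphere f (n:=n)),
      exists2 tail : nat -> \bar R,
        forall m : nat,
          (\int[sigma n]_(x in [set x | (m%:R <= `|on_sphere f x|)%R])
             (`|on_sphere f x|)%R%:E)%E @[n --> \oo] --> tail m &
        tail @ \oo --> 0%E,
      (\int[sigma n]_x (on_sphere f x)%:E)%E @[n --> \oo] -->
        (\int[std_gaussian R k]_x (f x)%:E)%E &
      forall N : star E nat, unlimited N ->
        let stf (w : internal_space (sphere R) N) := st (app (star_on_sphere E f) (sval w)) in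
        (loeb sigma N).-integrable setT (EFin \o stf) /\
        (\int[loeb sigma N]_w (stf w)%:E = \int[std_gaussian R k]_x (f x)%:E)%E ].
Proof.
have mf := measurable_lp f_Lp.
split.
- by move=> N unlN; exact: (star_S_integrable sigma_rot p_gt1 f_Lp unlN).
- exact: (on_sphere_integrable_near sigma_rot p_gt1).
- exists (tail f); first by move=> m; exact: (cvg_tail_sphere sigma_rot p_gt1 f_Lp).
  exact: (cvg_tail p_gt1 f_Lp).
- exact: (on_sphere_cvg sigma_rot p_gt1 f_Lp mf).
- move=> N unlN stf.
  apply: (loeb_st_integral unlN (F := fun x => on_sphere f (projT2 x)) (P := sigma) _ mf).
  + by move=> n; exact: (measurable_on_sphere f_Lp).
  + exact: (fibre_prob_cvg sigma_rot p_gt1 f_Lp).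
  + exact: (integrable_lp p_gt1).
Qed.
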